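(* Let $X$ be an arbitrary topological space and let $\mathcal A=(\mathcal A_x)_{x\in X}$, $\mathcal A\colon X\to\mathcal R_K^{\mathrm{sa}}(H)$, be a Riesz continuous family of regular self-adjoint operators with compact resolvents on $H$. Then the following three conditions are equivalent: (1) $\mathcal A$ has a spectral section; (2) $\mathcal A$ has a generalized spectral section; (3) $\mathcal A$ is homotopic, via a Riesz continuous homotopy $X\times[0,1]\to\mathcal R_K^{\mathrm{sa}}(H)$, to a family of invertible operators. Moreover, if $P$ is a generalized spectral section for $\mathcal A$ and $\varepsilon>0$, then a spectral section $Q$ for $\mathcal A$ can be chosen so that $\|Q-P\|_\infty=\sup_{x\in X}\|Q_x-P_x\|<\varepsilon$ and $Q$ is homotopic to $P$ as a generalized spectral section (that is, through a norm continuous homotopy $X\times[0,1]\to\mathcal P(H)$ each stage of which is a generalized spectral section for $\mathcal A$).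
   Context: $H$ is a separable complex Hilbert space of infinite dimension. A regular operator on $H$ is a closed densely defined linear operator; $\mathcal R(H)$ is the set of these. $\mathcal R_K^{\mathrm{sa}}(H)$ is the set of regular self-adjoint operators $A$ on $H$ with compact resolvents, i.e. with $(A+i)^{-1}$ compact. The bounded transform is $f(A)=A(1+A^*A)^{-1/2}$; the Riesz topology on $\mathcal R(H)$ is the topology induced by $f\colon\mathcal R(H)\to\mathcal B(H)$ from the norm topology; Riesz continuous means continuous with respect to it. $\mathcal P(H)$ is the space of orthogonal projections with the norm topology, partially ordered in the usual way. $\mathbb 1_S$ is the characteristic function of $S\subset\mathbb R$. $\mathbb R_+=(0,\infty)$. For $r>0$, a projection $P$ is an $r$-spectral section for $A\in\mathcal R_K^{\mathrm{sa}}(H)$ if $\mathbb 1_{[r,+\infty)}(A)\le P\le\mathbb 1_{(-r,+\infty)}(A)$. A spectral section for a family $\mathcal A=(\mathcal A_x)_{x\in X}$ is a norm continuous family $P=(P_x)_{x\in X}$ of projections for which there is a continuous function $r\colon X\to\mathbb R_+$ (the cut-off function) such that $P_x$ is an $r_x$-spectral section for $\mathcal A_x$ for every $x\in X$. A generalized spectral section for $\mathcal A$ is a norm continuous family $P=(P_x)_{x\in X}$ of projections such that $P_x-\mathbb 1_{[0,+\infty)}(\mathcal A_x)$ is compact for every $x\in X$. *)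

(* Defs.v *)
From HB Require Import structures.
From mathcomp Require Import all_boot all_order all_algebra.
From mathcomp Require Import sesquilinear complex.
From mathcomp Require Import all_classical all_reals all_analysis.

Set Implicit Arguments.
Unset Strict Implicit.
Unset Printing Implicit Defensive.

Import Order.TTheory GRing.Theory Num.Def Num.Theory.
Import numFieldNormedType.Exports.

Local Open Scope classical_set_scope.
Local Open Scope ring_scope.
Local Open Scope complex_scope.

(* As for every [{dot _ for _}], the inner product is linear in its first
   argument and conjugate-linear in the second one. *)
HB.mixin Record CompleteNormedModule_isHilbert (R : realType) H
    & CompleteNormedModule R[i] H := {
  inner : {dot H for (@Num.conj R[i])} ;
  sqr_norm_inner : forall x : H, `|x| ^+ 2 = (inner : H -> H -> R[i]) x x }.

#[short(type="hilbertType")]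
HB.structure Definition Hilbert (R : realType) :=
  {H of CompleteNormedModule R[i] H & CompleteNormedModule_isHilbert R H}.

Definition dotp (R : realType) (H : hilbertType R) (x y : H) : R[i] :=
  (inner : {dot H for (@Num.conj R[i])}) x y.

Definition separable_space (T : topologicalType) :=
  exists2 D : set T, countable D & dense D.

Definition infinite_dimensional (K : fieldType) (V : lmodType K) :=
  forall (n : nat) (v : 'I_n -> V),
    exists x : V, forall c : 'I_n -> K, x <> \sum_(i < n) c i *: v i.

Section bounded_operators.
Variables (R : realType) (H : hilbertType R).

Definition is_bop : {pred H -> H} :=
  fun T => `[< linear T /\ continuous T >].

Lemma is_bop_submod : submod_closed is_bop.
Proof.
split.
  apply/asboolP; split; first by move=> a x y; rewrite /= scaler0 addr0.
  by move=> x; exact: cvg_cst.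
move=> a S T /asboolP[Sl Sc] /asboolP[Tl Tc]; apply/asboolP; split.
  move=> b x y; rewrite !fctE Sl Tl !scalerDr !scalerA (mulrC b a).
  by rewrite addrACA.
move=> x; apply: (@cvgD _ H _ (nbhs x)) (Tc x).
apply: cvgZl_tmp; exact: Sc.
Qed.

HB.instance Definition _ :=
  GRing.isSubmodClosed.Build R[i] (H -> H) is_bop is_bop_submod.

Record bop : Type := Bop { bop_fun :> H -> H ; _ : bop_fun \in is_bop }.

HB.instance Definition _ := [isSub for bop_fun].
HB.instance Definition _ := [Choice of bop by <:].
HB.instance Definition _ := [SubChoice_isSubLmodule of bop by <:].

Definition opnorm (T : bop) : R :=
  sup [set complex.Re `|T x| | x in [set x : H | `|x| <= 1]].

Lemma bop_linear (T : bop) : linear T.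
Proof. by have /asboolP[] := valP T. Qed.

Lemma bop_continuous (T : bop) : continuous T.
Proof. by have /asboolP[] := valP T. Qed.

HB.instance Definition _ (T : bop) :=
  GRing.isLinear.Build R[i] H H *:%R T (@bop_linear T).

Lemma bop_bounded (T : bop) :
  exists2 M : R, 0 <= M & forall x, `|T x| <= M%:C * `|x|.
Proof.
have /linear_bounded_continuous/linear_boundedP/pinfty_ex_gt0[M M0 TM] :=
  @bop_continuous T.
have MR := gtr0_real M0; exists (complex.Re M) => [|x].
  by rewrite -ler0c RRe_real//; exact: ltW.
by rewrite RRe_real//; exact: TM.
Qed.

Lemma opnorm_has_sup (T : bop) :
  has_sup [set complex.Re `|T x| | x in [set x : H | `|x| <= 1]].
Proof.
split; first by exists (complex.Re `|T 0|), 0 => //=; rewrite normr0.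
have [M M0 TM] := bop_bounded T; exists M => _ [x /= x1 <-].
rewrite -lecR RRe_real ?normr_real// (le_trans (TM x))//.
by rewrite ler_piMr// ler0c.
Qed.

Lemma opnorm_ge0 (T : bop) : 0 <= opnorm T.
Proof.
apply: (@le_trans _ _ (complex.Re `|T 0|)).
  by rewrite -ler0c RRe_real ?normr_real.
apply: sup_ubound; first exact: (opnorm_has_sup T).2.
by exists 0 => //=; rewrite normr0.
Qed.

Lemma opnormP (T : bop) x : `|T x| <= (opnorm T)%:C * `|x|.
Proof.
have [->|x0] := eqVneq x 0; first by rewrite linear0 !normr0 mulr0.
have nx0 : 0 < `|x| by rewrite normr_gt0.
rewrite -ler_pdivrMr//.
have -> : `|T x| / `|x| = `|T (`|x|^-1 *: x)|.
  by rewrite linearZ normrZ normfV normr_id mulrC.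
rewrite -[leLHS]RRe_real ?normr_real// lecR.
apply: sup_ubound; first exact: (opnorm_has_sup T).2.
by exists (`|x|^-1 *: x) => //=; rewrite normrZ normfV normr_id mulVf ?gt_eqF.
Qed.

Lemma opnorm_le (T : bop) (M : R) :
  (forall x, `|x| <= 1 -> `|T x| <= M%:C) -> opnorm T <= M.
Proof.
move=> TM; apply: ge_sup; first exact: (opnorm_has_sup T).1.
by move=> _ [x /= x1 <-]; rewrite -lecR RRe_real ?normr_real//; exact: TM.
Qed.

Let norm_bop (T : bop) : R[i] := (opnorm T)%:C.

Let norm_bopD (S T : bop) : norm_bop (S + T) <= norm_bop S + norm_bop T.
Proof.
rewrite /norm_bop -rmorphD/= lecR; apply: opnorm_le => x x1.
rewrite (le_trans (ler_normD _ _))// rmorphD lerD// (le_trans (opnormP _ _))//.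
  by rewrite ler_piMr// ler0c opnorm_ge0.
by rewrite ler_piMr// ler0c opnorm_ge0.
Qed.

Let norm_bopZ_le (l : R[i]) (T : bop) :
  norm_bop (l *: T) <= `|l| * norm_bop T.
Proof.
have lE : (complex.Re `|l|)%:C = `|l| by rewrite RRe_real ?normr_real.
have lM : (complex.Re `|l| * opnorm T)%:C = `|l| * (opnorm T)%:C.
  by rewrite -[in RHS]lE -rmorphM.
rewrite /norm_bop -lM lecR; apply: opnorm_le => x x1; rewrite lM.
rewrite [X in `|X|](_ : _ = l *: T x)// normrZ.
rewrite ler_wpM2l// (le_trans (opnormP _ _))//.
by rewrite ler_piMr// ler0c opnorm_ge0.
Qed.

Let norm_bopZ (l : R[i]) (T : bop) : norm_bop (l *: T) = `|l| * norm_bop T.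
Proof.
apply/le_anti; rewrite norm_bopZ_le/=.
have [->|l0] := eqVneq l 0; first by rewrite normr0 mul0r ler0c opnorm_ge0.
have := norm_bopZ_le l^-1 (l *: T); rewrite scalerA mulVf// scale1r normfV.
by rewrite ler_pdivlMl ?normr_gt0.
Qed.

Let norm_bop_eq0 (T : bop) : norm_bop T = 0 -> T = 0.
Proof.
move=> T0; apply/val_inj/funext => x /=; apply/eqP; rewrite -normr_le0.
by rewrite (le_trans (opnormP T x))// [X in X * _]T0 mul0r.
Qed.

(* |T| = (opnorm T)%:C, and the topology is the one of the operator norm *)
HB.instance Definition _ := Lmodule_isNormed.Build R[i] bop
  norm_bopD norm_bopZ norm_bop_eq0.

End bounded_operators.

Lemma norm_bopE (R : realType) (H : hilbertType R) (T : bop H) :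
  `|T| = (opnorm T)%:C.
Proof. by []. Qed.

Section bounded_operator_notions.
Variables (R : realType) (H : hilbertType R).

Definition compact_op (T : bop H) : Prop :=
  compact (closure (T @` [set x : H | `|x| <= 1])).

Definition positive_op (T : bop H) : Prop := forall x, 0 <= dotp (T x) x.

Definition op_le (S T : bop H) : Prop :=
  forall x, dotp (S x) x <= dotp (T x) x.

Definition orthogonal_projection (P : bop H) : Prop :=
  (forall x, P (P x) = P x) /\ (forall x y, dotp (P x) y = dotp x (P y)).

Definition projections : set (bop H) := [set P | orthogonal_projection P].

End bounded_operator_notions.

Section graphs.
Variables (R : realType) (H : hilbertType R).
Implicit Types G : set (H * H).

Definition domain G : set H := [set x | exists y, G (x, y)].

Definition operator_graph G : Prop :=
  [/\ G (0, 0),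
      forall (a : R[i]) p q, G p -> G q -> G (a *: p + q) &
      forall x y z, G (x, y) -> G (x, z) -> y = z].

Definition is_regular G : Prop :=
  [/\ operator_graph G, closed G & dense (domain G)].

(* (y, z) belongs to the graph of A^* iff <A x, y> = <x, z> on the domain *)
Definition adjoint G : set (H * H) :=
  [set q | forall p, G p -> dotp p.2 q.1 = dotp p.1 q.2].

Definition comp_graph G' G : set (H * H) :=
  [set p | exists y, G (p.1, y) /\ G' (y, p.2)].

Definition shift_graph (a : R[i]) G : set (H * H) :=
  [set p | G (p.1, p.2 - a *: p.1)].

Definition bounded_inverse G (T : bop H) : Prop :=
  forall x y, G (x, y) <-> T y = x.

Record regop : Type := Regop {
  graph :> set (H * H) ;
  regopP : is_regular graph }.

HB.instance Definition _ := gen_eqMixin regop.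
HB.instance Definition _ := gen_choiceMixin regop.

(* F = A (1 + A^* A)^{-1/2}, where (1 + A^* A)^{-1/2} is the positive bounded
   operator S such that S o S is the inverse of 1 + A^* A *)
Definition is_bounded_transform (A : regop) (F : bop H) : Prop :=
  exists S : bop H,
    [/\ positive_op S,
        forall x y, shift_graph 1 (comp_graph (adjoint A) A) (x, y) <->
                    S (S y) = x &
        forall x, graph A (S x, F x)].

Definition bounded_transform (A : regop) : bop H :=
  get [set F | is_bounded_transform A F].

(* The Riesz topology. *)
HB.instance Definition _ :=
  Topological.copy regop (initial_topology bounded_transform).

Definition self_adjoint (A : regop) : Prop := adjoint A = A.

Definition compact_resolvents (A : regop) : Prop :=
  exists2 T : bop H, bounded_inverse (shift_graph 'i A) T & compact_op T.

Definition invertible (A : regop) : Prop :=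
  exists T : bop H, bounded_inverse A T.

Definition RKsa : set regop :=
  [set A | self_adjoint A /\ compact_resolvents A].

Definition projection_valued_measure (E : set R -> bop H) : Prop :=
  [/\ forall S, measurable S -> orthogonal_projection (E S),
      forall x, E setT x = x &
      forall F : (set R)^nat, (forall n, measurable (F n)) ->
        trivIset setT F -> forall x,
        (fun n => \sum_(0 <= k < n) E (F k) x) @ \oo --> E (\bigcup_n F n) x].

(* A is the integral of the identity of R against E: its domain consists of the
   x such that t^2 is integrable against the measure <E(.)x, x>, and <A x, x>
   is then the integral of t against this measure (the values <A x, y> follow
   by polarization) *)
Definition is_spectral_measure (A : regop) (E : set R -> bop H) : Prop :=
  projection_valued_measure E /\
  forall x, exists mu : {measure set R -> \bar R},
    [/\ forall S, measurable S -> (mu S) = (complex.Re (dotp (E S x) x))%:E,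
        domain A x <-> (\int[mu]_t (t ^+ 2)%:E < +oo)%E &
        forall y, graph A (x, y) -> dotp y x = (\int[mu]_t t)%:C].

(* \mathbb 1_S(A); the spectral theorem says that [get] picks an E whose values
   on measurable sets are determined by A *)
Definition spectral_projection (S : set R) (A : regop) : bop H :=
  (get [set E | is_spectral_measure A E]) S.

End graphs.

Arguments projections {R} H.
Arguments RKsa {R} H.

Definition unit_interval (R : realType) : set R := `[0, 1]%classic.

Arguments unit_interval : clear implicits.

Section spectral_sections.
Variables (R : realType) (H : hilbertType R) (X : topologicalType).
Implicit Types (A : X -> RKsa H) (P Q : X -> projections H).

Definition spectral_section_at (r : R) (A : regop H) (P : bop H) : Prop :=
  op_le (spectral_projection `[r, +oo[ A) P /\
  op_le P (spectral_projection `]-r, +oo[ A).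

Definition spectral_section A P : Prop :=
  continuous P /\
  exists r : X -> R, [/\ continuous r, forall x, 0 < r x &
    forall x, spectral_section_at (r x) (val (A x)) (val (P x))].

Definition generalized_spectral_section A P : Prop :=
  continuous P /\
  forall x,
    compact_op (val (P x) - spectral_projection `[0, +oo[ (val (A x))).

Definition homotopic_to_invertible A : Prop :=
  exists h : X * unit_interval R -> RKsa H,
    [/\ continuous h,
        forall x (t : unit_interval R), val t = 0 -> h (x, t) = A x &
        forall x (t : unit_interval R), val t = 1 -> invertible (val (h (x, t)))].

Definition homotopic_as_generalized A Q P : Prop :=
  exists h : X * unit_interval R -> projections H,
    [/\ continuous h,
        forall t, generalized_spectral_section A (fun x => h (x, t)),
        forall x (t : unit_interval R), val t = 0 -> h (x, t) = Q x &
        forall x (t : unit_interval R), val t = 1 -> h (x, t) = P x].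

Definition sup_dist Q P : \bar R :=
  ereal_sup [set (opnorm (val (Q x) - val (P x)))%:E | x in [set: X]].

End spectral_sections.

(* Main.v *)
Require Import Defs.
From HB Require Import structures.
From mathcomp Require Import all_boot all_order all_algebra.
From mathcomp Require Import sesquilinear complex.
From mathcomp Require Import all_classical all_reals all_analysis.
From mathcomp Require Import measurable_realfun ring lra.

Set Implicit Arguments.
Unset Strict Implicit.
Unset Printing Implicit Defensive.

Import Order.TTheory GRing.Theory Num.Theory.
Import numFieldNormedType.Exports.

Local Open Scope classical_set_scope.
Local Open Scope ring_scope.
Local Open Scope complex_scope.

(* Everything is expressed through the bounded transform F = f(A): it is
   self-adjoint, 1 - F^2 = (1 + A^2)^-1 is compact and injective, and conversely
   every such F is some f(A). A generalized spectral section is then a projection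
   P congruent to (1 + F) / 2 modulo compact operators.

   Given P, put E = 1_{[0, +oo)}(A) and let c be a cut-off of A equal to 1 on a
   large interval and vanishing outside a larger one. Then
   T = (1 - c^2) E + c P c agrees with E where c vanishes, and
   T - P = c (P - E) c - (P - E) is small since P - E is compact. The projection
   onto the part of T near 1, obtained from T by Newton iteration, is a spectral
   section close to P. The size of the interval is made continuous in x by taking
   a 1-Lipschitz function for the pseudometric |F_x - F_y| + |P_x - P_y|, so no
   paracompactness of X is needed.

   The homotopy (1 - t/2) F + (t/2) (2P - 1) leads to an invertible family: it
   stays in the image of f, and at t = 1 it is injective because
   |F v| < |v| = |(2P - 1) v| for v <> 0. Conversely, the positive spectral
   projections at the invertible end of a homotopy are transported back in finitely
   many steps, adding (F_{t'} - F_t) / 2 and correcting to a projection by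
   Newton iteration. *)

(** * Norms with real values, inner products *)

(** Both f(A) and 1_S(A) are values of [get], so nothing can be computed before they are identified
    on an eigenbasis of A: f(A) through the positivity of the square root in its definition, 1_S(A)
    through the values that any spectral measure of A must take on eigenvectors. From then on a
    question about one operator is a question about its eigenvalues.

    The obstacle is the dependence on x. Eigenbases need not vary continuously with x, and 1_{[0,
    +oo)}(A_x) jumps when an eigenvalue crosses 0. Continuity therefore comes from operator norm
    estimates. The cut-offs are piecewise linear, hence combinations of absolute values, and |S -
    T|^2 <= |S^2 - T^2| for positive S, T makes the absolute value continuous; the discontinuous
    projection only enters with a factor 1 - c, which allows a continuous function of F_x in its
    place. Newton iteration serves the same end: it is algebraic in T and converges uniformly. *)

Lemma ltr0c (R : rcfType) (r : R) : (0 < r%:C) = (0 < r).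
Proof. exact: ltcR. Qed.

Section real_norm.
Variables (R : realType) (V : normedModType R[i]).
Implicit Types (v w : V) (a : R[i]).

(** Norms take values in R[i]; their real part allows order reasoning, [lra] and [nra] to work in
    R. *)
Definition nrm v : R := complex.Re `|v|.

Lemma nrmE v : `|v| = (nrm v)%:C.
Proof. by rewrite /nrm RRe_real ?normr_real. Qed.

Lemma nrm_ge0 v : 0 <= nrm v.
Proof. by rewrite -ler0c -nrmE. Qed.

Lemma nrm0 : nrm (0 : V) = 0.
Proof. by rewrite /nrm normr0. Qed.

Lemma nrm_eq0 v : (nrm v == 0) = (v == 0).
Proof. by rewrite -[RHS]normr_eq0 nrmE -(inj_eq (@complexI R)). Qed.

Lemma nrm_gt0 v : (0 < nrm v) = (v != 0).
Proof. by rewrite lt_neqAle nrm_ge0 andbT eq_sym nrm_eq0. Qed.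

Lemma nrmN v : nrm (- v) = nrm v.
Proof. by rewrite /nrm normrN. Qed.

Lemma nrmBC v w : nrm (v - w) = nrm (w - v).
Proof. by rewrite -nrmN opprB. Qed.

Lemma nrmD v w : nrm (v + w) <= nrm v + nrm w.
Proof. by rewrite -lecR rmorphD /= -!nrmE ler_normD. Qed.

Lemma nrmB v w : nrm (v - w) <= nrm v + nrm w.
Proof. by rewrite -[nrm w]nrmN nrmD. Qed.

Lemma nrm_dist u v w : nrm (u - w) <= nrm (u - v) + nrm (v - w).
Proof. by apply: le_trans (nrmD _ _); rewrite addrA subrK. Qed.

Lemma nrm_distB v w : nrm v - nrm w <= nrm (v - w).
Proof. by rewrite lerBlDr -{1}(subrK w v) nrmD. Qed.

Lemma nrmZ a v : nrm (a *: v) = complex.Re `|a| * nrm v.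
Proof.
apply: complexI; rewrite rmorphM /= -[LHS]nrmE normrZ.
by rewrite (nrmE v) RRe_real ?normr_real.
Qed.

Lemma nrmZr (r : R) v : nrm (r%:C *: v) = `|r| * nrm v.
Proof. by rewrite nrmZ normc_def/= expr0n addr0 sqrtr_sqr. Qed.

Lemma nrm_le v (M : R) : (nrm v <= M) = (`|v| <= M%:C).
Proof. by rewrite nrmE lecR. Qed.

Lemma cvg_nrmP (T : Type) (F : set_system T) {FF : Filter F} (f : T -> V) (l : V) :
  f @ F --> l <-> forall e : R, 0 < e -> \forall x \near F, nrm (l - f x) < e.
Proof.
split=> [/cvgrPdist_lt fl e e0|fl].
  have := fl e%:C; rewrite ltr0c => /(_ e0).
  by apply: filterS => x; rewrite nrmE ltcR.
apply/cvgrPdist_lt => e e0.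
have eR : e = (complex.Re e)%:C by rewrite RRe_real ?gtr0_real.
move: e0; rewrite eR ltr0c => e0.
by apply: filterS (fl _ e0) => x; rewrite nrmE ltcR.
Qed.

Lemma cvg_nrm_le (T : Type) (F : set_system T) {FF : Filter F} (f : T -> V) (l : V)
    (g : T -> R) :
  (forall x, nrm (f x - l) <= g x) -> g @ F --> (0 : R) -> f @ F --> l.
Proof.
move=> fg /cvgr0Pnorm_lt g0; apply/cvg_nrmP => e e0.
apply: filterS (g0 _ e0) => x gx; rewrite nrmBC.
by apply: le_lt_trans (fg x) _; exact: le_lt_trans (ler_norm _) gx.
Qed.

Lemma nrm_cvg (T : Type) (F : set_system T) {FF : Filter F} (f : T -> V) (l : V) :
  f @ F --> l -> nrm \o f @ F --> nrm l.
Proof.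
move=> /cvg_nrmP fl; apply/cvgrPdist_lt => e e0.
apply: filterS (fl e e0) => x /= fx.
apply: le_lt_trans fx; rewrite ler_norml nrm_distB andbT.
by rewrite lerNl opprB nrmBC nrm_distB.
Qed.

Lemma cvgZr_real (T : Type) (F : set_system T) {FF : Filter F} (r : T -> R) (r0 : R)
    (f : T -> V) (l : V) :
  r @ F --> r0 -> f @ F --> l -> (fun x => (r x)%:C *: f x) @ F --> r0%:C *: l.
Proof.
move=> rr fl; apply: cvgZ => //.
apply/cvgrPdist_lt => e e0.
have eR : e = (complex.Re e)%:C by rewrite RRe_real ?gtr0_real.
move: e0; rewrite eR ltr0c => e0.
move/cvgrPdist_lt : rr => /(_ _ e0); apply: filterS => x.
by rewrite -rmorphB normc_def /= expr0n addr0 sqrtr_sqr ltcR.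
Qed.

End real_norm.

Lemma nrm_cauchy_cvg (R : realType) (V : completeNormedModType R[i]) (f : nat -> V) :
  (forall e : R, 0 < e -> exists N, forall m n, (N <= m)%N -> (N <= n)%N ->
    nrm (f m - f n) < e) -> cvgn f.
Proof.
move=> fc; apply/cauchy_cvgP/cauchy_ballP => e e0.
have eR : e = (complex.Re e)%:C by rewrite RRe_real ?gtr0_real.
move: e0; rewrite eR ltr0c => e0.
have [N NP] := fc _ e0.
pose B : set V := [set v | exists2 n, (N <= n)%N & v = f n].
have BF : (f @ \oo) B by exists N => // n /= Nn; exists n.
exists (B, B) => //= -[_ _] [/= [m Nm ->] [n Nn ->]].
by rewrite -ball_normE /= nrmE ltcR; exact: NP.
Qed.

Lemma cvg_sqr (R : realType) (I : Type) (F : set_system I) {FF : Filter F}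
    (f : I -> R) (l : R) : f @ F --> l -> (fun i => f i ^+ 2) @ F --> l ^+ 2.
Proof.
by move=> fl; rewrite expr2; under eq_fun do rewrite expr2; exact: cvgM.
Qed.

Section inner_product.
Variables (R : realType) (H : hilbertType R).
Implicit Types (x y z : H) (a : R[i]).

Lemma dotpC x y : dotp x y = Num.conj (dotp y x).
Proof. by rewrite /dotp [LHS]hermC expr0 mul1r. Qed.

Lemma dotpDl x y z : dotp (x + y) z = dotp x z + dotp y z.
Proof. by rewrite /dotp linearDl. Qed.

Lemma dotpZl a x y : dotp (a *: x) y = a * dotp x y.
Proof. by rewrite /dotp linearZl_LR. Qed.

Lemma dotpDr x y z : dotp x (y + z) = dotp x y + dotp x z.
Proof. by rewrite dotpC dotpDl rmorphD /= -!dotpC. Qed.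

Lemma dotpZr a x y : dotp x (a *: y) = Num.conj a * dotp x y.
Proof. by rewrite dotpC dotpZl rmorphM /= -dotpC. Qed.

Lemma dotp0l x : dotp 0 x = 0.
Proof. by rewrite -(scale0r x) dotpZl mul0r. Qed.

Lemma dotp0r x : dotp x 0 = 0.
Proof. by rewrite dotpC dotp0l rmorph0. Qed.

Lemma dotpNl x y : dotp (- x) y = - dotp x y.
Proof. by rewrite -scaleN1r dotpZl mulN1r. Qed.

Lemma dotpNr x y : dotp x (- y) = - dotp x y.
Proof. by rewrite dotpC dotpNl rmorphN /= -dotpC. Qed.

Lemma dotpBl x y z : dotp (x - y) z = dotp x z - dotp y z.
Proof. by rewrite dotpDl dotpNl. Qed.

Lemma dotp_suml I (s : seq I) (P : pred I) (F : I -> H) y :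
  dotp (\sum_(i <- s | P i) F i) y = \sum_(i <- s | P i) dotp (F i) y.
Proof. by elim/big_ind2: _ => [|u a v b <- <-|//]; rewrite ?dotp0l ?dotpDl. Qed.

Lemma dotp_sumr I (s : seq I) (P : pred I) (F : I -> H) y :
  dotp y (\sum_(i <- s | P i) F i) = \sum_(i <- s | P i) dotp y (F i).
Proof. by elim/big_ind2: _ => [|u a v b <- <-|//]; rewrite ?dotp0r ?dotpDr. Qed.

Lemma dotp_nrm x : dotp x x = (nrm x ^+ 2)%:C.
Proof. by rewrite /dotp -sqr_norm_inner nrmE rmorphXn. Qed.

Definition rdot x y : R := complex.Re (dotp x y).

Lemma complexRe_conj (a : R[i]) : complex.Re (Num.conj a) = complex.Re a.
Proof. by case: a. Qed.

Lemma complexReD (a b : R[i]) : complex.Re (a + b) = complex.Re a + complex.Re b.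
Proof. by case: a b => ? ? []. Qed.

Lemma complexReMr (r : R) (a : R[i]) : complex.Re (r%:C * a) = r * complex.Re a.
Proof. by case: a => ? ? /=; rewrite mul0r subr0. Qed.

Lemma rdotC x y : rdot x y = rdot y x.
Proof. by rewrite /rdot dotpC complexRe_conj. Qed.

Lemma rdotDl x y z : rdot (x + y) z = rdot x z + rdot y z.
Proof. by rewrite /rdot dotpDl complexReD. Qed.

Lemma rdotDr x y z : rdot x (y + z) = rdot x y + rdot x z.
Proof. by rewrite /rdot dotpDr complexReD. Qed.

Lemma rdotZl (r : R) x y : rdot (r%:C *: x) y = r * rdot x y.
Proof. by rewrite /rdot dotpZl complexReMr. Qed.

Lemma rdotZr (r : R) x y : rdot x (r%:C *: y) = r * rdot x y.
Proof. by rewrite rdotC rdotZl rdotC. Qed.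

Lemma rdotNl x y : rdot (- x) y = - rdot x y.
Proof. by rewrite /rdot dotpNl raddfN. Qed.

Lemma rdotNr x y : rdot x (- y) = - rdot x y.
Proof. by rewrite rdotC rdotNl rdotC. Qed.

Lemma rdotBl x y z : rdot (x - y) z = rdot x z - rdot y z.
Proof. by rewrite rdotDl rdotNl. Qed.

Lemma rdotBr x y z : rdot x (y - z) = rdot x y - rdot x z.
Proof. by rewrite rdotDr rdotNr. Qed.

Lemma rdot0l x : rdot 0 x = 0.
Proof. by rewrite /rdot dotp0l. Qed.

Lemma rdot0r x : rdot x 0 = 0.
Proof. by rewrite /rdot dotp0r. Qed.

Lemma rdot_nrm x : rdot x x = nrm x ^+ 2.
Proof. by rewrite /rdot dotp_nrm. Qed.

Lemma nrm_sqrD x y : nrm (x + y) ^+ 2 = nrm x ^+ 2 + 2 * rdot x y + nrm y ^+ 2.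
Proof.
by rewrite -!rdot_nrm !rdotDl !rdotDr (rdotC y x); ring.
Qed.

Lemma nrm_sqrB x y : nrm (x - y) ^+ 2 = nrm x ^+ 2 - 2 * rdot x y + nrm y ^+ 2.
Proof. by rewrite nrm_sqrD rdotNr nrmN; ring. Qed.

(** Expand |(|y| x - |x| y)|^2 >= 0, which equals 2 |x| |y| (|x| |y| - Re <x, y>). *)
Lemma rdot_le x y : rdot x y <= nrm x * nrm y.
Proof.
have [->|y0] := eqVneq y 0; first by rewrite rdot0r nrm0 mulr0.
have [->|x0] := eqVneq x 0; first by rewrite rdot0l nrm0 mul0r.
have := sqr_ge0 (nrm ((nrm y)%:C *: x - (nrm x)%:C *: y)).
rewrite nrm_sqrB !nrmZr rdotZl rdotZr !ger0_norm ?nrm_ge0//.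
set s := nrm x; set t := nrm y; set r := rdot x y => h.
have : 0 <= 2 * (s * t) * (s * t - r) by nra.
rewrite pmulr_rge0 ?subr_ge0// mulr_gt0// mulr_gt0//.
  by rewrite nrm_gt0.
by rewrite nrm_gt0.
Qed.

Lemma rdot_norm_le x y : `|rdot x y| <= nrm x * nrm y.
Proof. by rewrite ler_norml rdot_le lerNl -rdotNl -(nrmN x) rdot_le. Qed.

(** Conjugate-linearity in the second argument gives <x, i y> = - i <x, y>, so two real inner
    products determine the complex one. *)
Lemma Im_dotp x y : complex.Im (dotp x y) = rdot x ('i *: y).
Proof.
by rewrite /rdot dotpZr; case: (dotp x y) => a b /=; ring.
Qed.

Lemma dotp_rdot_eq x y x' y' :
  rdot x y = rdot x' y' -> rdot x ('i *: y) = rdot x' ('i *: y') ->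
  dotp x y = dotp x' y'.
Proof.
rewrite -!Im_dotp /rdot; case: (dotp x y) (dotp x' y') => a b [c d] /=.
by move=> -> ->.
Qed.

(** Together with [bopP], this reduces an identity between noncommuting operators to one between
    real numbers: each word applied to a vector and paired with z becomes an atom for [ring]. *)
Lemma rdot_ext x y : (forall z, rdot x z = rdot y z) -> x = y.
Proof.
move=> h; apply/eqP; rewrite -subr_eq0 -nrm_eq0 -sqrf_eq0 -rdot_nrm.
by rewrite rdotBl h subrr.
Qed.

(** Multiplying x by the conjugate of z = <x, y> makes the inner product equal to |z|^2, so the real
    Cauchy-Schwarz inequality applies. *)
Lemma dotp_norm_le x y : complex.Re `|dotp x y| <= nrm x * nrm y.
Proof.
set z := dotp x y; set n := complex.Re `|z|.
have n0 : 0 <= n by rewrite -ler0c /n RRe_real ?normr_real.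
have : n ^+ 2 <= n * (nrm x * nrm y).
  have -> : n ^+ 2 = rdot (Num.conj z *: x) y.
    rewrite /rdot dotpZl -/z mulrC -normCK /n normc_def /=; ring.
  apply: (le_trans (rdot_le _ _)); rewrite nrmZ mulrA ler_wpM2r ?nrm_ge0//.
  rewrite ler_wpM2r ?nrm_ge0//.
  by rewrite /n norm_conjC.
have [->|n1] := eqVneq n 0; first by rewrite mulr_ge0 ?nrm_ge0.
by rewrite expr2 ler_pM2l// lt_neqAle eq_sym n1.
Qed.

Lemma cvg_rdotl (T : Type) (F : set_system T) {FF : Filter F} (f : T -> H) (l y : H) :
  f @ F --> l -> (fun t => rdot (f t) y) @ F --> rdot l y.
Proof.
move=> /cvg_nrmP fl; apply/cvgrPdist_lt => e e0.
have y1 : 0 < nrm y + 1 by rewrite ltr_wpDl ?nrm_ge0.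
have := fl (e / (nrm y + 1)); rewrite divr_gt0// => /(_ isT).
apply: filterS => t ft; rewrite -rdotBl.
apply: (le_lt_trans (rdot_norm_le _ _)).
apply: (@le_lt_trans _ _ (nrm (l - f t) * (nrm y + 1))).
  by rewrite ler_wpM2l ?nrm_ge0// lerDl.
by rewrite -ltr_pdivlMr.
Qed.

(** Used to pass from partial sums along a basis to arbitrary vectors. *)
Lemma cvg_dotp_eq (f g : nat -> H) (u v x y : H) :
  (forall n, dotp (f n) x = dotp (g n) y) -> f @ \oo --> u -> g @ \oo --> v ->
  dotp u x = dotp v y.
Proof.
move=> fg fu gv.
have lim z w : (forall n, rdot (f n) z = rdot (g n) w) -> rdot u z = rdot v w.
  move=> fgzw; have fz : (fun n => rdot (f n) z) @ \oo --> rdot u z by exact: cvg_rdotl.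
  have gw : (fun n => rdot (g n) w) @ \oo --> rdot v w by exact: cvg_rdotl.
  have E : (fun n => rdot (f n) z) = (fun n => rdot (g n) w) by exact/funext.
  by rewrite E in fz; rewrite -(cvg_lim (@Rhausdorff R) fz) -(cvg_lim (@Rhausdorff R) gw).
apply: dotp_rdot_eq; apply: lim => n; first by rewrite /rdot fg.
by rewrite /rdot !dotpZr fg.
Qed.

End inner_product.

(** * The algebra of bounded operators *)
Section bounded_operator_algebra.
Variables (R : realType) (H : hilbertType R).
Implicit Types (S T : bop H) (x y : H).

Lemma bopDE S T x : (S + T) x = S x + T x. Proof. by []. Qed.
Lemma bopNE S x : (- S) x = - S x. Proof. by []. Qed.
Lemma bopBE S T x : (S - T) x = S x - T x. Proof. by []. Qed.
Lemma bopZE (a : R[i]) S x : (a *: S) x = a *: S x. Proof. by []. Qed.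
Lemma bop0E x : (0 : bop H) x = 0. Proof. by []. Qed.

Lemma bopP S T : (forall x, S x = T x) -> S = T.
Proof. by move=> ST; apply/val_inj/funext. Qed.

Lemma bopZr T (a : R[i]) x : T (a *: x) = a *: T x.
Proof. exact: linearZ. Qed.

Lemma bopDr T x y : T (x + y) = T x + T y.
Proof. exact: linearD. Qed.

Lemma bopBr T x y : T (x - y) = T x - T y.
Proof. exact: linearB. Qed.

Lemma bopNr T x : T (- x) = - T x.
Proof. exact: linearN. Qed.

Lemma bop0r T : T 0 = 0.
Proof. exact: linear0. Qed.

Lemma bop_sumr T I (s : seq I) (P : pred I) (F : I -> H) :
  T (\sum_(i <- s | P i) F i) = \sum_(i <- s | P i) T (F i).
Proof. exact: linear_sum. Qed.

Lemma nrm_bop T x : nrm (T x) <= nrm T * nrm x.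
Proof. by rewrite nrm_le rmorphM /= -(nrmE x); exact: opnormP. Qed.

Lemma nrm_bop_le T (M : R) :
  0 <= M -> (forall x, nrm (T x) <= M * nrm x) -> nrm T <= M.
Proof.
move=> M0 TM; apply: opnorm_le => x x1; rewrite -nrm_le.
apply: (le_trans (TM x)); rewrite ler_piMr//.
by rewrite nrm_le.
Qed.

Lemma bop_of (f : H -> H) (M : R) : linear f ->
  (forall x, nrm (f x) <= M * nrm x) -> {T : bop H | forall x, T x = f x}.
Proof.
move=> fl fM.
suff fb : f \in is_bop (H := H) by exists (Bop fb).
apply/asboolP; split; first exact: fl.
move=> x; apply/cvg_nrmP => e e0.
have M1 : 0 < `|M| + 1 by rewrite ltr_wpDl.
have fB u v : f (u - v) = f u - f v.
  by rewrite -[in LHS](scaleN1r v) addrC fl scaleN1r addrC.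
apply/nbhs_ballP; exists (e / (`|M| + 1))%:C => /=; first by rewrite ltr0c divr_gt0.
move=> y; rewrite -ball_normE /= nrmE ltcR => xy.
rewrite -fB; apply: (le_lt_trans (fM _)).
apply: (@le_lt_trans _ _ ((`|M| + 1) * nrm (x - y))).
  rewrite ler_wpM2r ?nrm_ge0//; apply: (le_trans (ler_norm _)).
  by rewrite lerDl.
by rewrite mulrC -ltr_pdivlMr.
Qed.

Lemma bop_one_subproof : (@idfun H) \in is_bop (H := H).
Proof. by apply/asboolP; split=> // x; exact: cvg_id. Qed.

Lemma bop_mul_subproof S T : (S \o T) \in is_bop (H := H).
Proof.
apply/asboolP; split; first by move=> a x y /=; rewrite !linearP.
move=> x; apply: continuous_comp; exact: bop_continuous.
Qed.

Definition bop_one : bop H := Bop bop_one_subproof.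
Definition bop_mul S T : bop H := Bop (bop_mul_subproof S T).

Fact bop_mulA : associative bop_mul. Proof. by move=> *; exact: bopP. Qed.
Fact bop_mul1l : left_id bop_one bop_mul. Proof. by move=> *; exact: bopP. Qed.
Fact bop_mul1r : right_id bop_one bop_mul. Proof. by move=> *; exact: bopP. Qed.
Fact bop_mulDl : left_distributive bop_mul +%R.
Proof. by move=> *; exact: bopP. Qed.
Fact bop_mulDr : right_distributive bop_mul +%R.
Proof. by move=> S T U; apply: bopP => x; rewrite /= linearD. Qed.

(** The product is composition. The ring may have 1 = 0, since H may be the zero space here. *)
HB.instance Definition _ := GRing.Zmodule_isPzRing.Build (bop H)
  bop_mulA bop_mul1l bop_mul1r bop_mulDl bop_mulDr.

Lemma bopME S T x : (S * T) x = S (T x). Proof. by []. Qed.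
Lemma bop1E x : (1 : bop H) x = x. Proof. by []. Qed.

Lemma bopZAl (a : R[i]) S T : a *: (S * T) = (a *: S) * T.
Proof. exact: bopP. Qed.

Lemma bopZAr (a : R[i]) S T : a *: (S * T) = S * (a *: T).
Proof. by apply: bopP => x; rewrite bopME !bopZE linearZ. Qed.

Lemma nrm_bop1 : nrm (1 : bop H) <= 1.
Proof. by apply: nrm_bop_le => // x; rewrite mul1r. Qed.

Lemma nrm_bopM S T : nrm (S * T) <= nrm S * nrm T.
Proof.
apply: nrm_bop_le => [|x]; first by rewrite mulr_ge0 ?nrm_ge0.
rewrite bopME -mulrA; apply: (le_trans (nrm_bop _ _)).
by rewrite ler_wpM2l ?nrm_ge0// nrm_bop.
Qed.

Lemma nrm_bopM_le S T (a b : R) : nrm S <= a -> nrm T <= b -> nrm (S * T) <= a * b.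
Proof.
move=> Sa Tb; apply: (le_trans (nrm_bopM S T)).
by apply: ler_pM => //; exact: nrm_ge0.
Qed.

Lemma cvg_bopM (I : Type) (F : set_system I) {FF : Filter F} (f g : I -> bop H) S T :
  f @ F --> S -> g @ F --> T -> (fun i => f i * g i) @ F --> S * T.
Proof.
move=> fS gT; apply: (@cvg_nrm_le _ _ _ _ _ _ _ (fun i =>
  nrm (f i - S) * (nrm (g i - T) + nrm T) + nrm S * nrm (g i - T))).
  move=> i.
  have -> : f i * g i - S * T = (f i - S) * ((g i - T) + T) + S * (g i - T).
    by rewrite subrK mulrBl mulrBr addrA subrK.
  apply: (le_trans (nrmD _ _)); apply: lerD; last exact: nrm_bopM.
  by apply: nrm_bopM_le => //; exact: nrmD.
have z0 (V : normedModType R[i]) (h : I -> V) l : h @ F --> l ->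
    (fun i => nrm (h i - l)) @ F --> (0 : R).
  move=> hl; rewrite -(nrm0 V) -(subrr l).
  by apply: nrm_cvg; apply: cvgB => //; exact: cvg_cst.
have -> : 0 = 0 * (0 + nrm T) + nrm S * 0 :> R by ring.
apply: cvgD; apply: cvgM => //; try exact: z0; try exact: cvg_cst.
by apply: cvgD; [exact: z0|exact: cvg_cst].
Qed.

Definition self_adj T := forall x y, dotp (T x) y = dotp x (T y).

Lemma self_adjP T : (forall x y, rdot (T x) y = rdot x (T y)) -> self_adj T.
Proof.
move=> h x y; apply: dotp_rdot_eq; first exact: h.
by rewrite h linearZ.
Qed.

Lemma self_adj_rdot T : self_adj T -> forall x y, rdot (T x) y = rdot x (T y).
Proof. by move=> h x y; rewrite /rdot h. Qed.

Lemma self_adj1 : self_adj 1. Proof. by []. Qed.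

Lemma self_adjD S T : self_adj S -> self_adj T -> self_adj (S + T).
Proof. by move=> hS hT x y; rewrite !bopDE dotpDl dotpDr hS hT. Qed.

Lemma self_adjN S : self_adj S -> self_adj (- S).
Proof. by move=> hS x y; rewrite !bopNE dotpNl dotpNr hS. Qed.

Lemma self_adjB S T : self_adj S -> self_adj T -> self_adj (S - T).
Proof. by move=> hS hT; apply/self_adjD/self_adjN. Qed.

Lemma self_adjZ (r : R) S : self_adj S -> self_adj (r%:C *: S).
Proof.
move=> hS; apply: self_adjP => x y.
by rewrite !bopZE rdotZl rdotZr self_adj_rdot.
Qed.

Lemma self_adjM S T : self_adj S -> self_adj T -> S * T = T * S -> self_adj (S * T).
Proof. by move=> hS hT ST x y; rewrite bopME hS hT -bopME -ST. Qed.

Lemma self_adj_sandwich S T : self_adj S -> self_adj T -> self_adj (S * T * S).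
Proof. by move=> hS hT x y; rewrite !bopME hS hT hS. Qed.

Lemma self_adj_sqr S : self_adj S -> self_adj (S * S).
Proof. by move=> hS; apply: self_adjM. Qed.

(* |ST|^2 <= |TS| |ST| for self-adjoint S, T *)
Lemma nrm_self_adjM S T : self_adj S -> self_adj T -> nrm (S * T) <= nrm (T * S).
Proof.
move=> hS hT; have [->|ST0] := eqVneq (nrm (S * T)) 0; first exact: nrm_ge0.
have ST1 : 0 < nrm (S * T) by rewrite lt_neqAle eq_sym ST0 nrm_ge0.
rewrite -(ler_pM2l ST1) -expr2 -ler_sqrt; last first.
  by rewrite mulr_ge0 ?nrm_ge0.
rewrite sqrtr_sqr ger0_norm ?nrm_ge0//.
apply: nrm_bop_le => [|x]; first exact: sqrtr_ge0.
rewrite -(@ler_pXn2r _ 2)// ?nnegrE ?mulr_ge0 ?nrm_ge0 ?sqrtr_ge0//.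
rewrite exprMn sqr_sqrtr ?mulr_ge0 ?nrm_ge0// -rdot_nrm.
set y := (S * T) x; rewrite -[rdot _ _]/(rdot (S (T x)) y).
rewrite (self_adj_rdot hS) (self_adj_rdot hT) rdotC.
apply: (le_trans (rdot_le _ _)); rewrite expr2 mulrA ler_wpM2r ?nrm_ge0//.
apply: (le_trans (nrm_bop (T * S) y)); rewrite (mulrC (nrm (S * T))) -mulrA.
by rewrite ler_wpM2l ?nrm_ge0// nrm_bop.
Qed.

Lemma proj_self_adj (P : bop H) : orthogonal_projection P -> self_adj P.
Proof. by case. Qed.

Lemma proj_mul (P : bop H) : orthogonal_projection P -> P * P = P.
Proof. by case=> PP _; exact: bopP. Qed.

Lemma proj_rdot (P : bop H) x : orthogonal_projection P ->
  rdot (P x) x = nrm (P x) ^+ 2.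
Proof.
by move=> [PP Psa]; rewrite -rdot_nrm -[in RHS](self_adj_rdot Psa) PP.
Qed.

Lemma proj_nrm_le (P : bop H) x : orthogonal_projection P -> nrm (P x) <= nrm x.
Proof.
move=> hP; have := rdot_le (P x) x; rewrite proj_rdot// expr2.
have [->|Px0] := eqVneq (P x) 0; first by rewrite nrm0 nrm_ge0.
by rewrite ler_pM2l// nrm_gt0.
Qed.

Lemma proj_nrm (P : bop H) : orthogonal_projection P -> nrm P <= 1.
Proof. by move=> hP; apply: nrm_bop_le => // x; rewrite mul1r proj_nrm_le. Qed.

Lemma projP (P : bop H) : self_adj P -> P * P = P -> orthogonal_projection P.
Proof. by move=> Psa PP; split=> // x; rewrite -bopME PP. Qed.

End bounded_operator_algebra.

(** * Riesz representation and adjoints of bounded operators *)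

Section riesz_representation.
Variables (R : realType) (H : hilbertType R).

Lemma quadratic_ge0_eq0 (c q : R) : 0 <= q ->
  (forall t, 0 <= 2 * t * c + t ^+ 2 * q) -> c = 0.
Proof.
(* The minimum is at - c / q; the added 1 avoids the case q = 0 and still gives a negative value
   unless c = 0. *)
move=> q0 h; have := h (- c / (q + 1)).
have q1 : 0 < q + 1 by rewrite ltr_wpDl.
rewrite (_ : _ + _ = - (c ^+ 2 * ((q + 2) / (q + 1) ^+ 2))); last first.
  by field; rewrite gt_eqF.
rewrite oppr_ge0 pmulr_lle0 ?divr_gt0 ?exprn_gt0 ?ltr_wpDl//.
by move=> c2; apply/eqP; rewrite -sqrf_eq0 eq_le c2 sqr_ge0.
Qed.

(* the representing vector minimizes |v|^2 - 2 phi v *)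
Lemma riesz (phi : H -> R) (M : R) :
  (forall u v, phi (u + v) = phi u + phi v) ->
  (forall (r : R) u, phi (r%:C *: u) = r * phi u) ->
  (forall u, phi u <= M * nrm u) ->
  exists w, forall v, phi v = rdot v w.
Proof.
move=> phiD phiZ phiM.
pose J v := nrm v ^+ 2 - 2 * phi v.
have JM v : - M ^+ 2 <= J v.
  rewrite /J; have := phiM v; have := sqr_ge0 (nrm v - M); nra.
pose E := [set J v | v in [set: H]].
have infE : has_inf E.
  by split; [exists (J 0), 0|exists (- M ^+ 2) => _ [v _ <-]].
have /choice[x Jx] (n : nat) : exists v, J v < inf E + n.+1%:R^-1.
  have /inf_adherent/(_ infE)[_ [v _ <-] ?] : 0 < (n.+1%:R : R)^-1 by [].
  by exists v.
have mJ v : inf E <= J v by apply: ge_inf; [exact: infE.2|exists v].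
(* The parallelogram law, by which a minimizing sequence of J is Cauchy. *)
have par a b : nrm (a - b) ^+ 2 = 2 * J a + 2 * J b - 4 * J (2^-1%:C *: (a + b)).
  rewrite /J phiZ phiD nrmZr ger0_norm// exprMn !nrm_sqrB !nrm_sqrD.
  by field.
have xc : cvgn x.
  apply: nrm_cauchy_cvg => e e0.
  have e20 : 0 < e ^+ 2 / 4 by rewrite divr_gt0 ?exprn_gt0.
  have [N _ /= Ne] := near_infty_natSinv_lt (PosNum e20).
  exists N => m n Nm Nn.
  rewrite -(@ltr_pXn2r _ 2)// ?nnegrE ?nrm_ge0 ?ltW// par.
  have := Jx m; have := Jx n; have := mJ (2^-1%:C *: (x m + x n)).
  have := Ne m Nm; have := Ne n Nn; rewrite /=.
  move: (n.+1%:R^-1) (m.+1%:R^-1) => a b; lra.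
exists (lim (x @ \oo)) => v; set w := lim _.
apply/eqP; rewrite eq_sym -subr_eq0; apply/eqP.
(* J (x n + t v) is at least the infimum for every t; in the limit the linear coefficient in t must
   vanish. *)
apply: (@quadratic_ge0_eq0 _ (nrm v ^+ 2)); first exact: sqr_ge0.
move=> t.
have uL : (fun n => 2 * t * (rdot v (x n) - phi v) + t ^+ 2 * nrm v ^+ 2 +
    n.+1%:R^-1) @ \oo --> 2 * t * (rdot v w - phi v) + t ^+ 2 * nrm v ^+ 2 + 0.
  apply: cvgD; last exact: cvg_harmonic.
  apply: cvgD; last exact: cvg_cst.
  apply: cvgMr; apply: cvgB; last exact: cvg_cst.
  rewrite rdotC; under eq_fun do rewrite rdotC.
  exact: cvg_rdotl.
rewrite addr0 in uL; apply: (cvgr_to_ge uL); apply: nearW => n.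
have := mJ (x n + t%:C *: v); have := Jx n.
rewrite /J phiD phiZ nrm_sqrD nrmZr exprMn real_normK ?num_real// rdotZr rdotC.
set a := _^-1; nra.
Qed.

Lemma adjoint_ex (T : bop H) :
  {T' : bop H | forall x y, rdot (T x) y = rdot x (T' y)}.
Proof.
have /choice[f fP] (y : H) : exists w, forall v, rdot (T v) y = rdot v w.
  apply: (@riesz _ (nrm T * nrm y)) => [u v|r u|u].
  - by rewrite linearD rdotDl.
  - by rewrite linearZ rdotZl.
  - by rewrite mulrAC; apply: (le_trans (rdot_le _ _)); rewrite ler_wpM2r ?nrm_ge0 ?nrm_bop.
have fC x y : dotp (T x) y = dotp x (f y).
  rewrite dotpC [RHS]dotpC; congr Num.conj; apply: dotp_rdot_eq.
    by rewrite rdotC fP rdotC.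
  by rewrite rdotC -linearZ fP rdotC.
have fl : linear f.
  move=> a x y; apply: rdot_ext => z.
  by rewrite rdotC [RHS]rdotC /rdot -fC !dotpDr !dotpZr !fC.
have fb x : nrm (f x) <= nrm T * nrm x.
  have [->|fx0] := eqVneq (nrm (f x)) 0; first by rewrite mulr_ge0 ?nrm_ge0.
  have fx1 : 0 < nrm (f x) by rewrite lt_neqAle eq_sym fx0 nrm_ge0.
  rewrite -(ler_pM2l fx1) -expr2 -rdot_nrm -fP.
  apply: (le_trans (rdot_le _ _)); rewrite mulrCA mulrA.
  by rewrite ler_wpM2r ?nrm_ge0 ?nrm_bop.
have [T' T'E] := bop_of fl fb.
by exists T' => x y; rewrite T'E.
Qed.

End riesz_representation.

(** * Compact operators *)

Section compact_operators.
Variables (R : realType) (H : hilbertType R).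
Implicit Types (T : bop H) (e : R).

(** Total boundedness of the image of the unit ball. Stability of compactness under sums, products
    and norm limits is proved in this form. *)
Definition finite_nets T := forall e, 0 < e -> exists s : seq H,
  forall x, nrm x <= 1 -> exists2 y, y \in s & nrm (T x - y) < e.

Lemma ballP (x y : H) e : ball x e%:C y <-> nrm (x - y) < e.
Proof. by rewrite -ball_normE /= nrmE ltcR. Qed.

Lemma compact_finite_nets T : compact_op T -> finite_nets T.
Proof.
rewrite /compact_op compact_cover => cT e e0.
have [|x|D' _ D'P] := cT _ [set: H] (fun y => ball y e%:C).
- by move=> y _; apply: ball_open; rewrite ltr0c.
- by move=> _; exists x => //; apply: ballxx; rewrite ltr0c.
exists (finmap.enum_fset D') => x x1.
have /D'P[y /= yD' /ballP yx] : closure (T @` [set x | `|x| <= 1]) (T x).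
  by apply: subset_closure; exists x => //=; rewrite -nrm_le.
by exists y => //; rewrite nrmBC.
Qed.

Lemma ultra_bigcup (I : eqType) (U : Type) (F : set_system U) (s : seq I)
    (f : I -> set U) :
  UltraFilter F -> F [set u | exists2 i, i \in s & f i u] ->
  exists2 i, i \in s & F (f i).
Proof.
move=> FU; elim: s => [|i s IH] Fs.
  suff : F set0 by move/filter_not_empty.
  by apply: filterS Fs => u [].
have [Fi|Fi] := in_ultra_setVsetC (f i) FU.
  by exists i; rewrite ?mem_head.
have [|j js Fj] := IH; last by exists j => //; rewrite inE js orbT.
apply: filterS2 Fs Fi => u [j]; rewrite inE => /predU1P[->//|js fj _].
by exists j.
Qed.

(** By the finite nets, an ultrafilter on the closure contains a ball of every radius, so it is
    Cauchy and converges in the complete space H. *)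
Lemma finite_nets_compact T : finite_nets T -> compact_op T.
Proof.
move=> nT; rewrite /compact_op compact_ultra => F FU FT.
have Fc : cauchy F.
  apply: cauchy_exP => e e0.
  have eR : e = (complex.Re e)%:C by rewrite RRe_real ?gtr0_real.
  move: e0; rewrite eR ltr0c => e0.
  have [s sP] : exists s : seq H, forall x, nrm x <= 1 ->
    exists2 y, y \in s & nrm (T x - y) < complex.Re e / 2.
    by apply: nT; rewrite divr_gt0.
  suff [y ys Fy] : exists2 y, y \in s & F (ball y (complex.Re e)%:C).
    by exists y.
  apply: (ultra_bigcup (f := fun y => ball y (complex.Re e)%:C)).
  apply: filterS FT => u /(_ (ball u (complex.Re e / 2)%:C))[].
    by apply: nbhsx_ballx; rewrite ltr0c divr_gt0.
  move=> _ [[x x1 <-] /ballP ux].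
  have [y ys Txy] : exists2 y, y \in s & nrm (T x - y) < complex.Re e / 2.
    by apply: sP; rewrite nrm_le.
  exists y => //; apply/ballP; rewrite nrmBC [ltRHS]splitr.
  by apply: le_lt_trans (nrm_dist _ (T x) _) _; exact: ltrD.
have Fl : F --> lim F by apply: cauchy_cvg.
exists (lim F); split=> //.
apply: (@closed_cvg _ _ F _ id _ (@closed_closure _ _)); first exact: FT.
exact: Fl.
Qed.

Lemma compact_opP T : compact_op T <-> finite_nets T.
Proof. split; [exact: compact_finite_nets|exact: finite_nets_compact]. Qed.

Lemma compact_opD S T : compact_op S -> compact_op T -> compact_op (S + T).
Proof.
rewrite !compact_opP => cS cT e e0.
have e20 : 0 < e / 2 by rewrite divr_gt0.
have [s sP] := cS _ e20; have [t tP] := cT _ e20.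
exists [seq x + y | x <- s, y <- t] => x x1.
have [y ys Sxy] := sP x x1; have [z zt Txz] := tP x x1.
exists (y + z); first by apply/allpairsP; exists (y, z).
rewrite bopDE opprD addrACA (splitr e); apply: le_lt_trans (nrmD _ _) _.
exact: ltrD.
Qed.

Lemma compact_opMl S T : compact_op T -> compact_op (S * T).
Proof.
rewrite !compact_opP => cT e e0.
have S1 : 0 < nrm S + 1 by rewrite ltr_wpDl ?nrm_ge0.
have [s sP] := cT _ (divr_gt0 e0 S1); exists (map S s) => x x1.
have [y ys Txy] := sP x x1; exists (S y); first exact: map_f.
rewrite bopME -linearB; apply: le_lt_trans (nrm_bop _ _) _.
rewrite ltr_pdivlMr// mulrC in Txy; apply: le_lt_trans Txy.
by rewrite ler_wpM2r ?nrm_ge0// lerDl.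
Qed.

Lemma compact_opZ (a : R[i]) T : compact_op T -> compact_op (a *: T).
Proof.
by move=> cT; rewrite -[T]mul1r bopZAl; exact: compact_opMl.
Qed.

Lemma compact_opN T : compact_op T -> compact_op (- T).
Proof. by move=> cT; rewrite -scaleN1r; exact: compact_opZ. Qed.

Lemma compact_opB S T : compact_op S -> compact_op T -> compact_op (S - T).
Proof. by move=> cS cT; apply/compact_opD/compact_opN. Qed.

Lemma compact_opMr S T : compact_op T -> compact_op (T * S).
Proof.
rewrite !compact_opP => cT e e0.
(* c^-1 S maps the unit ball into itself, so a net for T rescaled by c serves T S; the 1 keeps c
   positive when S = 0. *)
set c := nrm S + 1; have c0 : 0 < c by rewrite ltr_wpDl ?nrm_ge0.
have [s sP] := cT _ (divr_gt0 e0 c0).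
exists (map (fun y => c%:C *: y) s) => x x1.
have [|y ys Txy] := sP (c^-1%:C *: S x).
  rewrite nrmZr gtr0_norm ?invr_gt0// mulrC ler_pdivrMr// mul1r.
  apply: (le_trans (nrm_bop _ _)); apply: (@le_trans _ _ (nrm S)).
    by rewrite ler_piMr ?nrm_ge0.
  by rewrite lerDl.
exists (c%:C *: y); first exact: map_f.
rewrite ltr_pdivlMr// in Txy; apply: le_lt_trans Txy.
have -> : (T * S) x - c%:C *: y = c%:C *: (T (c^-1%:C *: S x) - y).
  rewrite scalerBr bopZr scalerA -rmorphM /= divff ?scale1r//.
  by rewrite gt_eqF.
by rewrite nrmZr gtr0_norm// mulrC.
Qed.

Lemma compact_op_lim T : (forall e, 0 < e ->
  exists2 S, compact_op S & nrm (T - S) <= e) -> compact_op T.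
Proof.
move=> h; apply/compact_opP => e e0.
have e20 : 0 < e / 2 by rewrite divr_gt0.
have [S /compact_opP/(_ _ e20)[s sP] ST] := h _ e20.
exists s => x x1; have [y ys Sxy] := sP x x1; exists y => //.
apply: le_lt_trans (nrm_dist _ (S x) _) _; rewrite (splitr e).
apply: ler_ltD => //; rewrite -bopBE; apply: (le_trans (nrm_bop _ _)).
by apply: le_trans ST; rewrite ler_piMr ?nrm_ge0.
Qed.

Lemma compact_op0 : compact_op (0 : bop H).
Proof.
apply/compact_opP => e e0; exists [:: 0] => x _; exists 0; rewrite ?mem_head//.
by rewrite bop0E subrr nrm0.
Qed.

Lemma real_finite_net (M e : R) : 0 < e ->
  exists s : seq R, forall r, `|r| <= M -> exists2 t, t \in s & `|r - t| < e.
Proof.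
move=> e0; exists [seq i%:R * e - M | i <- iota 0 (Num.truncn (2 * M / e)).+1].
move=> r; rewrite ler_norml => /andP[Mr rM].
have rM0 : 0 <= (r + M) / e by apply: divr_ge0; [lra|exact: ltW].
have /andP[] := truncn_itv rM0; set n := Num.truncn _ => n1 n2.
exists (n%:R * e - M).
  apply/mapP; exists n => //; rewrite mem_iota add0n leq0n /= ltnS.
  apply: le_truncn; rewrite ler_pM2r ?invr_gt0//; lra.
rewrite ler_pdivlMr// in n1; rewrite ltr_pdivrMr// in n2.
rewrite -natr1 mulrDl mul1r in n2.
by rewrite ltr_norml; apply/andP; split; lra.
Qed.

(** The coefficient <x, u> stays in the disc of radius |u|; a grid on its real and imaginary parts
    gives the net. *)
Lemma compact_rank1 T (u v : H) :
  (forall x, T x = dotp x u *: v) -> compact_op T.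
Proof.
move=> TE; apply/compact_opP => e e0.
have v1 : 0 < 2 * (nrm v + 1) by rewrite mulr_gt0// ltr_wpDl ?nrm_ge0.
have [s sP] := real_finite_net (nrm u) (divr_gt0 e0 v1).
exists [seq (a +i* b) *: v | a <- s, b <- s] => x x1.
have dxu : complex.Re `|dotp x u| <= nrm u.
  by apply: (le_trans (dotp_norm_le _ _)); rewrite ler_piMl ?nrm_ge0.
case E : (dotp x u) dxu => [p q] dxu.
have pqn : complex.Re `|p +i* q| = Num.sqrt (p ^+ 2 + q ^+ 2) by rewrite normc_def.
rewrite pqn in dxu.
have [a as_ pa] : exists2 t, t \in s & `|p - t| < e / (2 * (nrm v + 1)).
  apply: sP; apply: le_trans dxu; rewrite -sqrtr_sqr ler_wsqrtr// lerDl.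
  exact: sqr_ge0.
have [b bs qb] : exists2 t, t \in s & `|q - t| < e / (2 * (nrm v + 1)).
  apply: sP; apply: le_trans dxu; rewrite -sqrtr_sqr ler_wsqrtr// lerDr.
  exact: sqr_ge0.
exists ((a +i* b) *: v); first by apply/allpairsP; exists (a, b).
rewrite TE E -scalerBl nrmZ.
have -> : (p +i* q) - (a +i* b) = (p - a) +i* (q - b) by [].
rewrite normc_def /=.
apply: (@le_lt_trans _ _ ((`|p - a| + `|q - b|) * nrm v)).
  rewrite ler_wpM2r ?nrm_ge0//.
  rewrite -(@ler_pXn2r _ 2)// ?nnegrE ?sqrtr_ge0 ?addr_ge0//.
  rewrite sqr_sqrtr ?addr_ge0 ?sqr_ge0// [leRHS]sqrrD !real_normK ?num_real//.
  by rewrite -addrA (addrC (_ *+ 2)) addrA lerDl mulrn_wge0 ?mulr_ge0.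
rewrite ltr_pdivlMr// in pa; rewrite ltr_pdivlMr// in qb.
have := nrm_ge0 v; have := normr_ge0 (p - a); have := normr_ge0 (q - b).
by move=> ? ? ?; nra.
Qed.

Lemma compact_seq T (x : nat -> H) : compact_op T ->
  (forall n, nrm (x n) <= 1) ->
  exists y, forall e N, 0 < e -> exists2 n, (N <= n)%N & nrm (T (x n) - y) < e.
Proof.
move=> cT x1.
have [|y [_ yP]] := cT ((T \o x) @ \oo).
  by exists 0 => // n _ /=; apply: subset_closure; exists (x n) => //=; rewrite -nrm_le.
exists y => e N e0.
have [||z [/= [n Nn <-] /ballP yz]] := yP [set T (x n) | n in [set n | (N <= n)%N]] (ball y e%:C).
- by exists N => // n /= Nn; exists n.
- by apply: nbhsx_ballx; rewrite ltr0c.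
by exists n => //; rewrite nrmBC.
Qed.

End compact_operators.

(** * Orthonormal bases and diagonal operators *)
Section orthonormal_bases.
Variables (R : realType) (H : hilbertType R).
Implicit Types (x y : H) (c : nat -> R[i]) (S T K : bop H) (phi psi : nat -> R).

Lemma bop_cvg (I : Type) (F : set_system I) {FF : Filter F} (f : I -> H) (l : H) T :
  f @ F --> l -> (fun i => T (f i)) @ F --> T l.
Proof. by apply: continuous_cvg; exact: bop_continuous. Qed.

Definition orthonormal_seq (e : nat -> H) :=
  forall m n, dotp (e m) (e n) = (m == n)%:R.

Definition total_seq (e : nat -> H) :=
  forall x, (forall n, dotp x (e n) = 0) -> x = 0.

Lemma conj_realc (r : R) : Num.conj (r%:C : R[i]) = r%:C.
Proof. by rewrite conj_Creal// complex_real. Qed.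

Definition csq (z : R[i]) : R := complex.Re `|z| ^+ 2.

Lemma csq_ge0 z : 0 <= csq z. Proof. exact: sqr_ge0. Qed.

Lemma csqE z : (csq z)%:C = z * Num.conj z.
Proof. by rewrite /csq -normCK -[in RHS](RRe_real (normr_real z)) rmorphXn. Qed.

Lemma csqMr (r : R) z : csq (r%:C * z) = r ^+ 2 * csq z.
Proof.
apply: complexI; rewrite [RHS]rmorphM [in RHS]rmorphXn /= !csqE rmorphM /=.
by rewrite conj_realc; ring.
Qed.

Definition psum (e : nat -> H) c N := \sum_(k < N) c k *: e k.

Section orthonormal.
Variables (e : nat -> H) (oe : orthonormal_seq e).

Lemma nrm_orthonormal n : nrm (e n) = 1.
Proof.
have := oe n n; rewrite eqxx dotp_nrm => /complexI h.
by apply/eqP; rewrite -(@eqrXn2 _ 2)// ?nrm_ge0// h expr1n.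
Qed.

Lemma dotp_psum c N n :
  dotp (psum e c N) (e n) = if (n < N)%N then c n else 0.
Proof.
rewrite dotp_suml; under eq_bigr => k _ do rewrite dotpZl oe.
case: ltnP => [nN|Nn].
  rewrite (bigD1 (Ordinal nN)) //= eqxx mulr1 big1 ?addr0// => k kn.
  by rewrite (negbTE (_ : _ != _)) ?mulr0//; apply: contraNneq kn => kn; apply/eqP/val_inj.
rewrite big1// => k _; rewrite (negbTE (_ : _ != _)) ?mulr0//.
by rewrite neq_ltn (leq_trans (ltn_ord k) Nn).
Qed.

Lemma dotp_psum2 c N y : dotp (psum e c N) y = \sum_(k < N) c k * Num.conj (dotp y (e k)).
Proof.
by rewrite dotp_suml; apply: eq_bigr => k _; rewrite dotpZl -dotpC.
Qed.

Lemma psumB c N m : (N <= m)%N ->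
  nrm (psum e c m - psum e c N) ^+ 2 = \sum_(N <= k < m) csq (c k).
Proof.
move=> Nm; apply: complexI; rewrite -dotp_nrm.
have -> : psum e c m - psum e c N = \sum_(N <= k < m) c k *: e k.
  rewrite /psum -!(big_mkord xpredT (fun k => c k *: e k)).
  have -> : \sum_(0 <= k < m) c k *: e k = \sum_(0 <= k < N) c k *: e k +
    \sum_(N <= k < m) c k *: e k by exact: big_cat_nat.
  by rewrite addrC addKr.
rewrite dotp_suml rmorph_sum /=; apply: eq_big_nat => i /andP[Ni im].
rewrite dotpZl dotp_sumr (bigD1_seq i) ?mem_index_iota ?Ni ?iota_uniq//=.
rewrite dotpZr oe eqxx mulr1 big1 ?addr0 ?csqE// => j ji.
by rewrite dotpZr oe eq_sym (negbTE ji) mulr0.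
Qed.

Lemma nrm_psum c N : nrm (psum e c N) ^+ 2 = \sum_(k < N) csq (c k).
Proof.
have := psumB c (leq0n N); rewrite big_mkord => <-.
by have -> : psum e c 0 = 0 by [rewrite /psum big_ord0]; rewrite subr0.
Qed.

Lemma bessel_eq x N : nrm (x - psum e (fun k => dotp x (e k)) N) ^+ 2 =
  nrm x ^+ 2 - \sum_(k < N) csq (dotp x (e k)).
Proof.
rewrite nrm_sqrB nrm_psum; set s := \sum_(_ < _) _.
have -> : rdot x (psum e (fun k => dotp x (e k)) N) = s.
  rewrite rdotC /rdot dotp_psum2; under eq_bigr => k _ do rewrite -csqE.
  by rewrite -rmorph_sum.
by ring.
Qed.

Lemma bessel x N : \sum_(k < N) csq (dotp x (e k)) <= nrm x ^+ 2.
Proof. by rewrite -subr_ge0 -bessel_eq sqr_ge0. Qed.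

Lemma riesz_fischer_cvg c (M : R) : (forall N, \sum_(k < N) csq (c k) <= M) ->
  exists2 y, psum e c @ \oo --> y & forall n, dotp y (e n) = c n.
Proof.
move=> cM; pose s N := \sum_(k < N) csq (c k).
have sup_s : has_sup [set s N | N in [set: nat]].
  by split; [exists (s 0%N), 0%N|exists M => _ [N _ <-]; exact: cM].
have ndE N m : (N <= m)%N -> s m = s N + \sum_(N <= k < m) csq (c k).
  move=> Nm; rewrite /s -!(big_mkord xpredT (fun k => csq (c k))).
  exact: big_cat_nat.
have cc : cvgn (psum e c).
  apply: nrm_cauchy_cvg => r r0.
  have r20 : 0 < (r / 2) ^+ 2 by rewrite exprn_gt0// divr_gt0.
  have [_ [N _ <-] sN] := sup_adherent r20 sup_s.
  have near_N m : (N <= m)%N -> nrm (psum e c m - psum e c N) < r / 2.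
    move=> Nm; rewrite -(@ltr_pXn2r _ 2)// ?nnegrE ?nrm_ge0 ?ltW ?divr_gt0//.
    rewrite psumB//; have := ndE _ _ Nm => sm.
    have : s m <= sup [set s N | N in [set: nat]].
      by apply: sup_ubound; [exact: sup_s.2|exists m].
    move: sN sm; set S := sup _; set a := s N; set b := \sum_(_ <= _ < _) _; lra.
  exists N => m n Nm Nn; rewrite [ltRHS]splitr.
  apply: le_lt_trans (nrm_dist _ (psum e c N) _) _.
  by rewrite [in X in _ + X]nrmBC ltrD ?near_N.
exists (lim (psum e c @ \oo)) => // n.
rewrite -[RHS]mulr1 -[1]/(true%:R) -(eqxx n) -oe -dotpZl.
(* After a shift by n + 1 every partial sum contains the n-th term, so its n-th coefficient no
   longer depends on N. *)
apply: (@cvg_dotp_eq _ _ (fun N => psum e c (N + n.+1)%N) (fun=> c n *: e n)).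
- by move=> N; rewrite dotp_psum addnS ltnS leq_addl dotpZl oe eqxx mulr1.
- by rewrite (@cvg_shiftn n.+1 _ (psum e c)).
- exact: cvg_cst.
Qed.

End orthonormal.

Section orthonormal_basis.
Variables (e : nat -> H) (oe : orthonormal_seq e) (te : total_seq e).

Lemma coef_inj x y : (forall n, dotp x (e n) = dotp y (e n)) -> x = y.
Proof.
move=> xy; apply/eqP; rewrite -subr_eq0; apply/eqP/te => n.
by rewrite dotpBl xy subrr.
Qed.

Lemma psum_cvg x : psum e (fun k => dotp x (e k)) @ \oo --> x.
Proof.
have [y yl yE] := riesz_fischer_cvg (c := fun k => dotp x (e k)) oe (bessel oe x).
by rewrite (coef_inj yE) in yl; exact: yl.
Qed.

Lemma coef_nrm_le x y (M : R) : 0 <= M ->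
  (forall n, csq (dotp x (e n)) <= M ^+ 2 * csq (dotp y (e n))) -> nrm x <= M * nrm y.
Proof.
move=> M0 xy.
have xl : (fun N => nrm (psum e (fun k => dotp x (e k)) N)) @ \oo --> nrm x.
  by apply: nrm_cvg; exact: psum_cvg.
apply: (cvgr_to_le xl).
apply: nearW => N /=.
rewrite -(@ler_pXn2r _ 2)// ?nnegrE ?mulr_ge0 ?nrm_ge0// nrm_psum// exprMn.
apply: (@le_trans _ _ (M ^+ 2 * \sum_(k < N) csq (dotp y (e k)))).
  by rewrite mulr_sumr; apply: ler_sum => k _.
by rewrite ler_wpM2l ?sqr_ge0// bessel.
Qed.

(** The functional calculus in the form used here: functions of A are diagonal in its eigenbasis,
    and by [is_diag_uniq] identities between them are identities between real sequences. *)
Definition is_diag (phi : nat -> R) (T : bop H) :=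
  forall n, T (e n) = (phi n)%:C *: e n.

Lemma bop_basis_eq S T : (forall n, S (e n) = T (e n)) -> S = T.
Proof.
move=> ST; apply: bopP => x.
have Sx : (fun N => S (psum e (fun k => dotp x (e k)) N)) @ \oo --> S x.
  by apply: bop_cvg; exact: psum_cvg.
have Tx : (fun N => T (psum e (fun k => dotp x (e k)) N)) @ \oo --> T x.
  by apply: bop_cvg; exact: psum_cvg.
have E : (fun N => S (psum e (fun k => dotp x (e k)) N)) =
    (fun N => T (psum e (fun k => dotp x (e k)) N)).
  by apply/funext => N /=; rewrite !bop_sumr; apply: eq_bigr => k _; rewrite !bopZr ST.
rewrite E in Sx; rewrite -(cvg_lim _ Sx); last exact: norm_hausdorff.
by rewrite (cvg_lim _ Tx)//; exact: norm_hausdorff.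
Qed.

Lemma is_diag_uniq phi S T : is_diag phi S -> is_diag phi T -> S = T.
Proof. by move=> hS hT; apply: bop_basis_eq => n; rewrite hS hT. Qed.

Lemma is_diag_coef phi T x n : is_diag phi T ->
  dotp (T x) (e n) = (phi n)%:C * dotp x (e n).
Proof.
move=> hT; rewrite -[_ * _]/(_ * _)%R.
have -> : (phi n)%:C * dotp x (e n) = dotp x ((phi n)%:C *: e n).
  by rewrite dotpZr conj_realc.
apply: (@cvg_dotp_eq _ _ (fun N => T (psum e (fun k => dotp x (e k)) N))
  (psum e (fun k => dotp x (e k)))) => [N||].
- rewrite bop_sumr; under eq_bigr => k _ do rewrite bopZr hT scalerA.
  rewrite dotp_suml dotp_suml; apply: eq_bigr => k _.
  rewrite !dotpZl dotpZr oe -mulrA; case: eqP => [->|_]; last by rewrite !mulr0.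
  by rewrite conj_realc.
- by apply: bop_cvg; exact: psum_cvg.
- exact: psum_cvg.
Qed.

Lemma is_diag_self_adj phi T : is_diag phi T -> self_adj T.
Proof.
move=> hT x y.
apply: (@cvg_dotp_eq _ _ (fun N => T (psum e (fun k => dotp x (e k)) N))
  (psum e (fun k => dotp x (e k)))) => [N||].
- rewrite bop_sumr; under eq_bigr => k _ do rewrite bopZr hT scalerA mulrC -scalerA.
  rewrite !dotp_suml; apply: eq_bigr => k _.
  rewrite !dotpZl (dotpC _ (T y)) (is_diag_coef _ _ hT) (dotpC (e k) y).
  rewrite rmorphM /= conj_realc; ring.
- by apply: bop_cvg; exact: psum_cvg.
- exact: psum_cvg.
Qed.

Lemma is_diag_nrm phi T (M : R) : 0 <= M -> is_diag phi T ->
  (forall n, `|phi n| <= M) -> nrm T <= M.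
Proof.
move=> M0 hT phiM; apply: nrm_bop_le => // x; apply: coef_nrm_le => // n.
rewrite (is_diag_coef _ _ hT) csqMr ler_wpM2r ?csq_ge0//.
by rewrite -real_normK ?num_real// ler_pXn2r ?nnegrE.
Qed.

Lemma is_diag_bound phi T n : is_diag phi T -> `|phi n| <= nrm T.
Proof.
by move=> hT; have := nrm_bop T (e n); rewrite hT nrmZr nrm_orthonormal// !mulr1.
Qed.

Lemma is_diag_ex phi (M : R) : (forall n, `|phi n| <= M) -> {T | is_diag phi T}.
Proof.
move=> phiM; have M0 : 0 <= M by apply: le_trans (phiM 0%N).
have phi2 n z : csq ((phi n)%:C * z) <= M ^+ 2 * csq z.
  rewrite csqMr ler_wpM2r ?csq_ge0//.
  by rewrite -real_normK ?num_real// ler_pXn2r ?nnegrE.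
have /choice[f fE] x : exists y, forall n, dotp y (e n) = (phi n)%:C * dotp x (e n).
  have [|y _ yE] := @riesz_fischer_cvg e oe (fun n => (phi n)%:C * dotp x (e n)) (M ^+ 2 * nrm x ^+ 2).
    move=> N; apply: (@le_trans _ _ (M ^+ 2 * \sum_(k < N) csq (dotp x (e k)))).
      by rewrite mulr_sumr; apply: ler_sum => k _.
    by rewrite ler_wpM2l ?sqr_ge0// bessel.
  by exists y.
have fl : linear f.
  move=> a x y; apply: coef_inj => n.
  by rewrite fE !dotpDl !dotpZl !fE; ring.
have fM x : nrm (f x) <= M * nrm x by apply: coef_nrm_le => // n; rewrite fE.
have [T TE] := bop_of fl fM; exists T => n; apply: coef_inj => m.
by rewrite TE fE dotpZl oe; case: eqP => [->|_]; rewrite ?mulr0.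
Qed.

Lemma is_diagM phi psi S T : is_diag phi S -> is_diag psi T ->
  is_diag (phi \* psi) (S * T).
Proof.
move=> hS hT n; rewrite bopME hT bopZr hS scalerA -rmorphM /=.
by rewrite mulrC.
Qed.

Lemma is_diagD phi psi S T : is_diag phi S -> is_diag psi T ->
  is_diag (phi \+ psi) (S + T).
Proof. by move=> hS hT n; rewrite bopDE hS hT -scalerDl -rmorphD. Qed.

Lemma is_diagB phi psi S T : is_diag phi S -> is_diag psi T ->
  is_diag (phi \- psi) (S - T).
Proof. by move=> hS hT n; rewrite bopBE hS hT -scalerBl -rmorphB. Qed.

Lemma is_diagZ (r : R) phi S : is_diag phi S -> is_diag (fun n => r * phi n) (r%:C *: S).
Proof. by move=> hS n; rewrite bopZE hS scalerA -rmorphM. Qed.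

Lemma is_diag1 : is_diag (fun=> 1) 1.
Proof. by move=> n; rewrite scale1r. Qed.

Lemma is_diag_comm phi psi S T : is_diag phi S -> is_diag psi T -> S * T = T * S.
Proof.
move=> hS hT; apply: (is_diag_uniq (is_diagM hS hT)) => n.
by rewrite (is_diagM hT hS) /= mulrC.
Qed.

Lemma is_diag_ext phi psi T : phi =1 psi -> is_diag phi T -> is_diag psi T.
Proof. by move=> E hT n; rewrite hT E. Qed.

Lemma is_diag_proj phi T : is_diag phi T -> (forall n, phi n * phi n = phi n) ->
  orthogonal_projection T.
Proof.
move=> hT pp; apply: projP; first exact: is_diag_self_adj hT.
by apply: (is_diag_uniq (is_diagM hT hT)); apply: is_diag_ext hT => n; rewrite /= pp.
Qed.

Lemma is_diag_pos phi T : is_diag phi T -> (forall n, 0 <= phi n) -> positive_op T.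
Proof.
(* The order of R[i] also requires <T x, x> to be real, which follows from self-adjointness. *)
move=> hT p0 x; suff : 0 <= rdot (T x) x.
  move=> r0; suff -> : dotp (T x) x = (rdot (T x) x)%:C by rewrite ler0c.
  have : Num.conj (dotp (T x) x) = dotp (T x) x.
    by rewrite -dotpC -(is_diag_self_adj hT).
  rewrite /rdot; case: (dotp _ _) => a b [] h /=; congr (_ +i* _).
  by move/eqP: h; rewrite -subr_eq0 -opprD oppr_eq0 -mulr2n mulrn_eq0 /= => /eqP.
have cv : (fun N => rdot (psum e (fun k => dotp x (e k)) N) (T x)) @ \oo --> rdot x (T x).
  by apply: cvg_rdotl; exact: psum_cvg.
rewrite rdotC; apply: (cvgr_to_ge cv); apply: nearW => N.
rewrite /rdot dotp_psum2; under eq_bigr => k _ do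
  rewrite (is_diag_coef _ _ hT) rmorphM /= conj_realc mulrCA -csqE -rmorphM.
by rewrite -rmorph_sum /=; apply: sumr_ge0 => k _; rewrite mulr_ge0 ?csq_ge0.
Qed.

Lemma is_diag_finite_compact phi T N : is_diag phi T ->
  (forall n, (N <= n)%N -> phi n = 0) -> compact_op T.
Proof.
elim: N phi T => [|N IH] phi T hT phi0.
  suff -> : T = 0 by exact: compact_op0.
  by apply: bop_basis_eq => n; rewrite hT phi0// scale0r.
have [|P hP] := @is_diag_ex (fun n => if n == N then phi N else 0) `|phi N|.
  by move=> n; case: ifP; rewrite ?normr0.
rewrite -(subrK P T); apply: compact_opD.
  apply: IH (is_diagB hT hP) _ => n Nn /=; case: eqP => [->|/eqP nN].
    by rewrite subrr.
  by rewrite subr0 phi0// ltn_neqAle eq_sym nN.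
apply: (@compact_rank1 _ _ _ (e N) ((phi N)%:C *: e N)) => x; apply: coef_inj => n.
rewrite (is_diag_coef _ _ hP) !dotpZl oe; case: (eqVneq n N) => [->|nN].
  rewrite /= ?eqxx; ring.
by rewrite /= !mulr0 mul0r.
Qed.

Lemma is_diag_compact phi T : is_diag phi T ->
  (forall eps, 0 < eps -> exists N, forall n, (N <= n)%N -> `|phi n| <= eps) ->
  compact_op T.
Proof.
move=> hT phi0; apply: compact_op_lim => eps eps0.
have [N phiN] := phi0 _ eps0.
have [|S hS] := @is_diag_ex (fun n => if (n < N)%N then phi n else 0) (nrm T).
  by move=> n; case: ifP => _; rewrite ?normr0 ?nrm_ge0// is_diag_bound.
exists S.
  by apply: (is_diag_finite_compact (N := N) hS) => n; rewrite ltnNge => ->.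
apply: (is_diag_nrm (ltW eps0) (is_diagB hT hS)) => n /=.
by case: ltnP => [_|/phiN]; rewrite ?subrr ?normr0 ?subr0// ltW.
Qed.

(** N depends on x and eta only. T kills the first N basis vectors, so T x = T (x - s) with s the
    N-th partial sum of x. *)
Lemma is_diag_tail x (eta : R) : 0 < eta -> exists N, forall phi T (M : R),
  0 <= M -> is_diag phi T -> (forall n, `|phi n| <= M) ->
  (forall n, (n < N)%N -> phi n = 0) -> nrm (T x) <= M * eta.
Proof.
move=> eta0.
have /cvg_nrmP xl : psum e (fun k => dotp x (e k)) @ \oo --> x by exact: psum_cvg.
have [N _ /= xN] := xl _ eta0.
exists N => phi T M M0 hT phiM phiN.
have -> : T x = T (x - psum e (fun k => dotp x (e k)) N).
  rewrite bopBr bop_sumr big1 ?subr0// => k _.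
  by rewrite bopZr hT phiN// scale0r scaler0.
apply: (le_trans (nrm_bop _ _)); apply: ler_pM; rewrite ?nrm_ge0//.
  exact: is_diag_nrm hT phiM.
by apply/ltW/xN => /=.
Qed.

(** Convergence to 0 on each vector becomes norm convergence after multiplication by a compact
    operator: it suffices to control T on a finite net of the image of the unit ball. *)
Lemma is_diag_tail_compact K (eta : R) : compact_op K -> 0 < eta ->
  exists N, forall phi T, is_diag phi T -> (forall n, `|phi n| <= 1) ->
  (forall n, (n < N)%N -> phi n = 0) -> nrm (T * K) <= eta.
Proof.
move=> /compact_opP cK eta0; have eta20 : 0 < eta / 2 by rewrite divr_gt0.
have [s sP] := cK _ eta20.
have [N NP] : exists N, forall y, y \in s -> forall phi T, is_diag phi T ->
    (forall n, `|phi n| <= 1) -> (forall n, (n < N)%N -> phi n = 0) ->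
    nrm (T y) <= eta / 2.
  elim: s {sP} => [|y s [N NP]]; first by exists 0%N.
  have [N' N'P] := is_diag_tail y eta20.
  exists (maxn N N') => z; rewrite inE => /predU1P[->|zs] phi T hT phi1 phi0.
    rewrite -[leRHS]mul1r; apply: N'P hT _ _ => // n nN'.
    by rewrite phi0// leq_max nN' orbT.
  by apply: NP hT _ _ => // n nN; rewrite phi0// leq_max nN.
exists N => phi T hT phi1 phi0; apply: opnorm_le => x x1.
rewrite -nrm_le; have [|y ys Kxy] := sP x; first by rewrite nrm_le.
rewrite bopME -(subrK y (K x)) bopDr [leRHS]splitr; apply: (le_trans (nrmD _ _)).
apply: lerD; last exact: (NP y ys _ _ hT).
apply: (le_trans (nrm_bop _ _)); apply: le_trans (ltW Kxy).
by rewrite ler_piMl ?nrm_ge0// (is_diag_nrm _ hT).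
Qed.

End orthonormal_basis.
End orthonormal_bases.

(** * Diagonalization *)
(* Greedy choice of eigenvectors of K with the largest eigenvalue orthogonal to
   the previous ones. As B^2 is scalar on the eigenspaces of K, for z in such an
   eigenspace either z or (s + B) z, with s the square root of that scalar, is
   an eigenvector of B. *)
Section eigenbasis.
Variables (R : realType) (H : hilbertType R).
Variables (K B : bop H) (c : R -> R).
Hypotheses (Kcpt : compact_op K) (Ksa : self_adj K) (Bsa : self_adj B).
Hypothesis Kpos : forall x : H, x != 0 -> 0 < rdot (K x) x.
Hypothesis KB : K * B = B * K.
Hypothesis Bsqr : forall (k : R) (x : H), K x = k%:C *: x -> B (B x) = (c k)%:C *: x.

Lemma compact_subseq (x : nat -> H) : (forall n, nrm (x n) <= 1) ->
  exists (y : H) (f : nat -> nat), (forall n, (n <= f n)%N) /\ (fun n => K (x (f n))) @ \oo --> y.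
Proof.
move=> x1; have [y yP] := compact_seq Kcpt x1.
have /choice[f fP] n : exists m, (n <= m)%N /\ nrm (K (x m) - y) < n.+1%:R^-1.
  by have [|m nm xm] := yP n.+1%:R^-1 n; [rewrite invr_gt0|exists m].
exists y, f; split=> [n|]; first by have [] := fP n.
apply: (@cvg_nrm_le _ _ _ _ _ _ _ (fun n => n.+1%:R^-1)); last exact: cvg_harmonic.
by move=> n; have [_ /ltW] := fP n.
Qed.

(** M is a closed subspace invariant under K and k is the norm of K on it. Along a maximizing
    sequence v with u = K v, |K u - k^2 v|^2 <= k^2 (k^2 - |u|^2) tends to 0, so a limit y of the u
    satisfies K^2 y = k^2 y. Then w = K y - k y satisfies K w = - k w, which positivity forbids
    unless w = 0. *)
Lemma max_eigenvector (M : H -> Prop) :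
  (forall (a : R[i]) x y, M x -> M y -> M (a *: x + y)) ->
  (forall x, M x -> M (K x)) ->
  (forall (x : nat -> H) y, (forall n, M (x n)) -> x @ \oo --> y -> M y) ->
  (exists2 x, M x & x != 0) ->
  exists z k, [/\ M z, z != 0, 0 < k, K z = k%:C *: z &
    forall x, M x -> nrm (K x) <= k * nrm x].
Proof.
move=> Mlin MK Mlim [x0 Mx0 x00].
have M0 : M 0 by rewrite -(addNr x0) -scaleN1r; exact: Mlin.
have MZ a x : M x -> M (a *: x) by move=> Mx; rewrite -[_ *: _]addr0; exact: Mlin.
pose E := [set nrm (K x) | x in [set x | M x /\ nrm x <= 1]].
have supE : has_sup E.
  split; first by exists (nrm (K 0)), 0 => //=; split=> //; rewrite nrm0.
  exists (nrm K) => _ [x /= [_ x1] <-]; apply: (le_trans (nrm_bop _ _)).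
  by rewrite ler_piMr ?nrm_ge0.
set k := sup E.
have kP x : M x -> nrm (K x) <= k * nrm x.
  move=> Mx; have [->|xn0] := eqVneq x 0; first by rewrite bop0r !nrm0 mulr0.
  have nx : 0 < nrm x by rewrite nrm_gt0.
  rewrite -ler_pdivrMr//.
  have -> : nrm (K x) / nrm x = nrm (K ((nrm x)^-1%:C *: x)).
    by rewrite bopZr nrmZr gtr0_norm ?invr_gt0// mulrC.
  apply: sup_ubound; first exact: supE.2.
  exists ((nrm x)^-1%:C *: x) => //=; split; first exact: MZ.
  by rewrite nrmZr gtr0_norm ?invr_gt0// mulVf ?gt_eqF.
have k0 : 0 < k.
  have := Kpos x00; have := rdot_le (K x0) x0; have := kP _ Mx0.
  have : 0 < nrm x0 by rewrite nrm_gt0.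
  by have := nrm_ge0 (K x0); nra.
have /choice[x xP] (n : nat) : exists x, [/\ M x, nrm x <= 1 & k - n.+1%:R^-1 < nrm (K x)].
  have /sup_adherent/(_ supE)[_ [x /= [Mx x1] <-] ?] : 0 < (n.+1%:R : R)^-1 by [].
  by exists x.
have [|y [f [fn Kxy]]] := @compact_subseq x; first by move=> n; have [] := xP n.
pose u n := K (x (f n)).
have Mu n : M (u n) by apply: MK; have [] := xP (f n).
have My : M y by exact: Mlim Mu Kxy.
have yk : k <= nrm y.
  have un : (fun n => nrm (u n) + n.+1%:R^-1) @ \oo --> nrm y + 0.
    by apply: cvgD; [exact: nrm_cvg Kxy|exact: cvg_harmonic].
  rewrite addr0 in un; apply: (cvgr_to_ge un); apply: nearW => n.
  have [_ _ xn] := xP (f n); rewrite -lerBlDr; apply: le_trans (ltW xn).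
  rewrite lerD2l lerN2 lef_pV2 ?posrE// ler_nat ltnS; exact: fn.
have y0 : y != 0 by rewrite -nrm_gt0 (lt_le_trans k0).
have KKy : K (K y) = (k ^+ 2)%:C *: y.
  apply/eqP; rewrite -subr_eq0 -nrm_eq0 -sqrf_eq0 eq_le sqr_ge0 andbT.
  pose d v := nrm (K (K v) - (k ^+ 2)%:C *: v).
  have dl : (fun n => d (u n) ^+ 2 - nrm K ^+ 2 * k ^+ 2 * (k ^+ 2 - nrm (u n) ^+ 2)) @ \oo -->
      d y ^+ 2 - nrm K ^+ 2 * k ^+ 2 * (k ^+ 2 - nrm y ^+ 2).
    apply: cvgB.
      apply: cvg_sqr; apply: nrm_cvg; apply: cvgB.
        by apply: bop_cvg; exact: bop_cvg Kxy.
      by apply: cvgZr_real; [exact: cvg_cst|exact: Kxy].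
    apply: cvgMr; apply: cvgB; first exact: cvg_cst.
    by apply: cvg_sqr; exact: nrm_cvg Kxy.
  have : d y ^+ 2 - nrm K ^+ 2 * k ^+ 2 * (k ^+ 2 - nrm y ^+ 2) <= 0.
    apply: (cvgr_to_le dl); apply: nearW => n; rewrite subr_le0.
    have [Mxn xn1 _] := xP (f n); set v := x (f n) in Mxn xn1 *.
    have -> : d (u n) = nrm (K (K (u n) - (k ^+ 2)%:C *: v)) by rewrite bopBr bopZr.
    apply: (@le_trans _ _ ((nrm K * nrm (K (u n) - (k ^+ 2)%:C *: v)) ^+ 2)).
      by rewrite ler_pXn2r ?nnegrE ?mulr_ge0 ?nrm_ge0// nrm_bop.
    rewrite exprMn -mulrA ler_wpM2l ?sqr_ge0//.
    rewrite nrm_sqrB nrmZr rdotZr (self_adj_rdot Ksa) rdot_nrm -/(u n).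
    rewrite ger0_norm ?sqr_ge0//.
    have h1 : nrm (K (u n)) ^+ 2 <= k ^+ 2 * nrm (u n) ^+ 2.
      by rewrite -exprMn ler_pXn2r ?nnegrE ?mulr_ge0 ?nrm_ge0 ?(ltW k0)// kP.
    have h2 : nrm v ^+ 2 <= 1 by rewrite expr_le1// nrm_ge0.
    rewrite exprMn.
    have : k ^+ 2 ^+ 2 * nrm v ^+ 2 <= k ^+ 2 ^+ 2 by rewrite ler_piMr// sqr_ge0.
    rewrite -/(u n); nra.
  rewrite subr_le0 => h; apply: (le_trans h).
  apply: mulr_ge0_le0; first by rewrite mulr_ge0 ?sqr_ge0.
  by rewrite subr_le0 ler_pXn2r ?nnegrE ?nrm_ge0// ltW.
exists y, k; split=> //.
apply/eqP; rewrite -subr_eq0; apply/negPn/negP => w0.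
have := Kpos w0; rewrite bopBr bopZr KKy.
have -> : (k ^+ 2)%:C *: y - k%:C *: K y = - (k%:C *: (K y - k%:C *: y)).
  by rewrite scalerBr scalerA -rmorphM /= opprB.
by rewrite rdotNl rdotZl rdot_nrm oppr_gt0 pmulr_rlt0// ltNge sqr_ge0.
Qed.

Lemma common_eigenvector (M : H -> Prop) z k :
  (forall (a : R[i]) x y, M x -> M y -> M (a *: x + y)) ->
  (forall x, M x -> M (B x)) ->
  M z -> z != 0 -> K z = k%:C *: z ->
  exists z' b, [/\ M z', nrm z' = 1, K z' = k%:C *: z' & B z' = b%:C *: z'].
Proof.
move=> Mlin MB Mz z0 Kz.
suff [w [b [Mw w0 Kw Bw]]] : exists w b, [/\ M w, w != 0, K w = k%:C *: w & B w = b%:C *: w].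
  have nw : 0 < nrm w by rewrite nrm_gt0.
  exists ((nrm w)^-1%:C *: w), b; split.
  - have M0 : M 0 by rewrite -(addNr z) -scaleN1r; exact: Mlin.
    by rewrite -[_ *: _]addr0; exact: Mlin.
  - by rewrite nrmZr gtr0_norm ?invr_gt0// mulVf ?gt_eqF.
  - by rewrite bopZr Kw !scalerA mulrC.
  - by rewrite bopZr Bw !scalerA mulrC.
have BB := Bsqr Kz.
have ck : 0 <= c k.
  have : 0 <= rdot (B (B z)) z by rewrite (self_adj_rdot Bsa) rdot_nrm sqr_ge0.
  by rewrite BB rdotZl rdot_nrm pmulr_lge0// exprn_gt0// nrm_gt0.
pose s := Num.sqrt (c k); have ss : s * s = c k by rewrite -expr2 sqr_sqrtr.
have [p0|p0] := eqVneq (s%:C *: z + B z) 0.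
  exists z, (- s); split=> //; rewrite rmorphN scaleNr.
  by apply/eqP; rewrite -addr_eq0 addrC p0.
exists (s%:C *: z + B z), s; split=> //.
- by apply: Mlin => //; exact: MB.
- by rewrite bopDr bopZr -bopME KB bopME Kz bopZr scalerDr !scalerA mulrC.
- by rewrite bopDr bopZr BB scalerDr scalerA -rmorphM ss /= addrC.
Qed.

Hypothesis Hinf : infinite_dimensional H.

Let eigen_list (s : seq H) :=
  (forall i, (i < size s)%N -> exists k b : R, K s`_i = k%:C *: s`_i /\ B s`_i = b%:C *: s`_i) /\
  (forall i j, (i < size s)%N -> (j < size s)%N -> dotp s`_i s`_j = (i == j)%:R).

Let next_eigen (s : seq H) (p : H * R * R) :=
  let: (z, k, b) := p in
  [/\ forall i, (i < size s)%N -> dotp z s`_i = 0, nrm z = 1, 0 < k,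
      K z = k%:C *: z /\ B z = b%:C *: z &
      forall x, (forall i, (i < size s)%N -> dotp x s`_i = 0) -> nrm (K x) <= k * nrm x].

Let next_eigen_ex s : eigen_list s -> exists p, next_eigen s p.
Proof.
move=> [seig sort].
pose M x := forall i, (i < size s)%N -> dotp x s`_i = 0.
have Mlin (a : R[i]) x y : M x -> M y -> M (a *: x + y).
  by move=> Mx My i si; rewrite dotpDl dotpZl Mx// My// mulr0 addr0.
have MK x : M x -> M (K x).
  move=> Mx i si; have [k [b [Ki _]]] := seig i si.
  by rewrite Ksa Ki dotpZr Mx// mulr0.
have MB x : M x -> M (B x).
  move=> Mx i si; have [k [b [_ Bi]]] := seig i si.
  by rewrite Bsa Bi dotpZr Mx// mulr0.
have Mlim (x : nat -> H) y : (forall n, M (x n)) -> x @ \oo --> y -> M y.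
  move=> Mx xy i si; rewrite -(dotp0l s`_i).
  apply: (@cvg_dotp_eq _ _ x (fun=> 0)) xy _ => [n|]; last exact: cvg_cst.
  by rewrite Mx// dotp0l.
(* A vector outside the span of s, minus its projection onto that span. *)
have Mne : exists2 x, M x & x != 0.
  have [x xP] := Hinf (fun i : 'I_(size s) => s`_i).
  exists (x - \sum_(i < size s) dotp x s`_i *: s`_i); last first.
    by rewrite subr_eq0; apply/eqP/xP.
  move=> i si; rewrite dotpBl dotp_suml (bigD1 (Ordinal si))//= dotpZl sort// eqxx.
  rewrite mulr1 big1 ?addr0 ?subrr// => j ji.
  by rewrite dotpZl sort// (negbTE (ji : (j : nat) != i)) mulr0.
have [z [k [Mz z0 k0 Kz kP]]] := max_eigenvector Mlin MK Mlim Mne.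
have [z' [b [Mz' z'1 Kz' Bz']]] := common_eigenvector Mlin MB Mz z0 Kz.
by exists (z', k, b); split.
Qed.

Theorem eigenbasis : exists (e : nat -> H) (k b : nat -> R),
  [/\ orthonormal_seq e /\ total_seq e, is_diag e k K, is_diag e b B,
      forall n, 0 < k n &
      forall eps, 0 < eps -> exists N, forall n, (N <= n)%N -> k n <= eps].
Proof.
have /choice[F FP] s : exists p, eigen_list s -> next_eigen s p.
  have [/next_eigen_ex[p]|ns] := pselect (eigen_list s); first by exists p.
  (* Default value for lists that are not of the required kind; [good] shows that the recursion
     never meets one. *)
  by exists (0, 0, 0).
pose L := fix L n := if n is m.+1 then rcons (L m) (F (L m)).1.1 else [::].
pose e n := (F (L n)).1.1; pose k n := (F (L n)).1.2; pose b n := (F (L n)).2.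
have sL n : size (L n) = n by elim: n => //= n IH; rewrite size_rcons IH.
have eL n i : (i < n)%N -> (L n)`_i = e i.
  elim: n => //= n IH; rewrite ltnS nth_rcons sL leq_eqVlt => /predU1P[->|i_n].
    by rewrite ltnn eqxx.
  by rewrite i_n IH.
have step n : eigen_list (L n) -> next_eigen (L n) (e n, k n, b n).
  by move=> /FP; rewrite /e /k /b; case: (F (L n)) => -[].
have good n : eigen_list (L n).
  elim: n => [|n IH]; first by split.
  have [orth e1 _ eig _] := step _ IH; have [IHe IHo] := IH.
  split=> [i|i j]; rewrite sL.
    rewrite ltnS leq_eqVlt => /predU1P[->|i_n].
      by rewrite eL//; exists (k n), (b n).
    by rewrite eL ?(ltn_trans i_n)// -(eL n i)//; apply: IHe; rewrite sL.
  move=> iS jS; rewrite !eL//.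
  have en m : (m < n)%N -> dotp (e n) (e m) = 0.
    by move=> mn; rewrite -(eL n m)// orth// sL.
  move: iS jS; rewrite !ltnS leq_eqVlt => /predU1P[->|i_n]; rewrite leq_eqVlt => /predU1P[->|j_n].
  - by rewrite dotp_nrm e1 expr1n eqxx.
  - by rewrite en// gtn_eqF.
  - by rewrite dotpC en// conjC0 ltn_eqF.
  - by rewrite -(eL n i)// -(eL n j)// IHo ?sL.
have st n := step n (good n).
have oe : orthonormal_seq e.
  move=> m n; pose N := (maxn m n).+1; have [_ ort] := good N.
  have mN : (m < N)%N by rewrite ltnS leq_maxl.
  have nN : (n < N)%N by rewrite ltnS leq_maxr.
  by rewrite -(eL N m)// -(eL N n)// ort ?sL.
have Kd : is_diag e k K by move=> n; have [_ _ _ []] := st n.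
have Bd : is_diag e b B by move=> n; have [_ _ _ []] := st n.
have k0 n : 0 < k n by have [] := st n.
have kmax n x : (forall i, (i < n)%N -> dotp x (e i) = 0) -> nrm (K x) <= k n * nrm x.
  move=> xe; have [_ _ _ _] := st n; apply => i; rewrite sL => i_n.
  by rewrite eL// xe.
have k_noninc n m : (n <= m)%N -> k m <= k n.
  move=> nm; have : nrm (K (e m)) <= k n * nrm (e m).
    by apply: kmax => i i_n; rewrite oe gtn_eqF// (leq_trans i_n).
  by rewrite Kd nrmZr !nrm_orthonormal// !mulr1 gtr0_norm.
(* If all eigenvalues exceeded eps, the orthogonal vectors K (e n) would stay more than eps apart,
   against compactness. *)
have ksmall eps : 0 < eps -> exists N, k N <= eps.
  move=> eps0; apply: contrapT => /forallNP kbig.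
  have kb n : eps < k n by rewrite ltNge; apply/negP/kbig.
  have [|y yP] := @compact_seq _ _ K e Kcpt; first by move=> n; rewrite nrm_orthonormal.
  have e20 : 0 < eps / 2 by rewrite divr_gt0.
  have [n _ ny] := yP _ 0%N e20; have [m nm my] := yP _ n.+1 e20.
  have : nrm (K (e n) - K (e m)) < eps.
    apply: le_lt_trans (nrm_dist _ y _) _; rewrite [ltRHS]splitr.
    by apply: ltrD => //; rewrite nrmBC.
  rewrite -(@ltr_pXn2r _ 2)// ?nnegrE ?nrm_ge0 ?(ltW eps0)// nrm_sqrB !Kd.
  rewrite rdotZl rdotZr !nrmZr !nrm_orthonormal// {1}/rdot oe ltn_eqF//= !mulr0 subr0 !mulr1.
  rewrite !gtr0_norm//; have := kb n; have := kb m; have := eps0; nra.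
exists e, k, b; split=> //.
(* A vector orthogonal to all e n satisfies |K x| <= k n |x| for every n, by maximality of the
   eigenvalues; hence K x = 0. *)
- split=> // x xe; apply/eqP/negPn/negP => x0.
  have nx : 0 < nrm x by rewrite nrm_gt0.
  have Kx : 0 < nrm (K x).
    by rewrite nrm_gt0; apply: contraTneq (Kpos x0) => ->; rewrite rdot0l ltxx.
  have [|N kN] := ksmall (nrm (K x) / nrm x / 2); first by rewrite !divr_gt0.
  have := kmax N x (fun i _ => xe i).
  rewrite leNgt => /negP; apply; rewrite -ltr_pdivlMr//.
  apply: (le_lt_trans kN); rewrite ltr_pdivrMr// ltr_pMr ?divr_gt0//.
  by rewrite ltr1n.
- move=> eps /ksmall[N kN]; exists N => n Nn; exact: le_trans (k_noninc _ _ Nn) kN.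
Qed.

End eigenbasis.

(** * Operators of [RKsa] as diagonal operators, and their bounded transforms *)

Section diagonal_operators.
Variables (R : realType) (H : hilbertType R).
Implicit Types (x y : H) (e : nat -> H) (lam : nat -> R).

(** Multiplication by lam on its maximal domain: the second component witnesses summability, so no
    condition on x is written. *)
Definition diag_graph e lam : set (H * H) :=
  [set p | forall n, dotp p.2 (e n) = (lam n)%:C * dotp p.1 (e n)].

Definition diverges lam := forall M, exists N, forall n, (N <= n)%N -> M <= `|lam n|.

(** The form in which A is handled later; [diverges] carries the compactness of the resolvent. *)
Definition eigen_data (A : regop H) e lam :=
  [/\ orthonormal_seq e, total_seq e, diverges lam & graph A = diag_graph e lam].

Lemma sqr1D_gt0 (t : R) : 0 < 1 + t ^+ 2.
Proof. by rewrite ltr_pwDl// sqr_ge0. Qed.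

Lemma sqr1D_ge0 (t : R) : 0 <= 1 + t ^+ 2.
Proof. exact/ltW/sqr1D_gt0. Qed.

Section fixed_basis.
Variables (e : nat -> H) (lam : nat -> R).
Hypotheses (oe : orthonormal_seq e) (te : total_seq e).

Lemma diag_graph_basis n : diag_graph e lam (e n, (lam n)%:C *: e n).
Proof.
by move=> m /=; rewrite dotpZl oe; case: eqP => [->|]; rewrite ?mulr0.
Qed.

Lemma diag_graph_operator : operator_graph (diag_graph e lam).
Proof.
split=> [n|a p q Gp Gq n|x y z Gy Gz] /=.
- by rewrite !dotp0l mulr0.
- by rewrite !dotpDl !dotpZl Gp Gq; ring.
- by apply: (coef_inj te) => n; rewrite Gy Gz.
Qed.

(** Presents the graph as an intersection of zero sets of real continuous functions, for closedness;
    pairing with i e n yields the imaginary parts. *)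
Lemma diag_graph_rdot p : diag_graph e lam p <->
  forall n, rdot p.2 (e n) - lam n * rdot p.1 (e n) = 0 /\
            rdot p.2 ('i *: e n) - lam n * rdot p.1 ('i *: e n) = 0.
Proof.
split=> Gp n.
  have h := Gp n; split; first by rewrite /rdot h complexReMr subrr.
  by rewrite /rdot !dotpZr h (mulrCA _ (lam n)%:C) complexReMr subrr.
have [/eqP + /eqP] := Gp n; rewrite !subr_eq0 => /eqP h1 /eqP h2.
rewrite -[RHS]dotpZl; apply: dotp_rdot_eq; by rewrite rdotZl.
Qed.

Lemma diag_graph_closed : closed (diag_graph e lam).
Proof.
have cg z (l : R) : continuous (fun p : H * H => rdot p.2 z - l * rdot p.1 z).
  move=> p; apply: cvgB; first by apply: cvg_rdotl; exact: cvg_snd.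
  by apply: cvgMr; apply: cvg_rdotl; exact: cvg_fst.
have cl z (l : R) : closed [set p : H * H | rdot p.2 z - l * rdot p.1 z = 0].
  have -> : [set p : H * H | rdot p.2 z - l * rdot p.1 z = 0] =
      (fun p : H * H => rdot p.2 z - l * rdot p.1 z) @^-1` [set 0] by [].
  by apply: closed_comp => [p _|]; [exact: cg|exact: closed_eq].
have -> : diag_graph e lam = \bigcap_n
   ([set p : H * H | rdot p.2 (e n) - lam n * rdot p.1 (e n) = 0] `&`
    [set p : H * H | rdot p.2 ('i *: e n) - lam n * rdot p.1 ('i *: e n) = 0]).
  apply/seteqP; split=> p; first by move=> /diag_graph_rdot h n _; exact: h.
  by move=> h; apply/diag_graph_rdot => n; exact: h.
by apply: closed_bigI => n _; apply: closedI; exact: cl.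
Qed.

Lemma diag_graph_dense : dense (domain (diag_graph e lam)).
Proof.
move=> O [x Ox] Oo.
have xO : nbhs x O by exact: open_nbhs_nbhs.
have [N _ /(_ N (leqnn N)) ON] := psum_cvg oe te xO.
exists (psum e (fun k => dotp x (e k)) N); split=> //.
exists (psum e (fun k => (lam k)%:C * dotp x (e k)) N) => n /=.
by rewrite !dotp_psum//; case: ifP; rewrite ?mulr0.
Qed.

Lemma diag_graph_regular : is_regular (diag_graph e lam).
Proof.
split; [exact: diag_graph_operator|exact: diag_graph_closed|exact: diag_graph_dense].
Qed.

Lemma diag_graph_adjoint : adjoint (diag_graph e lam) = diag_graph e lam.
Proof.
apply/seteqP; split=> [q qP n|q Gq p Gp].
  have := qP _ (diag_graph_basis n); rewrite /= dotpZl => h.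
  by rewrite dotpC -h rmorphM /= conj_realc -dotpC.
apply: (@cvg_dotp_eq _ _ (psum e (fun k => dotp p.2 (e k)))
  (psum e (fun k => dotp p.1 (e k)))) => [N||]; [|exact: psum_cvg..].
rewrite !dotp_psum2; apply: eq_bigr => k _.
by rewrite Gp Gq rmorphM /= conj_realc; ring.
Qed.

(** [is_diag] only has real eigenvalues, so 1 / (t + i) is split as t / (1 + t^2) - i / (1 + t^2).
    Both parts have square at most 1 / (1 + t^2), which tends to 0 along lam. *)
Lemma diag_graph_resolvent : diverges lam ->
  exists2 T : bop H, bounded_inverse (shift_graph 'i (diag_graph e lam)) T & compact_op T.
Proof.
move=> lamD.
have small (phi : nat -> R) : (forall n, phi n ^+ 2 <= (1 + lam n ^+ 2)^-1) ->
    forall eps, 0 < eps -> exists N, forall n, (N <= n)%N -> `|phi n| <= eps.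
  move=> phiP eps eps0; have [N NP] := lamD (eps^-1); exists N => n /NP lamn.
  rewrite -(@ler_pXn2r _ 2)// ?nnegrE ?(ltW eps0)// real_normK ?num_real//.
  apply: (le_trans (phiP n)); rewrite -[leRHS]invrK lef_pV2 ?posrE ?sqr1D_gt0//; last first.
    by rewrite invr_gt0 exprn_gt0.
  rewrite -exprVn; apply: (@le_trans _ _ (lam n ^+ 2)); last by rewrite lerDr.
  by rewrite -[leRHS]real_normK ?num_real// ler_pXn2r// nnegrE invr_ge0 ltW.
have bnd (phi : nat -> R) : (forall n, phi n ^+ 2 <= (1 + lam n ^+ 2)^-1) -> forall n, `|phi n| <= 1.
  move=> phiP n; rewrite -(@ler_pXn2r _ 2)// ?nnegrE// real_normK ?num_real//.
  apply: (le_trans (phiP n)); rewrite expr1n invf_le1 ?sqr1D_gt0//.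
  by rewrite lerDl sqr_ge0.
have l1 n : (lam n / (1 + lam n ^+ 2)) ^+ 2 <= (1 + lam n ^+ 2)^-1.
  rewrite expr_div_n ler_pdivrMr ?exprn_gt0 ?sqr1D_gt0// expr2 mulrA.
  by rewrite mulVf ?gt_eqF ?sqr1D_gt0// mul1r lerDr.
have l2 n : (1 + lam n ^+ 2)^-1 ^+ 2 <= (1 + lam n ^+ 2)^-1.
  rewrite expr2 ler_piMr ?invr_ge0 ?sqr1D_ge0//.
  by rewrite invf_le1 ?sqr1D_gt0// lerDl sqr_ge0.
have [D1 D1P] := is_diag_ex oe te (bnd _ l1).
have [D2 D2P] := is_diag_ex oe te (bnd _ l2).
exists (D1 - 'i *: D2); last first.
  apply: compact_opB; first exact: (is_diag_compact oe te D1P (small _ l1)).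
  by apply: compact_opZ; exact: (is_diag_compact oe te D2P (small _ l2)).
have Tc y n : dotp ((D1 - 'i *: D2) y) (e n) = dotp y (e n) / ((lam n)%:C + 'i).
  rewrite bopBE bopZE dotpBl dotpZl (is_diag_coef oe te _ _ D1P) (is_diag_coef oe te _ _ D2P).
  have d0 : (lam n)%:C + 'i != 0 :> R[i].
    by rewrite eq_complex /= addr0 add0r oner_eq0 andbF.
  apply: (mulIf d0); rewrite mulfVK//.
  have s0 : (1 + lam n ^+ 2)%:C != 0 :> R[i].
    by rewrite (inj_eq (@complexI R)) gt_eqF ?sqr1D_gt0.
  apply: (mulIf s0); rewrite rmorphM !fmorphV /=.
  rewrite [LHS](_ : _ = dotp y (e n) * (((lam n)%:C - 'i) * ((lam n)%:C + 'i))); last first.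
    set s := (1 + lam n ^+ 2)%:C in s0 *; clearbody s; by field.
  congr (_ * _); rewrite -subr_sqr sqr_i opprK rmorphD rmorphXn rmorph1 addrC.
  by [].
move=> x y; split=> [Gxy|<- n /=].
  apply: (coef_inj te) => n; rewrite Tc; have /eqP := Gxy n; rewrite /= dotpBl dotpZl.
  rewrite subr_eq -mulrDl => /eqP ->; rewrite mulrC mulKf//.
  by rewrite eq_complex /= addr0 add0r oner_eq0 andbF.
rewrite dotpBl dotpZl Tc; apply/eqP; rewrite subr_eq -mulrDl mulrC divfK//.
by rewrite eq_complex /= addr0 add0r oner_eq0 andbF.
Qed.

End fixed_basis.

Definition btr (t : R) : R := t / Num.sqrt (1 + t ^+ 2).

Lemma sqrt1D_gt0 (t : R) : 0 < Num.sqrt (1 + t ^+ 2).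
Proof. by rewrite sqrtr_gt0 sqr1D_gt0. Qed.

Lemma btr_sqr t : btr t ^+ 2 = 1 - (1 + t ^+ 2)^-1.
Proof.
rewrite /btr expr_div_n sqr_sqrtr ?sqr1D_ge0//.
by field; rewrite gt_eqF ?sqr1D_gt0.
Qed.

Lemma btr_norm_le1 t : `|btr t| <= 1.
Proof.
rewrite -(@ler_pXn2r _ 2)// ?nnegrE// real_normK ?num_real// btr_sqr expr1n.
by rewrite gerBl invr_ge0 ltW ?sqr1D_gt0.
Qed.

Lemma btr_ge0 t : (0 <= btr t) = (0 <= t).
Proof. by rewrite /btr pmulr_lge0// invr_gt0 sqrt1D_gt0. Qed.

Lemma btr_eq0 t : (btr t == 0) = (t == 0).
Proof. by rewrite /btr mulf_eq0 invr_eq0 (gt_eqF (sqrt1D_gt0 t)) orbF. Qed.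

(** The diagonal operator shows that [get] has a candidate. For the chosen F and its root S', on e n
    the square of S' is s^2, and w = S' e n - s e n satisfies S' w = - s w; positivity forces w = 0,
    and the graph condition then gives F e n. *)
Lemma bounded_transformP (A : regop H) e lam : eigen_data A e lam ->
  is_diag e (btr \o lam) (bounded_transform A).
Proof.
move=> [oe te _ AE].
have adjA : adjoint A = A by rewrite AE diag_graph_adjoint.
have iB n : `|(Num.sqrt (1 + lam n ^+ 2))^-1| <= 1.
  rewrite gtr0_norm ?invr_gt0 ?sqrt1D_gt0// invf_le1 ?sqrt1D_gt0//.
  by rewrite -[leLHS]sqrtr1 ler_wsqrtr// lerDl sqr_ge0.
have [S SP] := is_diag_ex oe te iB.
have [F FP] := is_diag_ex oe te (fun n => btr_norm_le1 (lam n)).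
have compE x y : shift_graph 1 (comp_graph (adjoint A) A) (x, y) <->
    forall n, dotp y (e n) = (1 + lam n ^+ 2)%:C * dotp x (e n).
  rewrite adjA AE; split=> [[z /= [xz zy]] n|h].
    have := zy n; have := xz n; rewrite /= => -> /eqP.
    rewrite scale1r dotpBl subr_eq => /eqP ->.
    by rewrite rmorphD rmorphXn rmorph1 /=; ring.
  have [z _ zP] : exists2 z, psum e (fun n => (lam n)%:C * dotp x (e n)) @ \oo --> z &
      forall n, dotp z (e n) = (lam n)%:C * dotp x (e n).
    apply: (riesz_fischer_cvg oe (M := nrm y ^+ 2)) => N.
    apply: le_trans (bessel oe y N); apply: ler_sum => k _.
    rewrite h !csqMr ler_wpM2r ?csq_ge0//.
    have := sqr_ge0 (lam k); nra.
  exists z; split=> n /=; first exact: zP.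
  by rewrite scale1r dotpBl zP h rmorphD rmorphXn rmorph1 /=; ring.
have FT : is_bounded_transform A F.
  exists S; split.
  - by apply: (is_diag_pos oe te SP) => n; rewrite invr_ge0 ltW ?sqrt1D_gt0.
  - move=> x y; rewrite compE; split=> [h|<- n].
      apply: (coef_inj te) => n; rewrite 2!(is_diag_coef oe te _ _ SP) h !mulrA -!rmorphM.
      rewrite -invfM -expr2 sqr_sqrtr ?sqr1D_ge0// mulVf ?mul1r//.
      by rewrite gt_eqF ?sqr1D_gt0.
    rewrite 2!(is_diag_coef oe te _ _ SP) !mulrA -!rmorphM -mulrA -invfM -expr2.
    rewrite sqr_sqrtr ?sqr1D_ge0// mulfV ?mul1r//.
    by rewrite gt_eqF ?sqr1D_gt0.
  - move=> x; rewrite AE => n /=.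
    by rewrite (is_diag_coef oe te _ _ SP) (is_diag_coef oe te _ _ FP) mulrA -rmorphM.
have [S' [S'pos S'sqr S'A]] : is_bounded_transform A (bounded_transform A).
  exact: (@getPex _ [set F | is_bounded_transform A F] (ex_intro _ F FT)).
move=> n; set s := (Num.sqrt (1 + lam n ^+ 2))^-1.
have s0 : 0 < s by rewrite invr_gt0 sqrt1D_gt0.
have S'e : S' (e n) = s%:C *: e n.
  have SSe : S' (S' (e n)) = (s ^+ 2)%:C *: e n.
    apply/S'sqr/compE => m; rewrite dotpZl oe; case: eqP => [<-|_]; last by rewrite !mulr0.
    rewrite mulrA -rmorphM /s exprVn sqr_sqrtr ?sqr1D_ge0// mulfV ?mul1r//.
    by rewrite gt_eqF ?sqr1D_gt0.
  apply/eqP; rewrite -subr_eq0; apply/negPn/negP; set w := _ - _ => w0.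
  have S'w : S' w = - (s%:C *: w).
    rewrite /w bopBr bopZr SSe scalerBr scalerA -rmorphM -expr2 opprB.
    by [].
  have := S'pos w; rewrite S'w dotpNl dotpZl dotp_nrm -rmorphM -rmorphN ler0c /=.
  by rewrite oppr_ge0 leNgt mulr_gt0// exprn_gt0// nrm_gt0.
have := S'A (e n); rewrite AE => h; apply: (coef_inj te) => m.
rewrite h /= S'e !dotpZl oe.
by case: eqP => [<-|_]; rewrite ?mulr0// !mulr1 -rmorphM.
Qed.

Lemma diverges_inv (k lam : nat -> R) : (forall n, 0 < k n) ->
  (forall eps, 0 < eps -> exists N, forall n, (N <= n)%N -> k n <= eps) ->
  (forall n, lam n ^+ 2 = (k n)^-1 - 1) -> diverges lam.
Proof.
move=> k0 ksmall lamE M.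
have M1 : 0 < (1 + M ^+ 2)^-1 by rewrite invr_gt0 sqr1D_gt0.
have [N NP] := ksmall _ M1; exists N => n /NP kn.
apply: (le_trans (ler_norm M)); rewrite -(@ler_pXn2r _ 2)// ?nnegrE//.
rewrite !real_normK ?num_real// lamE lerBrDr addrC.
by rewrite -[leLHS]invrK lef_pV2 ?posrE.
Qed.

(* With T = (A + i)^-1, the operators K = T T^* = (1 + A^2)^-1 and
   B = T + i K = A K satisfy B^2 = K - K^2. *)
Lemma eigen_data_ex (Hinf : infinite_dimensional H) (A : regop H) :
  self_adjoint A -> compact_resolvents A -> exists e lam, eigen_data A e lam.
Proof.
move=> Asa [T TA Tcpt].
have [[A00 Alin Afun] _ _] := regopP A.
have [T' TT'] := adjoint_ex T.
have TT'c x y : dotp (T x) y = dotp x (T' y).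
  by apply: dotp_rdot_eq; rewrite ?TT' -?bopZr// TT' bopZr.
have Asym p q : graph A p -> graph A q -> dotp p.2 q.1 = dotp p.1 q.2.
  by move=> Ap; rewrite -{1}[graph A]Asa; apply.
have AT y : graph A (T y, y - 'i *: T y) by apply/(TA (T y) y).
(* T' is (A - i)^-1: the pair satisfies the defining condition of the adjoint graph, which is the
   graph of A. *)
have AT' y : graph A (T' y, y + 'i *: T' y).
  rewrite -[graph A]Asa => -[u v] /= Auv.
  have Tu : T (v + 'i *: u) = u.
    by apply/(TA u (v + 'i *: u)); rewrite /shift_graph /= addrK.
  have := TT'c (v + 'i *: u) y; rewrite Tu dotpDl dotpZl dotpDr dotpZr => ->.
  rewrite -addrA -mulrDl (_ : 'i + _ = 0) ?mul0r ?addr0//.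
  by apply/eqP; rewrite eq_complex /= !addr0 subrr eqxx.
have AB p q : graph A p -> graph A q -> graph A (p - q).
  by move=> Ap Aq; rewrite addrC -scaleN1r; exact: Alin.
(* Resolvent identity for (A - i)^-1 and (A + i)^-1; with its counterpart in the other order it
   makes T and T' commute. *)
have T'T y : T' y = T y + (2 * 'i) *: T (T' y).
  have E : T (y + (2 * 'i) *: T' y) = T' y.
    apply/(TA (T' y)); rewrite /shift_graph /=.
    rewrite (_ : _ - _ = y + 'i *: T' y)//.
    by rewrite mulrDl mul1r scalerDl addrA addrK.
  by rewrite -[LHS]E bopDr bopZr.
(* Two solutions differ by some w with A w = i w, and w = 0 since A is symmetric. *)
have T'unique x y : graph A (x, y + 'i *: x) -> T' y = x.
  move=> Axy; apply/eqP; rewrite -subr_eq0; apply/eqP; set w := _ - _.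
  have Aw : graph A (w, 'i *: w).
    have -> : 'i *: w = (y + 'i *: T' y) - (y + 'i *: x).
      by rewrite /w scalerBr opprD addrACA subrr add0r.
    exact: (AB _ _ (AT' y) Axy).
  have := Asym _ _ Aw Aw; rewrite /= dotpZl dotpZr dotp_nrm => /eqP.
  rewrite eq_complex /= => /andP[_ /eqP h]; apply/eqP.
  by rewrite -nrm_eq0 -sqrf_eq0; apply/eqP; move: h; lra.
have TT'T y : T y = T' y - (2 * 'i) *: T' (T y).
  have E : T' (y - (2 * 'i) *: T y) = T y.
    apply: T'unique; rewrite (_ : _ + _ = y - 'i *: T y)//.
    by rewrite mulrDl mul1r scalerDl opprD addrA addrNK.
  by rewrite -[LHS]E bopBr bopZr.
have comm : T * T' = T' * T.
  apply: bopP => y; rewrite !bopME.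
  have i2 : (2 * 'i : R[i]) != 0 by rewrite mulf_neq0// eq_complex /= oner_eq0 andbF.
  apply: (scalerI i2).
  have -> : (2 * 'i) *: T (T' y) = T' y - T y by rewrite [X in X - _]T'T addrC addKr.
  by rewrite [X in _ - X]TT'T opprB addrC subrK.
have T'Tc x y : dotp (T' x) y = dotp x (T y) by rewrite dotpC -TT'c -dotpC.
pose K := T * T'; pose B := T + 'i *: K.
have BE x : B x = T' x - 'i *: K x.
  by rewrite bopDE bopZE T'T mulrDl mul1r scalerDl addrA addrK.
have Kcpt : compact_op K by exact: compact_opMr.
have Ksa : self_adj K by move=> x y; rewrite !bopME TT'c T'Tc.
have Bsa : self_adj B.
  move=> x y; rewrite {1}BE dotpBl dotpZl T'Tc Ksa bopDE bopZE dotpDr dotpZr.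
  by congr (_ + _); rewrite -mulNr; congr (_ * _); apply/eqP; rewrite eq_complex /= oppr0 !eqxx.
have Kpos x : x != 0 -> 0 < rdot (K x) x.
  move=> x0; rewrite bopME TT' rdot_nrm exprn_gt0// nrm_gt0.
  apply: contraNneq x0 => T'x; have := AT' x; rewrite T'x scaler0 addr0 => A0x.
  by apply/eqP; exact: Afun A0x A00.
have KB : K * B = B * K.
  rewrite mulrDr mulrDl -bopZAr -bopZAl; congr (_ + _).
  by rewrite -mulrA -comm.
have Bsqr (k : R) x : K x = k%:C *: x -> B (B x) = (k - k ^+ 2)%:C *: x.
  move=> Kx; rewrite {1}/B bopDE bopZE -(bopME K) KB bopME Kx bopZr.
  rewrite {1}BE bopBr -bopME -/K Kx !bopZr bopDE bopZE Kx !scalerDr !scalerA.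
  rewrite (_ : 'i * k%:C * 'i * k%:C = - (k ^+ 2)%:C); last first.
    by rewrite -mulrA mulrACA -expr2 sqr_i mulN1r rmorphXn.
  by rewrite addrA subrK scaleNr rmorphB scalerBl.
have [e [k [b [[oe te] Ke Be k0 ksmall]]]] := eigenbasis Kcpt Ksa Bsa Kpos KB Bsqr Hinf.
have kn0 n : (k n)%:C != 0 :> R[i] by rewrite (inj_eq (@complexI R)) gt_eqF.
pose lam n := b n / k n.
have Ae n : graph A (e n, (lam n)%:C *: e n).
  have := AT (T' (e n)); rewrite -bopME -/K -BE Ke Be => h.
  have := Alin ((k n)^-1%:C) _ _ h A00; rewrite /= !addr0.
  rewrite -[_ *: (_, _)]/(_ *: _, _ *: _) !scalerA -!rmorphM mulVf ?gt_eqF// scale1r.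
  by rewrite mulrC.
have Asub p : graph A p -> diag_graph e lam p.
  move=> Ap n; have := Asym _ _ Ap (Ae n); rewrite /= => ->.
  by rewrite dotpZr conj_realc.
exists e, lam; split=> //.
- apply: (diverges_inv k0 ksmall) => n.
  have := Bsqr _ _ (Ke n); rewrite Be bopZr Be scalerA -rmorphM => /(congr1 (fun v => rdot v (e n))) /=.
  rewrite !rdotZl rdot_nrm nrm_orthonormal// expr1n !mulr1 => bb.
  by rewrite /lam expr_div_n [b n ^+ 2]bb; field; rewrite gt_eqF.
(* Taking adjoints reverses the inclusion of A in the diagonal operator, and both are
   self-adjoint. *)
- apply/seteqP; split=> [p|q Gq]; first exact: Asub.
  rewrite -[graph A]Asa => p /Asub; move: q Gq.
  by rewrite -{1}(diag_graph_adjoint lam oe te) => q; apply.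
Qed.

(** [eigenbasis] is applied to K = 1 - F^2 and B = F. If k and b are the eigenvalues of K and F on e
    n, then b^2 = 1 - k, and A has eigenvalue b / sqrt k, the inverse of t / sqrt (1 + t^2) at b. *)
Lemma RKsa_of_bounded (Hinf : infinite_dimensional H) (F : bop H) :
  self_adj F -> (forall x : H, x != 0 -> nrm (F x) < nrm x) -> compact_op (1 - F * F) ->
  exists A : RKsa H, bounded_transform (val A) = F.
Proof.
move=> Fsa Flt Fcpt; set K := 1 - F * F in Fcpt.
have Ksa : self_adj K by apply: self_adjB; [exact: self_adj1|exact: self_adj_sqr].
have Kpos x : x != 0 -> 0 < rdot (K x) x.
  move=> x0; rewrite bopBE bopME bop1E rdotBl (self_adj_rdot Fsa) !rdot_nrm.
  by rewrite subr_gt0 ltr_pXn2r ?nnegrE ?nrm_ge0// Flt.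
have KF : K * F = F * K by rewrite mulrBl mulrBr mul1r mulr1 mulrA.
have Fsqr (k : R) x : K x = k%:C *: x -> F (F x) = (1 - k)%:C *: x.
  by move=> Kx; rewrite rmorphB scalerBl -Kx scale1r bopBE bopME opprB addrC subrK.
have [e [k [b [[oe te] Ke Fe k0 ksmall]]]] := eigenbasis Fcpt Ksa Fsa Kpos KF Fsqr Hinf.
pose lam n := b n / Num.sqrt (k n).
have bk n : b n ^+ 2 = 1 - k n.
  have := Fsqr _ _ (Ke n); rewrite Fe bopZr Fe scalerA -rmorphM => /(congr1 (fun v => rdot v (e n))) /=.
  by rewrite !rdotZl rdot_nrm nrm_orthonormal// expr1n !mulr1.
have lam2 n : lam n ^+ 2 = (k n)^-1 - 1.
  rewrite /lam expr_div_n sqr_sqrtr ?ltW// bk.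
  by field; rewrite gt_eqF.
have lamD : diverges lam by exact: diverges_inv k0 ksmall lam2.
pose A := Regop (diag_graph_regular lam oe te).
have Asa : RKsa H A.
  split; first exact: diag_graph_adjoint.
  exact: diag_graph_resolvent.
have AE : RKsa H A by [].
exists (exist _ A (mem_set AE)) => /=.
apply: (is_diag_uniq oe te (bounded_transformP (e := e) (lam := lam) _)); first by split.
apply: (is_diag_ext _ Fe) => n /=.
rewrite /btr lam2 addrC subrK sqrtrV ?ltW// invrK /lam divfK//.
by rewrite gt_eqF// sqrtr_gt0.
Qed.

(** As |lam n| tends to infinity, nonzero eigenvalues stay away from 0: all but finitely many
    inverses are bounded by 1. *)
Lemma invertible_eigen (A : regop H) e lam : eigen_data A e lam ->
  invertible A <-> forall n, lam n != 0.
Proof.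
move=> [oe te lamD AE]; split=> [[T TA] n|lam0].
  apply: contraTneq isT => lamn; have : T 0 = e n.
    by apply/TA; rewrite AE => m /=; rewrite dotp0l dotpC oe; case: eqP => [->|];
      rewrite ?conjC0 ?mulr0// lamn mul0r.
  by rewrite bop0r => /esym/(congr1 (@nrm _ _)); rewrite nrm_orthonormal// nrm0 => /eqP; rewrite oner_eq0.
have [N NP] := lamD 1.
have [M MP] : exists M, forall n, `|(lam n)^-1| <= M.
  exists (1 + \sum_(k < N) `|(lam k)^-1|) => n; have [nN|Nn] := ltnP n N.
    rewrite (bigD1 (Ordinal nN)) //= addrCA lerDl addr_ge0// sumr_ge0//.
  apply: (@le_trans _ _ 1); last by rewrite lerDl sumr_ge0.
  by rewrite normfV invf_le1 ?NP// normr_gt0.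
have [T TP] := is_diag_ex oe te MP; exists T => x y; rewrite AE.
have l0 n : (lam n)%:C != 0 :> R[i] by rewrite (inj_eq (@complexI R)).
split=> [Gxy|<- n /=].
  apply: (coef_inj te) => n; rewrite (is_diag_coef oe te _ _ TP) (Gxy n) mulrA.
  by rewrite fmorphV /= mulVf// mul1r.
by rewrite (is_diag_coef oe te _ _ TP) mulrA fmorphV /= mulfV// mul1r.
Qed.

End diagonal_operators.

(** * Spectral measures of diagonal operators *)
Section spectral_measure.
Variables (R : realType) (H : hilbertType R).
Implicit Types (x y : H) (S : set R).

Lemma indic_norm_le1 S (t : R) : `|\1_S t : R| <= 1.
Proof. by rewrite indicE; case: (t \in S); rewrite ?normr1 ?normr0. Qed.

Lemma indic_sqr S (t : R) : \1_S t * \1_S t = \1_S t :> R.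
Proof. by rewrite indicE; case: (t \in S); rewrite ?mulr1 ?mulr0. Qed.

Section existence.
Variables (e : nat -> H) (lam : nat -> R).
Hypotheses (oe : orthonormal_seq e) (te : total_seq e).

Definition diag_pvm S : bop H :=
  sval (is_diag_ex oe te (fun n => indic_norm_le1 S (lam n))).

Lemma diag_pvmP S : is_diag e (\1_S \o lam) (diag_pvm S).
Proof. exact: (svalP (is_diag_ex oe te (fun n => indic_norm_le1 S (lam n)))). Qed.

Lemma diag_pvm_proj S : orthogonal_projection (diag_pvm S).
Proof. by apply: (is_diag_proj oe te (diag_pvmP S)) => n; exact: indic_sqr. Qed.

Lemma is_diag_sum (phi : nat -> nat -> R) (T : nat -> bop H) n :
  (forall k, is_diag e (phi k) (T k)) ->
  is_diag e (fun m => \sum_(0 <= k < n) phi k m) (\sum_(0 <= k < n) T k).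
Proof.
move=> hT; elim: n => [|n IH]; first by move=> m; rewrite !big_nil scale0r.
move=> m; rewrite !big_nat_recr// bopDE IH (hT n) -scalerDl -rmorphD.
by [].
Qed.

Lemma bop_sum_apply (T : nat -> bop H) n x :
  (\sum_(0 <= k < n) T k) x = \sum_(0 <= k < n) T k x.
Proof.
elim: n => [|n IH]; first by rewrite !big_nil.
by rewrite !big_nat_recr// bopDE IH.
Qed.

(** For countable additivity, the remainder after n terms is diagonal with eigenvalues [psi n]. By
    disjointness each of them vanishes for large n, hence finitely many do so together, and
    [is_diag_tail] bounds the rest. *)
Lemma diag_pvm_spectral : projection_valued_measure diag_pvm.
Proof.
split=> [S _|x|F mF tF x]; first exact: diag_pvm_proj.
  suff -> : diag_pvm setT = 1 by [].
  apply: (is_diag_uniq oe te _ (is_diag1 e)) => n.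
  by rewrite diag_pvmP /= indicE in_setT.
apply/cvg_nrmP => eps eps0.
have eps20 : 0 < eps / 2 by rewrite divr_gt0.
have [N NP] := is_diag_tail oe te x eps20.
pose psi n m := \1_(\bigcup_n F n) (lam m) - \sum_(0 <= k < n) \1_(F k) (lam m) : R.
have psiE n m : psi n m = \1_(\bigcup_(k in [set k | (n <= k)%N]) F k) (lam m).
  rewrite /psi; apply/eqP; rewrite subr_eq; apply/eqP.
  elim: n => [|n IH].
    rewrite big_nil addr0; congr (\1__ _); apply: eq_bigcupl; split=> //.
  rewrite {}IH big_nat_recr//= addrCA addrC; congr (_ + _).
  rewrite !indicE; set t := lam m.
  have [Ft|Ft] := boolP (t \in F n).
    have -> : t \in \bigcup_(k in [set k | (n <= k)%N]) F k.
      by apply/mem_set; exists n => //=; exact: set_mem.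
    rewrite memNset ?add0r//= => -[k /= nk Fk].
    have nE : n = k by apply: (tF n k I I); exists t; split=> //; exact: set_mem.
    by rewrite nE ltnn in nk.
  rewrite addr0; congr (_%:R); congr nat_of_bool; apply/idP/idP => /set_mem[k /= nk Fk].
    apply/mem_set; exists k => //=; rewrite ltn_neqAle nk andbT.
    by apply: contraNneq Ft => ->; exact: mem_set.
  by apply/mem_set; exists k => //=; exact: ltnW.
have ev m : exists n0, forall n, (n0 <= n)%N -> psi n m = 0.
  have [[k Fk]|nF] := pselect (exists k, F k (lam m)).
    exists k.+1 => n kn; rewrite psiE indicE memNset//= => -[j /= nj Fj].
    have jk : j = k by apply: (tF j k I I); exists (lam m).
    by move: nj; rewrite jk leqNgt kn.
  by exists 0%N => n _; rewrite psiE indicE memNset//= => -[j _ Fj]; apply: nF; exists j.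
have [n0 n0P] : exists n0, forall n, (n0 <= n)%N -> forall m, (m < N)%N -> psi n m = 0.
  elim: N {NP} => [|N [n0 n0P]]; first by exists 0%N.
  have [n1 n1P] := ev N; exists (maxn n0 n1) => n; rewrite geq_max => /andP[h0 h1] m.
  by rewrite ltnS leq_eqVlt => /predU1P[->|]; [exact: n1P|exact: n0P].
exists n0 => // n /= n0n.
rewrite -bop_sum_apply -bopBE; apply: (@le_lt_trans _ _ (1 * (eps / 2))); last first.
  by rewrite mul1r ltr_pdivrMr// ltr_pMr// ltr1n.
apply: (NP (psi n)) => //.
- exact: (is_diagB (diag_pvmP _) (is_diag_sum n (fun k => diag_pvmP (F k)))).
- by move=> m; rewrite psiE indic_norm_le1.
- exact: n0P.
Qed.

(** The measure sum_n |<x, e n>|^2 delta_(lam n). *)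
Definition diag_mu x : set R -> \bar R :=
  mseries (fun n => mscale (NngNum (csq_ge0 (dotp x (e n)))) (\d_(lam n) : {measure set R -> \bar R})) 0.

HB.instance Definition _ x := Measure.on (diag_mu x).

Lemma nneseries_limit (u : nat -> R) (l : R) :
  (fun N => \sum_(k < N) u k) @ \oo --> l ->
  (\sum_(0 <= k <oo) (u k)%:E = l%:E)%E.
Proof.
move=> ul; apply: cvg_lim => //.
rewrite (_ : (fun _ => _) = EFin \o (fun N => \sum_(k < N) u k)); last first.
  by apply/funext => N /=; rewrite sumEFin big_mkord.
by apply: cvg_EFin => //; exact: nearW.
Qed.

Lemma diag_mu_integral x (g : R -> R) : (forall t, 0 <= g t) ->
  measurable_fun setT g ->
  (\int[diag_mu x]_t (g t)%:E = \sum_(0 <= k <oo) (csq (dotp x (e k)) * g (lam k))%:E)%E.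
Proof.
move=> g0 mg.
have mg' : measurable_fun setT (fun t : R => (g t)%:E) by exact/measurable_EFinP.
rewrite ge0_integral_measure_series//; last by move=> t _; rewrite lee_fin.
apply: eq_eseriesr => k _.
rewrite ge0_integral_mscale//; last by move=> t _; rewrite lee_fin.
by rewrite integral_dirac//= diracE in_setT mul1e EFinM.
Qed.

Lemma dotp_series x y (u : nat -> R) :
  (forall k, u k = complex.Re (dotp y (e k) * Num.conj (dotp x (e k)))) ->
  (fun N => \sum_(k < N) u k) @ \oo --> rdot y x.
Proof.
move=> uE.
have h : (fun N => rdot (psum e (fun k => dotp y (e k)) N) x) @ \oo --> rdot y x.
  by apply: cvg_rdotl; exact: psum_cvg.
rewrite (_ : (fun N => _) = (fun N => rdot (psum e (fun k => dotp y (e k)) N) x))//.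
by apply/funext => N; rewrite /rdot dotp_psum2 raddf_sum; apply: eq_bigr.
Qed.

Lemma csq_dotp x n : complex.Re (dotp x (e n) * Num.conj (dotp x (e n))) = csq (dotp x (e n)).
Proof. by rewrite -csqE. Qed.

Lemma diag_spectral_measure (A : regop H) : graph A = diag_graph e lam ->
  is_spectral_measure A diag_pvm.
Proof.
move=> AE; split; first exact: diag_pvm_spectral.
move=> x; exists (diag_mu x); split.
- move=> S mS; rewrite -/(rdot _ _) rdotC.
  rewrite -[LHS]/(diag_mu x S).
  have -> : diag_mu x S = (\int[diag_mu x]_t (\1_S t)%:E)%E by rewrite integral_indic// setIT.
  rewrite diag_mu_integral; [|by move=> t; rewrite indicE ler0n|exact: measurable_indic].
  apply: nneseries_limit.
  apply: (dotp_series (u := fun k => csq (dotp x (e k)) * \1_S (lam k))) => k.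
  rewrite (is_diag_coef oe te _ _ (diag_pvmP S)) rmorphM /= conj_realc mulrCA.
  by rewrite complexReMr csq_dotp mulrC.
- have mX : measurable_fun setT (fun t : R => t ^+ 2) by exact: measurable_funX.
  rewrite diag_mu_integral//; last by move=> t; exact: sqr_ge0.
  have cE k : csq (dotp x (e k)) * lam k ^+ 2 = csq ((lam k)%:C * dotp x (e k)).
    by rewrite csqMr mulrC.
  rewrite AE; split=> [[y Gxy]|fin].
    apply: (@le_lt_trans _ _ (nrm y ^+ 2)%:E); last exact: ltry.
    apply: lime_le; first by apply: is_cvg_nneseries => k _ _; rewrite lee_fin mulr_ge0 ?csq_ge0 ?sqr_ge0.
    apply: nearW => N; rewrite sumEFin lee_fin big_mkord.
    by apply: le_trans (bessel oe y N); apply: ler_sum => k _; rewrite cE (Gxy k).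
  have [|y _ yE] := @riesz_fischer_cvg _ _ e oe (fun k => (lam k)%:C * dotp x (e k))
    (fine (\sum_(0 <= k <oo) (csq (dotp x (e k)) * lam k ^+ 2)%:E)%E).
    move=> N; rewrite -lee_fin fineK; last first.
      rewrite ge0_fin_numE//; apply: nneseries_ge0 => k _ _.
      by rewrite lee_fin mulr_ge0 ?csq_ge0 ?sqr_ge0.
    under eq_bigr do rewrite -cE.
    rewrite -(big_mkord xpredT (fun k => csq (dotp x (e k)) * lam k ^+ 2)) -sumEFin.
    by apply: nneseries_lim_ge => k _ _; rewrite lee_fin mulr_ge0 ?csq_ge0 ?sqr_ge0.
  by exists y.
- move=> y; rewrite AE => Gxy.
  have symyx : dotp y x = (rdot y x)%:C.
    have : dotp y x = Num.conj (dotp y x).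
      rewrite -dotpC; have : adjoint (diag_graph e lam) (x, y) by rewrite diag_graph_adjoint.
      by move=> /(_ (x, y) Gxy).
    rewrite /rdot; case: (dotp y x) => a b [] /= h; congr (_ +i* _).
    by move/eqP: h; rewrite -addr_eq0 -mulr2n mulrn_eq0 /= => /eqP.
  rewrite symyx; congr (_%:C).
  have yk k : dotp y (e k) = (lam k)%:C * dotp x (e k) := Gxy k.
  have s0 : (fun N => \sum_(k < N) csq (dotp x (e k))) @ \oo --> rdot x x.
    by apply: (dotp_series (u := fun k => csq (dotp x (e k)))) => k; rewrite csq_dotp.
  have s1 : (fun N => \sum_(k < N) lam k * csq (dotp x (e k))) @ \oo --> rdot y x.
    apply: (dotp_series (u := fun k => lam k * csq (dotp x (e k)))) => k.
    by rewrite yk -mulrA complexReMr csq_dotp.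
  have s2 : (fun N => \sum_(k < N) lam k ^+ 2 * csq (dotp x (e k))) @ \oo --> rdot y y.
    apply: (dotp_series (u := fun k => lam k ^+ 2 * csq (dotp x (e k)))) => k.
    by rewrite csq_dotp yk csqMr.
  (* t is written as the difference of two nonnegative integrable functions *)
  pose g1 (t : R) := 1 + t + t ^+ 2; pose g2 (t : R) := 1 + t ^+ 2.
  have mX : measurable_fun setT (fun t : R => t ^+ 2) by exact: measurable_funX.
  have mg1 : measurable_fun setT g1.
    by apply: measurable_funD => //; apply: measurable_funD.
  have mg2 : measurable_fun setT g2 by exact: measurable_funD.
  have g1_ge0 t : 0 <= g1 t by rewrite /g1; have := sqr_ge0 (t + 2^-1); nra.
  have g2_ge0 t : 0 <= g2 t by exact: sqr1D_ge0.
  have I1 : (\int[diag_mu x]_t (g1 t)%:E = (rdot x x + rdot y x + rdot y y)%:E)%E.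
    rewrite diag_mu_integral//; apply: nneseries_limit.
    rewrite (_ : (fun _ => _) = fun N : nat => \sum_(k < N) csq (dotp x (e k)) +
       \sum_(k < N) lam k * csq (dotp x (e k)) + \sum_(k < N) lam k ^+ 2 * csq (dotp x (e k))).
      by apply: cvgD => //; apply: cvgD.
    apply/funext => N; rewrite -!big_split /=; apply: eq_bigr => k _.
    by rewrite /g1; ring.
  have I2 : (\int[diag_mu x]_t (g2 t)%:E = (rdot x x + rdot y y)%:E)%E.
    rewrite diag_mu_integral//; apply: nneseries_limit.
    rewrite (_ : (fun _ => _) = fun N : nat => \sum_(k < N) csq (dotp x (e k)) +
       \sum_(k < N) lam k ^+ 2 * csq (dotp x (e k))).
      by apply: cvgD.
    apply/funext => N; rewrite -!big_split /=; apply: eq_bigr => k _.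
    by rewrite /g2; ring.
  have int_of (g : R -> R) (l : R) : (forall t, 0 <= g t) -> measurable_fun setT g ->
      (\int[diag_mu x]_t (g t)%:E = l%:E)%E -> (diag_mu x).-integrable setT (fun t : R => (g t)%:E).
    move=> g0 mg gE; apply/integrableP; split; first exact/measurable_EFinP.
    rewrite (eq_integral (fun t : R => (g t)%:E)) => [|t _]; first by rewrite [X in (X < _)%E]gE ltry.
    by rewrite /= ger0_norm.
  rewrite /Rintegral (_ : (\int[diag_mu x]_t t%:E)%E =
     (\int[diag_mu x]_t ((g1 t)%:E - (g2 t)%:E))%E); last first.
    by apply: eq_integral => t _; rewrite -EFinB /g1 /g2; congr EFin; ring.
  rewrite integralB_EFin//; [|exact: int_of I1|exact: int_of I2].
  by rewrite I1 I2 -EFinB /=; ring.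
Qed.

End existence.
End spectral_measure.

(** * First and second moments of measures on the line *)

Section moments.
Variable R : realType.
Implicit Type mu : {measure set R -> \bar R}.
Local Open Scope ereal_scope.

Lemma measurable_sqr_EFin : measurable_fun setT (fun t : R => (t ^+ 2)%:E).
Proof. by apply/measurable_EFinP; exact: measurable_funX. Qed.

Lemma sqr_integrable mu : mu setT < +oo -> \int[mu]_t (t ^+ 2)%:E < +oo ->
  mu.-integrable setT (fun t : R => t%:E).
Proof.
move=> mu_fin sq_fin.
have mg : measurable_fun setT (fun t : R => (1 + t ^+ 2)%:E).
  by apply/measurable_EFinP; apply: measurable_funD => //; exact: measurable_funX.
apply: (@le_integrable _ _ _ _ _ _ _ (fun t : R => (1 + t ^+ 2)%:E)) => //.
- by apply/measurable_EFinP.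
- move=> t _; rewrite /= lee_fin [leRHS]ger0_norm ?sqr1D_ge0//.
  have := sqr_ge0 (`|t| - 2^-1)%R; rewrite sqrrB real_normK ?num_real//.
  by rewrite -mulr_natl; set a := `|t|%R; nra.
apply/integrableP; split=> //.
under eq_integral => t _ do rewrite /= ger0_norm ?sqr1D_ge0// EFinD.
rewrite ge0_integralD//; last 2 first.
- by move=> t _; rewrite lee_fin sqr_ge0.
- exact: measurable_sqr_EFin.
rewrite lte_add_pinfty//.
by rewrite (integral_cst mu measurableT 1) mul1e.
Qed.

Lemma Rintegral_measure_sum mu mu1 mu2 :
  (forall B, measurable B -> mu B = mu1 B + mu2 B) ->
  mu1.-integrable setT (fun t : R => t%:E) -> mu2.-integrable setT (fun t : R => t%:E) ->
  (Rintegral mu setT id = Rintegral mu1 setT id + Rintegral mu2 setT id)%R.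
Proof.
move=> muE int1 int2; rewrite /Rintegral -fineD; last 2 first.
- exact: integrable_fin_num.
- exact: integrable_fin_num.
congr fine; rewrite -integral_measure_add//.
apply: eq_measure_integral => B mB _; rewrite muE//.
exact/esym/measure_addE.
Qed.

Lemma concentrated_moments mu (a b m : R) : mu setT = m%:E -> mu (~` `[a, b]%classic) = 0 ->
  \int[mu]_t (t ^+ 2)%:E < +oo /\
  (a * m <= Rintegral mu setT id <= b * m)%R.
Proof.
move=> mum mu0; set I := `[a, b]%classic.
have mI : measurable I by exact: measurable_itv.
have mCI : measurable (~` I) by exact: measurableC.
have muI : mu I = m%:E.
  by rewrite -mum -(setUv I) measureU//= ?mu0 ?adde0// setICr.
have sq : \int[mu]_t (t ^+ 2)%:E < +oo.
  (* Bounds t^2 on [a, b] whatever the signs of a and b. *)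
  pose M := (a ^+ 2 + b ^+ 2)%R.
  apply: (@le_lt_trans _ _ (\int[mu]_t (cst M%:E t))).
    apply: ae_ge0_le_integral => //.
    - by move=> t _; rewrite lee_fin sqr_ge0.
    - exact: measurable_sqr_EFin.
    - by move=> t _; rewrite lee_fin addr_ge0 ?sqr_ge0.
    - exists (~` I); split=> // t /= ht It; apply: ht => _.
      move: It; rewrite /I /= in_itv /= => /andP[at_ tb].
      rewrite lee_fin /M; have := sqr_ge0 a; have := sqr_ge0 b.
      by have [t0|t0] := leP 0%R (t : R); nra.
  by rewrite integral_cst// mum -EFinM ltry.
split=> //.
have int : mu.-integrable setT (fun t : R => t%:E) by apply: sqr_integrable; rewrite // mum ltry.
have intI : mu.-integrable I (fun t : R => t%:E) by apply: integrableS int.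
have intc (c : R) : mu.-integrable I (cst c%:E).
  apply/integrableP; split=> //; rewrite (_ : (fun _ => _) = cst `|c|%:E)//.
  by rewrite integral_cst// [mu _]muI -EFinM ltry.
have RI : Rintegral mu setT id = Rintegral mu I id.
  rewrite /Rintegral; congr fine.
  by rewrite (negligible_integral mCI)// setTD setCK.
rewrite RI -!lee_fin /Rintegral fineK; last exact: integrable_fin_num.
apply/andP; split; rewrite EFinM -muI -integral_cst//; apply: le_integral => // t;
  by rewrite inE /I /= in_itv /= lee_fin => /andP[].
Qed.

End moments.

(** * Values of a spectral measure on eigenvectors *)

Section spectral_measure_uniqueness.
Variables (R : realType) (H : hilbertType R).
Variables (A : regop H) (E : set R -> bop H).
Hypothesis AE : is_spectral_measure A E.
Implicit Types (x y : H) (S B : set R).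

Lemma self_adj_quad0 (D : bop H) : self_adj D -> (forall x, rdot (D x) x = 0) -> D = 0.
Proof.
move=> Dsa D0; apply: bopP => x; apply: rdot_ext => y; rewrite bop0E rdot0l.
have := D0 (x + y); rewrite bopDr !rdotDl !rdotDr !D0 (rdotC (D y)) -(self_adj_rdot Dsa).
by lra.
Qed.

Let Eproj S : measurable S -> orthogonal_projection (E S).
Proof. by have [[+ _ _] _] := AE; apply. Qed.

Lemma spectral_mu x : exists mu : {measure set R -> \bar R},
  [/\ forall S, measurable S -> mu S = (nrm (E S x) ^+ 2)%:E,
      domain A x <-> (\int[mu]_t (t ^+ 2)%:E < +oo)%E &
      forall y, graph A (x, y) -> rdot y x = Rintegral mu setT id].
Proof.
have [_ /(_ x)[mu [muE mudom muA]]] := AE; exists mu; split=> //.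
  by move=> S mS; rewrite -proj_rdot; [exact: muE|exact: Eproj].
by move=> y /muA; rewrite /rdot => ->.
Qed.

(** Both sides are self-adjoint, and additivity of the scalar measures says that their quadratic
    forms agree. *)
Lemma pvmU S S' : measurable S -> measurable S' -> S `&` S' = set0 ->
  E (S `|` S') = E S + E S'.
Proof.
move=> mS mS' SS'; have mU : measurable (S `|` S') by exact: measurableU.
apply/eqP; rewrite -subr_eq0; apply/eqP/self_adj_quad0.
  by apply: self_adjB; [|apply: self_adjD]; apply/proj_self_adj/Eproj.
move=> x; have [mu [muE _ _]] := spectral_mu x.
have : mu (S `|` S') = (mu S + mu S')%E by exact: measureU.
rewrite !muE// -EFinD => -[h].
rewrite bopBE bopDE rdotBl rdotDl !proj_rdot; [|exact: Eproj..].
by apply/eqP; rewrite subr_eq0 h.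
Qed.

(** For y = E(S) x, |y|^2 + |E(S') y|^2 is the squared norm of the projection of y by the union,
    hence at most |y|^2. *)
Lemma pvm_disjoint S S' : measurable S -> measurable S' -> S `&` S' = set0 ->
  E S' * E S = 0.
Proof.
move=> mS mS' SS'; apply: bopP => x; rewrite bopME bop0E; set y := E S x.
have yE : E S y = y by have [h _] := Eproj mS; exact: h.
have mU : measurable (S `|` S') by exact: measurableU.
have := proj_nrm_le y (Eproj mU); rewrite -(@ler_pXn2r _ 2) ?nnegrE ?nrm_ge0//.
rewrite -proj_rdot; last exact: Eproj.
rewrite pvmU// bopDE rdotDl !proj_rdot; [|exact: Eproj..].
rewrite yE gerDl => h; apply/eqP; rewrite -nrm_eq0 -sqrf_eq0.
by rewrite eq_le h sqr_ge0.
Qed.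

Lemma pvm_comm S B : measurable S -> measurable B -> E B * E S = E S * E B.
Proof.
have side C D : measurable C -> measurable D -> E C * E D = E (C `&` D).
  move=> mC mD; have mCD : measurable (C `&` D) by exact: measurableI.
  have mC' : measurable (C `\` D) by exact: measurableD.
  have mD' : measurable (D `\` C) by exact: measurableD.
  have EC : E C = E (C `&` D) + E (C `\` D).
    rewrite -pvmU//; last by rewrite setDE setIACA setICr setI0.
    by rewrite setDE -setIUr setUv setIT.
  have ED : E D = E (C `&` D) + E (D `\` C).
    rewrite -pvmU//; last by rewrite setDE (setIC C) setIACA setICr setI0.
    by rewrite setDE (setIC C) -setIUr setUv setIT.
  rewrite EC mulrDl (@pvm_disjoint D (C `\` D))//; last first.
    by rewrite setDE setICA setICr setI0.
  rewrite addr0 ED mulrDr (@pvm_disjoint (D `\` C) (C `&` D))//; last first.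
    by rewrite setDE -setIA (setIA _ C) setICl set0I setI0.
  by rewrite addr0 proj_mul//; exact: Eproj.
by move=> mS mB; rewrite !side// setIC.
Qed.

Lemma pvm_setT : E setT = 1.
Proof. by have [[_ + _] _] := AE => h; apply: bopP => x; rewrite h. Qed.

Hypothesis Asym : forall p q, graph A p -> graph A q -> dotp p.2 q.1 = dotp p.1 q.2.

(* For v = E([a, b]) x and w = x - v, additivity of the first moments gives
   Re <A v, w> = 0, hence l |v|^2 = <A v, v> lies in [a |v|^2, b |v|^2]. *)
Lemma pvm_eigen_itv (x : H) (l a b : R) : graph A (x, l%:C *: x) ->
  ~ (a <= l <= b) -> E `[a, b]%classic x = 0.
Proof.
move=> Ax lab; set I := `[a, b]%classic.
have mI : measurable I by exact: measurable_itv.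
have mCI : measurable (~` I) by exact: measurableC.
set v := E I x; pose w := x - v.
have [[_ Alin _] _ _] := regopP A.
have Evv : E I v = v by have [h _] := Eproj mI; exact: h.
(* E(B) commutes with E([a, b]), so E(B) v and E(B) w are orthogonal: the measure of x is the sum of
   those of v and w. *)
have Ew B : measurable B -> nrm (E B x) ^+ 2 = nrm (E B v) ^+ 2 + nrm (E B w) ^+ 2.
  move=> mB; rewrite -{1}(subrK v x) -/w addrC bopDr nrm_sqrD.
  have -> : rdot (E B v) (E B w) = 0.
    have EEv : E B (E B v) = E B v by have [h _] := Eproj mB; exact: h.
    rewrite -(self_adj_rdot (proj_self_adj (Eproj mB))) EEv.
    rewrite /v -bopME pvm_comm// bopME (self_adj_rdot (proj_self_adj (Eproj mI))).
    by rewrite /w bopBr -/v Evv subrr rdot0r.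
  by rewrite mulr0 addr0.
have [muv [muvE muvdom muvA]] := spectral_mu v.
have [muw [muwE muwdom muwA]] := spectral_mu w.
have [mux [muxE _ muxA]] := spectral_mu x.
have muvT : muv setT = (nrm v ^+ 2)%:E by rewrite muvE// pvm_setT bop1E.
have muv0 : muv (~` I) = 0%E.
  rewrite muvE// /v -bopME (@pvm_disjoint I (~` I))// ?bop0E ?nrm0 ?expr0n//.
  by rewrite setICr.
have [sqv /andP[av bv]] := concentrated_moments muvT muv0.
have [y Ay] : domain A v by exact/muvdom.
have Aw : graph A (w, l%:C *: x - y).
  have := Alin (- 1) _ _ Ay Ax; rewrite /w -[_ *: (_, _)]/(_ *: _, _ *: _) !scaleN1r.
  by rewrite addrC [X in graph A (_, X)]addrC.
have domw : domain A w by exists (l%:C *: x - y).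
have intv : muv.-integrable setT (fun t : R => t%:E).
  by apply: sqr_integrable => //; rewrite muvT ltry.
have intw : muw.-integrable setT (fun t : R => t%:E).
  by apply: sqr_integrable; [rewrite muwE// ltry|exact/muwdom].
have sumE : Rintegral mux setT id = Rintegral muv setT id + Rintegral muw setT id.
  apply: Rintegral_measure_sum => // B mB.
  by rewrite muxE// muvE// muwE// -EFinD Ew.
rewrite -(muxA _ Ax) -(muvA _ Ay) -(muwA _ Aw) in sumE.
have xE : x = v + w by rewrite /w addrC subrK.
have vw : rdot v w = 0.
  rewrite -{1}Evv (self_adj_rdot (proj_self_adj (Eproj mI))).
  by rewrite /w bopBr -/v Evv subrr rdot0r.
clearbody w.
have yw : rdot y w = 0.
  have sym : rdot (l%:C *: x - y) v = rdot w y by rewrite /rdot (Asym Aw Ay).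
  have : rdot (l%:C *: x) x = rdot y v + rdot y w + rdot (l%:C *: x - y) v + rdot (l%:C *: x - y) w.
    by rewrite {2}xE !rdotDr !rdotBl; ring.
  by rewrite sumE sym (rdotC w); lra.
have lv : l * nrm v ^+ 2 = rdot y v.
  have : rdot (l%:C *: x) v = rdot x y by rewrite /rdot (Asym Ax Ay).
  rewrite rdotZl {1 2}xE !rdotDl (rdotC w v) vw (rdotC w y) yw !addr0 rdot_nrm.
  by rewrite (rdotC v).
rewrite -(muvA _ Ay) -lv in av bv.
apply/eqP; rewrite -nrm_eq0 -sqrf_eq0; apply/negPn/negP => v0.
have v1 : 0 < nrm v ^+ 2 by rewrite lt_neqAle eq_sym v0 sqr_ge0.
by apply: lab; move: av bv; rewrite !ler_pM2r// => -> ->.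
Qed.

(** The complement of l is the union of the intervals [F n] and [G n], each null for x by
    [pvm_eigen_itv]. So E(S) x = 0 when S misses l; otherwise the complement of S misses l. *)
Lemma pvm_eigen (x : H) (l : R) S : graph A (x, l%:C *: x) -> measurable S ->
  E S x = (\1_S l : R)%:C *: x.
Proof.
move=> Ax mS; have [mu [muE _ _]] := spectral_mu x.
pose F n : set R := `[l + n.+1%:R^-1, l + n.+1%:R]%classic.
pose G n : set R := `[l - n.+1%:R, l - n.+1%:R^-1]%classic.
have F0 n : mu (F n) = 0%E.
  rewrite muE; last exact: measurable_itv.
  rewrite (pvm_eigen_itv Ax) ?nrm0 ?expr0n//; apply/negP; rewrite negb_and -!ltNge.
  by rewrite ltrDl invr_gt0 ltr0n.
have G0 n : mu (G n) = 0%E.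
  rewrite muE; last exact: measurable_itv.
  rewrite (pvm_eigen_itv Ax) ?nrm0 ?expr0n//; apply/negP; rewrite negb_and -!ltNge.
  by rewrite gtrBl invr_gt0 ltr0n orbT.
have null S' : measurable S' -> ~ S' l -> E S' x = 0.
  move=> mS' Sl.
  have cov : S' `<=` \bigcup_n (F n `|` G n).
    move=> t S't; have tl : t != l by apply: contra_notN Sl => /eqP <-.
    have d0 : 0 < `|t - l| by rewrite normr_gt0 subr_eq0.
    have [n [n1 n2]] : exists n, n.+1%:R^-1 <= `|t - l| /\ `|t - l| <= n.+1%:R.
      exists (Num.truncn `|t - l|%R + Num.truncn (`|t - l|^-1)%R)%N; split.
        rewrite -[leRHS]invrK lef_pV2 ?posrE ?invr_gt0//.
        have d1 : 0 < `|t - l|^-1 by rewrite invr_gt0.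
        have /andP[_ /ltW h] := truncn_itv (ltW d1).
        by apply: (le_trans h); rewrite ler_nat ltnS leq_addl.
      have /andP[_ /ltW h] := truncn_itv (ltW d0).
      by apply: (le_trans h); rewrite ler_nat ltnS leq_addr.
    exists n => //; have [tl0|tl0] := leP l t.
      left; rewrite /F /= in_itv /=; move: n1 n2; rewrite ger0_norm ?subr_ge0//.
      by set u := _^-1; set u' := _%:R => n1 n2; apply/andP; split; lra.
    right; rewrite /G /= in_itv /=; move: n1 n2; rewrite ltr0_norm ?subr_lt0//.
    by set u := _^-1; set u' := _%:R => n1 n2; apply/andP; split; lra.
  have : (mu S' <= 0)%E.
    apply: (le_trans (measure_sigma_subadditive _ _ mS' cov)).
      by move=> n; apply: measurableU; exact: measurable_itv.
    rewrite eseries0// => n _ _; apply/eqP; rewrite eq_le measure_ge0 andbT.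
    apply: (le_trans (measureU2 _ _ _)); [exact: measurable_itv..|].
    by rewrite [X in (X + _)%E]F0 [X in (_ + X)%E]G0 adde0.
  rewrite muE// lee_fin => h; apply/eqP; rewrite -nrm_eq0 -sqrf_eq0.
  by rewrite eq_le h sqr_ge0.
rewrite indicE; have [lS|lS] := boolP (l \in S).
  have /null h : ~ (~` S) l by apply; exact: set_mem.
  rewrite scale1r -[RHS]bop1E -pvm_setT -(setUv S) pvmU ?setICr//; last exact: measurableC.
  by rewrite bopDE h ?addr0//; exact: measurableC.
by rewrite scale0r null// => /mem_set; exact/negP.
Qed.

End spectral_measure_uniqueness.

(** [diag_spectral_measure] shows that [get] has a candidate, and [pvm_eigen] fixes the values of
    whichever measure it picks. *)
Lemma spectral_projectionP (R : realType) (H : hilbertType R) (A : regop H)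
    (e : nat -> H) (lam : nat -> R) (S : set R) : eigen_data A e lam ->
  measurable S -> is_diag e (\1_S \o lam) (spectral_projection S A).
Proof.
move=> [oe te _ AE] mS n.
have ex : is_spectral_measure A (diag_pvm lam oe te) by exact: diag_spectral_measure.
have hE := @getPex _ [set E | is_spectral_measure A E] (ex_intro _ _ ex).
apply: (pvm_eigen hE) => //; last by rewrite AE; exact: diag_graph_basis.
move=> p q; rewrite -{2}(_ : adjoint A = A) => [Ap Aq|]; last by rewrite AE diag_graph_adjoint.
exact: Aq.
Qed.

(** * Norm continuity of the absolute value; projections from spectral gaps *)
Section absolute_value.
Variables (R : realType) (H : hilbertType R).
Implicit Types (S T B C D : bop H).

Definition nonneg_op T := forall x, 0 <= rdot (T x) x.

Lemma nrm_bop_adherent T (eta : R) : 0 < eta ->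
  exists u : H, nrm u <= 1 /\ nrm T - eta < nrm (T u).
Proof.
move=> eta0; have [_ [u /= u1 <-] h] := sup_adherent eta0 (opnorm_has_sup T).
by exists u; rewrite nrm_le.
Qed.

Definition bopE := (@bopDE R H, @bopNE R H, @bopME R H, @bop1E R H, @bopZE R H,
  @bopDr R H, @bopNr R H, @bopZr R H).

Definition rdotlE := (@rdotDl R H, @rdotNl R H, @rdotZl R H).

Definition rdotrE := (@rdotDr R H, @rdotNr R H, @rdotZr R H).

(* With D = S - T and u a unit vector almost maximizing |D u|, test
   2 (S^2 - T^2) = (S + T) D + D (S + T) against the pair (u, D u). *)
Lemma nrm_sqrt_dist S T : self_adj S -> self_adj T -> nonneg_op S -> nonneg_op T ->
  nrm (S - T) ^+ 2 <= nrm (S * S - T * T).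
Proof.
move=> Ssa Tsa S0 T0; set D := S - T; set Z := S * S - T * T; pose N := S + T.
set c := nrm D; set z := nrm Z; rewrite leNgt; apply/negP => zc.
have z0 : 0 <= z by exact: nrm_ge0.
have c0 : 0 < c.
  by rewrite lt_neqAle eq_sym nrm_ge0 andbT; apply: contraTneq zc => ->; rewrite expr0n /= -leNgt.
have Dsa : self_adj D by exact: self_adjB.
have ND x : rdot (D x) x <= rdot (N x) x.
  by rewrite bopBE bopDE rdotBl rdotDl lerD2l; have := T0 x; lra.
have NnD x : - rdot (D x) x <= rdot (N x) x.
  by rewrite bopBE bopDE rdotBl rdotDl; have := S0 x; lra.
have ZE x : 2 * rdot (Z x) (D x) = rdot (N (D x)) (D x) + rdot (N x) (D (D x)).
  rewrite -(self_adj_rdot Dsa (N x)); set y := D x.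
  by rewrite /y /Z /N /D !bopE; set w := S x - T x; rewrite !rdotlE; ring.
clearbody D N Z.
(* Add D <= N at D u + c u and - D <= N at D u - c u; the mixed terms in N cancel. *)
have key u : 2 * c * nrm (D u) ^+ 2 <= rdot (N (D u)) (D u) + c ^+ 2 * rdot (N u) u.
  have := ND (D u + c%:C *: u); have := NnD (D u - c%:C *: u).
  rewrite !(bopDr, bopNr, bopZr) !rdotlE !rdotrE (self_adj_rdot Dsa (D u) u).
  rewrite !rdot_nrm; lra.
pose M := nrm N.
have main u : nrm u <= 1 ->
    2 * c * (nrm (D u) ^+ 2 - z) <= M * nrm (D (D u) - (c ^+ 2)%:C *: u).
  move=> u1; have := ZE u; have := key u.
  have -> : rdot (N u) (D (D u)) = c ^+ 2 * rdot (N u) u + rdot (N u) (D (D u) - (c ^+ 2)%:C *: u).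
    by rewrite rdotBr rdotZr addrC subrK.
  have := rdot_norm_le (N u) (D (D u) - (c ^+ 2)%:C *: u).
  rewrite ler_norml => /andP[h _].
  have NuM : nrm (N u) <= M by apply: (le_trans (nrm_bop _ _)); rewrite ler_piMr ?nrm_ge0.
  have h2 : nrm (N u) * nrm (D (D u) - (c ^+ 2)%:C *: u) <= M * nrm (D (D u) - (c ^+ 2)%:C *: u).
    by rewrite ler_wpM2r ?nrm_ge0.
  have h3 : rdot (Z u) (D u) <= z * c.
    apply: (le_trans (rdot_le _ _)); apply: ler_pM; rewrite ?nrm_ge0//.
      by apply: (le_trans (nrm_bop _ _)); rewrite ler_piMr ?nrm_ge0.
    by apply: (le_trans (nrm_bop _ _)); rewrite ler_piMr ?nrm_ge0.
  move: h h2 h3; set q := nrm (D (D u) - _); set n2 := nrm (D u) ^+ 2; lra.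
have resid u : nrm u <= 1 ->
    nrm (D (D u) - (c ^+ 2)%:C *: u) ^+ 2 <= c ^+ 2 * (c ^+ 2 - nrm (D u) ^+ 2).
  move=> u1; rewrite nrm_sqrB rdotZr (self_adj_rdot Dsa (D u) u) rdot_nrm nrmZr ger0_norm ?sqr_ge0//.
  have h1 : nrm (D (D u)) ^+ 2 <= c ^+ 2 * nrm (D u) ^+ 2.
    by rewrite -exprMn ler_pXn2r ?nnegrE ?mulr_ge0 ?nrm_ge0// nrm_bop.
  have h2 : nrm u ^+ 2 <= 1 by rewrite expr_le1// nrm_ge0.
  have h3 : (c ^+ 2 * nrm u) ^+ 2 <= c ^+ 2 * c ^+ 2.
    by rewrite exprMn (expr2 (c ^+ 2)) ler_piMr// mulr_ge0// sqr_ge0.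
  by move: h1 h3; set d1 := nrm (D (D u)) ^+ 2; set d2 := nrm (D u) ^+ 2; nra.
set g := c ^+ 2 - z in zc *; have g0 : 0 < g by rewrite subr_gt0.
have M0 : 0 <= M by exact: nrm_ge0.
(* The first bound gives |D u|^2 - z >= g / 2, hence c g <= M q; with q^2 <= c^2 del this yields g^2
   <= M^2 del, which the second bound contradicts. *)
pose del := Num.min (g / 2) (g ^+ 2 / (2 * (M ^+ 2 + 1))).
have M1 : 0 < 2 * (M ^+ 2 + 1) by rewrite mulr_gt0// ltr_wpDl// sqr_ge0.
have del0 : 0 < del by rewrite lt_min !divr_gt0// exprn_gt0.
have [u [u1 uD]] := nrm_bop_adherent D (divr_gt0 del0 (mulr_gt0 (ltr0n R 2) c0)).
have Du : nrm (D u) <= c by apply: (le_trans (nrm_bop _ _)); rewrite ler_piMr ?nrm_ge0.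
have Dud : c ^+ 2 - nrm (D u) ^+ 2 <= del.
  rewrite -/c ltrBlDl -ltrBlDr ltr_pdivlMr in uD; last by rewrite mulr_gt0.
  have := nrm_ge0 (D u); nra.
have d1 : del <= g / 2 by rewrite ge_min lexx.
have d2 : del * (2 * (M ^+ 2 + 1)) <= g ^+ 2.
  by rewrite -ler_pdivlMr// ge_min lexx orbT.
have h1 := main u u1; have h2 := resid u u1.
set q := nrm (D (D u) - _) in h1 h2.
have q0 : 0 <= q by exact: nrm_ge0.
have h3 : c * g <= M * q.
  apply: le_trans h1; rewrite -mulrA mulrCA ler_pM2l//.
  by move: Dud d1; rewrite /g; lra.
have h4 : (c * g) ^+ 2 <= M ^+ 2 * (c ^+ 2 * del).
  apply: (@le_trans _ _ ((M * q) ^+ 2)).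
    by rewrite ler_pXn2r// ?nnegrE mulr_ge0// ltW.
  rewrite exprMn ler_wpM2l ?sqr_ge0//; apply: (le_trans h2).
  by rewrite ler_wpM2l ?sqr_ge0.
have c20 : 0 < c ^+ 2 by rewrite exprn_gt0.
have : g ^+ 2 <= M ^+ 2 * del by rewrite -(ler_pM2l c20) -exprMn mulrCA.
have : 0 < g ^+ 2 by rewrite exprn_gt0.
by nra.
Qed.

Definition is_absop B C := [/\ self_adj C, nonneg_op C & C * C = B * B].

(** [nrm_sqrt_dist] makes the nonnegative root of B^2 unique, so the value does not depend on an
    eigenbasis and can be compared for operators diagonal in unrelated bases. *)
Definition absop B : bop H := get [set C | is_absop B C].

Lemma absop_uniq B C D : is_absop B C -> is_absop B D -> C = D.
Proof.
move=> [Csa C0 CC] [Dsa D0 DD]; apply/eqP; rewrite -subr_eq0 -nrm_eq0 -sqrf_eq0.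
have := nrm_sqrt_dist Csa Dsa C0 D0; rewrite CC DD subrr nrm0 => h.
by rewrite eq_le h sqr_ge0.
Qed.

Definition diagonalizable B := exists (e : nat -> H) (phi : nat -> R),
  [/\ orthonormal_seq e, total_seq e & is_diag e phi B].

Lemma is_diag_nonneg (e : nat -> H) (phi : nat -> R) T :
  orthonormal_seq e -> total_seq e -> is_diag e phi T -> (forall n, 0 <= phi n) -> nonneg_op T.
Proof.
move=> oe te hT p0 x; have := is_diag_pos oe te hT p0 x.
by rewrite /rdot lecE => /andP[_].
Qed.

Lemma absop_diag (e : nat -> H) (phi : nat -> R) B :
  orthonormal_seq e -> total_seq e -> is_diag e phi B ->
  is_absop B (absop B) /\ is_diag e (fun n => `|phi n|) (absop B).
Proof.
move=> oe te hB.
have [|C hC] := @is_diag_ex _ _ e oe te (fun n => `|phi n|) (nrm B).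
  by move=> n; rewrite normr_id (is_diag_bound oe _ hB).
have abC : is_absop B C.
  split; [exact: is_diag_self_adj hC|by apply: is_diag_nonneg hC _ => //|].
  apply: (is_diag_uniq oe te (is_diagM hC hC)); apply: is_diag_ext (is_diagM hB hB) => n /=.
  by rewrite -!expr2 real_normK// num_real.
have ab : is_absop B (absop B) := @getPex _ [set C | is_absop B C] (ex_intro _ C abC).
by split=> //; rewrite (absop_uniq ab abC).
Qed.

Lemma absop_cvg (I : Type) (F : set_system I) {FF : Filter F} (f : I -> bop H) B :
  (forall i, diagonalizable (f i)) -> diagonalizable B ->
  f @ F --> B -> (fun i => absop (f i)) @ F --> absop B.
Proof.
move=> fd [e [phi [oe te hB]]] fB.
have [[Bsa B0 BB] _] := absop_diag oe te hB.
have ffB : (fun i => f i * f i) @ F --> B * B by exact: cvg_bopM.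
apply/cvg_nrmP => eps eps0; have eps2 : 0 < eps ^+ 2 by rewrite exprn_gt0.
move/cvg_nrmP : ffB => /(_ _ eps2); apply: filterS => i h.
have [e' [phi' [oe' te' hi]]] := fd i.
have [[Csa C0 CC] _] := absop_diag oe' te' hi.
rewrite -(@ltr_pXn2r _ 2)// ?nnegrE ?nrm_ge0 ?(ltW eps0)//.
by apply: le_lt_trans h; rewrite -BB -CC; exact: nrm_sqrt_dist.
Qed.

End absolute_value.

Section spectral_gap_projection.
Variables (R : realType) (H : hilbertType R).
Implicit Types (T P D : bop H).

(* This is 3 T^2 - 2 T^3: its iteration squares the defect T - T^2 (up to a
   factor), so it converges to a projection with the same compact perturbation
   class, the same kernel vectors and the same fixed vectors as T. *)
Definition newton T := T + (T - T * T) * (T + T - 1).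

(** For f = t^2 (3 - 2 t), f (1 - f) = u^2 (3 - 2 t) (1 + 2 t), and the last two factors multiply to
    3 + 4 u. *)
Lemma newton_defect T (u := T - T * T) :
  newton T - newton T * newton T = u * u * (1 + 1 + 1 + (u + u + u + u)).
Proof.
apply: bopP => x; apply: rdot_ext => y; rewrite /newton /u !bopE !rdotlE; ring.
Qed.

(** With these constants all iterates have norm at most 9/8 + 10/16 < 2. Hence |2 T - 1| <= 5, a
    step is at most 5 times the defect, and the new defect is at most 4 |u|^2 <= |u| / 2. The steps
    add up to 10 times the initial defect. *)
Definition near_proj T := nrm T <= 9 / 8 /\ nrm (T - T * T) <= 16^-1.

Lemma newton_iter_bound T k : near_proj T ->
  let a := nrm (T - T * T) in let Tk := iter k newton T in
  nrm (Tk - Tk * Tk) <= a / 2 ^+ k /\ nrm Tk <= 9 / 8 + 10 * a * (1 - 2^-1 ^+ k).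
Proof.
move=> [T98 Ta] a; elim: k => [|k [IH1 IH2]].
  by rewrite /= expr0 divr1 lexx expr0 subrr mulr0 addr0.
rewrite /= in IH1 IH2 *; set Tk := iter k newton T in IH1 IH2 *.
have a0 : 0 <= a by exact: nrm_ge0.
have p0 : 0 < 2^-1 ^+ k :> R by rewrite exprn_gt0.
have p1 : 2^-1 ^+ k <= 1 :> R by rewrite exprn_ile1// invf_le1// ler1n.
have E2 : a / 2 ^+ k.+1 = a / 2 ^+ k / 2 by rewrite exprSr invfM mulrA.
rewrite E2 exprSr; rewrite -!exprVn in IH1 *.
set p := 2^-1 ^+ k in p0 p1 IH1 IH2 *; set u := Tk - Tk * Tk in IH1 *.
have u0 : 0 <= nrm u by exact: nrm_ge0.
have Tk2 : nrm Tk <= 2 by apply: (le_trans IH2); move: Ta; rewrite -/a; nra.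
have ap : a * p <= 16^-1 by move: Ta; rewrite -/a; nra.
split.
  rewrite newton_defect -/u.
  have h1 : nrm (u * u) <= nrm u * nrm u by exact: nrm_bopM.
  have h2 : nrm ((1 : bop H) + 1 + 1 + (u + u + u + u)) <= 4.
    have := nrm_bop1 H; set o := nrm (1 : bop H) => o1.
    have := nrmD ((1 : bop H) + 1 + 1) (u + u + u + u); have := nrmD ((1 : bop H) + 1) 1.
    have := nrmD (1 : bop H) 1; have := nrmD (u + u + u) u; have := nrmD (u + u) u.
    have := nrmD u u.
    by rewrite -/o; lra.
  apply: (le_trans (nrm_bopM_le h1 h2)); nra.
apply: (le_trans (nrmD _ _)).
have h : nrm (u * (Tk + Tk - 1)) <= nrm u * 5.
  apply: (nrm_bopM_le (lexx _)); apply: (le_trans (nrmB _ _)).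
  have := nrmD Tk Tk; have := nrm_bop1 H; lra.
by rewrite -/u; lra.
Qed.

Lemma newton_step_bound T k : near_proj T ->
  nrm (iter k.+1 newton T - iter k newton T) <= 5 * nrm (T - T * T) / 2 ^+ k.
Proof.
move=> nT; have [h1 _] := newton_iter_bound k nT.
have [_ h2] := newton_iter_bound k nT; rewrite /= in h1 h2 *.
set Tk := iter k newton T in h1 h2 *; rewrite {1}/newton addrAC subrr add0r.
have [_ Ta] := nT; have p0 : 0 < 2^-1 ^+ k :> R by rewrite exprn_gt0.
have p1 : 2^-1 ^+ k <= 1 :> R by rewrite exprn_ile1// invf_le1// ler1n.
have a0 : 0 <= nrm (T - T * T) by exact: nrm_ge0.
have Tk2 : nrm Tk <= 2 by apply: (le_trans h2); nra.
have h3 : nrm (Tk + Tk - 1) <= 5.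
  by apply: (le_trans (nrmB _ _)); have := nrmD Tk Tk; have := nrm_bop1 H; lra.
by apply: (le_trans (nrm_bopM_le h1 h3)); rewrite mulrC mulrA.
Qed.

Lemma newton_dist_bound T k m : near_proj T ->
  nrm (iter (m + k) newton T - iter k newton T) <=
    10 * nrm (T - T * T) * (2^-1 ^+ k - 2^-1 ^+ (m + k)).
Proof.
move=> nT; elim: m => [|m IH]; first by rewrite add0n !subrr nrm0 mulr0.
apply: (le_trans (nrm_dist _ (iter (m + k) newton T) _)).
rewrite addSn; have := newton_step_bound (m + k) nT.
rewrite -exprVn [in X in _ -> X]exprSr; move: IH; set a := nrm (T - T * T).
by set p := _ ^+ (m + k); set q := _ ^+ k; lra.
Qed.

(** The limit is taken pointwise; the rate r makes it bounded and turns pointwise into norm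
    convergence. *)
Lemma bop_complete (T : nat -> bop H) (r : nat -> R) : r @ \oo --> 0 ->
  (forall k m, nrm (T (m + k)%N - T k) <= r k) ->
  exists L, forall k, nrm (L - T k) <= r k.
Proof.
move=> r0 Tr.
have Tx x : cvgn (fun k => T k x).
  apply: nrm_cauchy_cvg => eps eps0.
  have x1 : 0 < 2 * (nrm x + 1) by rewrite mulr_gt0// ltr_wpDl ?nrm_ge0.
  move/cvgr0Pnorm_lt : r0 => /(_ _ (divr_gt0 eps0 x1))[N _ /(_ N (leqnn N)) /= rN].
  have half m : (N <= m)%N -> nrm (T m x - T N x) < eps / 2.
    move=> Nm; rewrite -bopBE; apply: (le_lt_trans (nrm_bop _ _)).
    have := Tr N (m - N)%N; rewrite subnK// => h.
    have : nrm (T m - T N) < eps / (2 * (nrm x + 1)).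
      by apply: (le_lt_trans h); apply: le_lt_trans rN; exact: ler_norm.
    rewrite ltr_pdivlMr// ltr_pdivlMr//.
    by have := nrm_ge0 x; have := nrm_ge0 (T m - T N); nra.
  exists N => m n Nm Nn; apply: (le_lt_trans (nrm_dist _ (T N x) _)).
  by rewrite [ltRHS]splitr ltrD ?half// nrmBC half.
pose f x := lim ((fun k => T k x) @ \oo).
have fE x : (fun k => T k x) @ \oo --> f x by exact: Tx.
have fl : linear f.
  move=> a x y; apply: (@cvg_lim _ (@norm_hausdorff _ _)).
  rewrite (_ : (fun k => _) = (fun k => a *: T k x + T k y)); last first.
    by apply/funext => k; rewrite linearP.
  by apply: cvgD; [apply: cvgZl_tmp; exact: fE|exact: fE].
have fr k x : nrm (f x - T k x) <= r k * nrm x.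
  have h : (fun m => nrm (T (m + k)%N x - T k x)) @ \oo --> nrm (f x - T k x).
    apply: nrm_cvg; apply: cvgB; last exact: cvg_cst.
    by rewrite (@cvg_shiftn k _ (fun m => T m x)); exact: fE.
  apply: (cvgr_to_le h); apply: nearW => m; rewrite -bopBE.
  by apply: (le_trans (nrm_bop _ _)); rewrite ler_wpM2r ?nrm_ge0.
have fb x : nrm (f x) <= (r 0%N + nrm (T 0%N)) * nrm x.
  rewrite -(subrK (T 0%N x) (f x)) mulrDl; apply: (le_trans (nrmD _ _)).
  by apply: lerD; [exact: fr|exact: nrm_bop].
have [L LE] := bop_of fl fb; exists L => k.
have rk0 : 0 <= r k by apply: le_trans (Tr k 0%N); exact: nrm_ge0.
by apply: nrm_bop_le => // x; rewrite bopBE LE.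
Qed.

(** The limit of the Newton iterates, specified with its rate. The value is meaningful when T
    satisfies [near_proj]. *)
Definition gap_proj T : bop H :=
  get [set L | forall k, nrm (L - iter k newton T) <= 10 * nrm (T - T * T) * 2^-1 ^+ k].

Lemma geometric_cvg0 (a : R) : (fun k => a * 2^-1 ^+ k) @ \oo --> (0 : R).
Proof.
rewrite -(mulr0 a); apply: cvgMr.
by apply: cvg_expr; rewrite ger0_norm// invf_lt1// ltr1n.
Qed.

Lemma gap_proj_dist T k : near_proj T ->
  nrm (gap_proj T - iter k newton T) <= 10 * nrm (T - T * T) * 2^-1 ^+ k.
Proof.
move=> nT; set a := 10 * nrm (T - T * T).
have [|L LP] := @bop_complete (fun k => iter k newton T) (fun k => a * 2^-1 ^+ k) (geometric_cvg0 a).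
  move=> n m; apply: (le_trans (newton_dist_bound n m nT)).
  by rewrite ler_wpM2l// ?mulr_ge0 ?nrm_ge0// gerBl exprn_ge0.
exact: (@getPex _ [set L | forall k, nrm (L - iter k newton T) <= a * 2^-1 ^+ k]
  (ex_intro _ L LP)).
Qed.

Lemma gap_proj_cvg_iter T : near_proj T ->
  (fun k => iter k newton T) @ \oo --> gap_proj T.
Proof.
move=> nT; apply: (@cvg_nrm_le _ _ _ _ _ _ _ (fun k => 10 * nrm (T - T * T) * 2^-1 ^+ k)).
  by move=> k; rewrite nrmBC gap_proj_dist.
exact: geometric_cvg0.
Qed.

Lemma gap_proj_near T : near_proj T -> nrm (gap_proj T - T) <= 10 * nrm (T - T * T).
Proof. by move=> /(gap_proj_dist 0); rewrite expr0 mulr1. Qed.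

Lemma gap_proj_idem T : near_proj T -> gap_proj T * gap_proj T = gap_proj T.
Proof.
move=> nT; have hT := gap_proj_cvg_iter nT; set L := gap_proj T in hT *.
have dl : (fun k => iter k newton T - iter k newton T * iter k newton T) @ \oo --> L - L * L.
  by apply: cvgB => //; exact: cvg_bopM.
have d0 : (fun k => iter k newton T - iter k newton T * iter k newton T) @ \oo --> (0 : bop H).
  apply: (@cvg_nrm_le _ _ _ _ _ _ _ (fun k => nrm (T - T * T) * 2^-1 ^+ k)).
    by move=> k; rewrite subr0 exprVn; have [] := newton_iter_bound k nT.
  exact: geometric_cvg0.
apply/esym/eqP; rewrite -subr_eq0 -(cvg_lim (@norm_hausdorff _ _) dl).
by rewrite (cvg_lim (@norm_hausdorff _ _) d0).
Qed.

Lemma newton_self_adj T : self_adj T -> self_adj (newton T).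
Proof.
move=> Tsa; apply: self_adjD => //; apply: self_adjM.
- by apply: self_adjB => //; exact: self_adj_sqr.
- by apply: self_adjB; [exact: self_adjD|exact: self_adj1].
- by apply: bopP => x; apply: rdot_ext => y; rewrite !bopE !rdotlE; ring.
Qed.

Lemma newton_iter_ind (P : bop H -> Prop) (T : bop H) k :
  P T -> (forall S, P S -> P (newton S)) -> P (iter k newton T).
Proof. by move=> PT PS; elim: k => //= k; exact: PS. Qed.

Lemma bop_cvg_apply (T_ : nat -> bop H) (L : bop H) (x : H) :
  T_ @ \oo --> L -> (fun k => T_ k x) @ \oo --> L x.
Proof.
move=> TL; apply: (@cvg_nrm_le _ _ _ _ _ _ _ (fun k => nrm (T_ k - L) * nrm x)).
  by move=> k; rewrite -bopBE nrm_bop.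
rewrite -(mul0r (nrm x)); apply: cvgMl.
rewrite -(@nrm0 _ (bop H)) -(subrr L); apply: nrm_cvg; apply: cvgB => //; exact: cvg_cst.
Qed.

Lemma gap_proj_self_adj T : near_proj T -> self_adj T -> self_adj (gap_proj T).
Proof.
move=> nT Tsa; have hT := gap_proj_cvg_iter nT.
have Tk k : self_adj (iter k newton T) by apply: newton_iter_ind => // S; exact: newton_self_adj.
have limT x y : (fun k => rdot (iter k newton T x) y) @ \oo --> rdot (gap_proj T x) y.
  by apply: cvg_rdotl; exact: bop_cvg_apply.
apply: self_adjP => x y; rewrite [RHS]rdotC.
have E : (fun k => rdot (iter k newton T x) y) = (fun k => rdot (iter k newton T y) x).
  by apply/funext => k; rewrite (self_adj_rdot (Tk k)) rdotC.
rewrite -(cvg_lim (@Rhausdorff R) (limT x y)) -(cvg_lim (@Rhausdorff R) (limT y x)).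
by rewrite E.
Qed.

Lemma gap_proj_proj T : near_proj T -> self_adj T -> orthogonal_projection (gap_proj T).
Proof.
by move=> nT Tsa; apply: projP; [exact: gap_proj_self_adj|exact: gap_proj_idem].
Qed.

Lemma gap_proj_fix T x : near_proj T -> T x = x -> gap_proj T x = x.
Proof.
move=> nT Tx; have Tk k : iter k newton T x = x.
  by apply: (newton_iter_ind (P := fun S => S x = x)) => // S Sx; rewrite /newton !bopE !Sx subrr addr0.
have := bop_cvg_apply (x := x) (gap_proj_cvg_iter nT).
rewrite (_ : (fun k => _) = (fun=> x)); last exact/funext.
move=> h; rewrite -[LHS](cvg_lim (@norm_hausdorff _ _) h).
by apply: (cvg_lim (@norm_hausdorff _ _)); exact: cvg_cst.
Qed.

Lemma gap_proj_ker T x : near_proj T -> T x = 0 -> gap_proj T x = 0.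
Proof.
move=> nT Tx; have Tk k : iter k newton T x = 0.
  apply: (newton_iter_ind (P := fun S => S x = 0)) => // S Sx.
  by rewrite /newton !bopE !Sx !(bop0r, addr0, add0r, bopNr, oppr0, Sx, subrr).
have := bop_cvg_apply (x := x) (gap_proj_cvg_iter nT).
rewrite (_ : (fun k => _) = (fun=> 0)); last exact/funext.
move=> h; rewrite -[LHS](cvg_lim (@norm_hausdorff _ _) h).
by apply: (cvg_lim (@norm_hausdorff _ _)); exact: cvg_cst.
Qed.

Lemma gap_proj_id P : orthogonal_projection P -> gap_proj P = P.
Proof.
move=> hP; have PP := proj_mul hP.
have nP : near_proj P.
  by split; [apply: (le_trans (proj_nrm hP)); lra|rewrite PP subrr nrm0 invr_ge0].
have := gap_proj_near nP; rewrite PP subrr nrm0 mulr0 => h.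
by apply/eqP; rewrite -subr_eq0 -nrm_eq0 eq_le h nrm_ge0.
Qed.

(** Every Newton step adds a multiple of the defect, which stays compact, and compact operators are
    closed in norm. *)
Lemma gap_proj_compact T : near_proj T -> compact_op (T - T * T) ->
  compact_op (gap_proj T - T).
Proof.
move=> nT cT; have Tk k : compact_op (iter k newton T - iter k newton T * iter k newton T) /\
    compact_op (iter k newton T - T).
  elim: k => [|k [IH1 IH2]]; first by rewrite /= subrr; split=> //; exact: compact_op0.
  rewrite /= newton_defect; split; first by apply: compact_opMr; exact: compact_opMl.
  by rewrite {1}/newton addrAC; apply: compact_opD => //; exact: compact_opMr.
apply: compact_op_lim => eps eps0.
have /cvg_nrmP/(_ _ eps0)[k _ /(_ k (leqnn k)) /= h] := gap_proj_cvg_iter nT.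
exists (iter k newton T - T); first by have [] := Tk k.
by rewrite opprB addrA subrK ltW.
Qed.

Lemma newton_cvg (I : Type) (F : set_system I) {FF : Filter F} (f : I -> bop H) T :
  f @ F --> T -> (fun i => newton (f i)) @ F --> newton T.
Proof.
move=> fT; apply: cvgD => //; apply: cvg_bopM; first by apply: cvgB => //; exact: cvg_bopM.
by apply: cvgB; [exact: cvgD|exact: cvg_cst].
Qed.

(** The Newton iterates converge uniformly on operators satisfying [near_proj], so the limit
    inherits their continuity. *)
Lemma gap_proj_cvg (I : Type) (F : set_system I) {FF : Filter F} (f : I -> bop H) T :
  (forall i, near_proj (f i)) -> near_proj T -> f @ F --> T ->
  (fun i => gap_proj (f i)) @ F --> gap_proj T.
Proof.
move=> nf nT fT; apply/cvg_nrmP => eps eps0.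
have eps3 : 0 < eps / 3 by rewrite divr_gt0.
have /cvgr0Pnorm_lt/(_ _ eps3)[k _ /(_ k (leqnn k)) /= hk] := geometric_cvg0 1.
have bnd S : near_proj S -> nrm (gap_proj S - iter k newton S) < eps / 3.
  move=> nS; apply: (le_lt_trans (gap_proj_dist k nS)).
  rewrite mul1r in hk; rewrite ger0_norm ?exprn_ge0// in hk.
  apply: le_lt_trans hk; rewrite -[leRHS]mul1r ler_wpM2r ?exprn_ge0//.
  by have [_] := nS; lra.
have kT : (fun i => iter k newton (f i)) @ F --> iter k newton T.
  by elim: k {hk bnd} => //= k IH; exact: newton_cvg.
move/cvg_nrmP : kT => /(_ _ eps3); apply: filterS => i hi.
rewrite (_ : eps = eps / 3 + (eps / 3 + eps / 3)); last by field.
apply: (le_lt_trans (nrm_dist _ (iter k newton T) _)); apply: ltrD; first exact: bnd.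
apply: (le_lt_trans (nrm_dist _ (iter k newton (f i)) _)); apply: ltrD => //.
by rewrite nrmBC; exact: bnd.
Qed.

Lemma proj_perturb P D : P * P = P ->
  P + D - (P + D) * (P + D) = D - (P * D + D * P + D * D).
Proof.
move=> PP; rewrite mulrDl !mulrDr PP; apply: bopP => x; apply: rdot_ext => y.
by rewrite !bopE !rdotlE; ring.
Qed.

(** The defect D - (P D + D P + D^2) is at most 4 |D|; 1/64 keeps it below the 1/16 of
    [near_proj]. *)
Lemma near_projD P D : orthogonal_projection P -> nrm D <= 64^-1 ->
  near_proj (P + D) /\ nrm (P + D - (P + D) * (P + D)) <= 4 * nrm D.
Proof.
move=> hP D64; have PP := proj_mul hP; have P1 := proj_nrm hP.
have D0 := nrm_ge0 D.
have h : nrm (P + D - (P + D) * (P + D)) <= 4 * nrm D.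
  rewrite proj_perturb//.
  have := nrm_bopM_le P1 (lexx (nrm D)); have := nrm_bopM_le (lexx (nrm D)) P1.
  have := nrm_bopM D D; have := nrmB D (P * D + D * P + D * D).
  have := nrmD (P * D + D * P) (D * D); have := nrmD (P * D) (D * P); nra.
split=> //; split; last by apply: (le_trans h); lra.
by apply: (le_trans (nrmD _ _)); lra.
Qed.

(** 41 = 10 * 4 + 1: ten times the defect of P + D, plus the distance from P + D to P. *)
Lemma gap_proj_dist_proj P D : orthogonal_projection P -> nrm D <= 64^-1 ->
  nrm (gap_proj (P + D) - P) <= 41 * nrm D.
Proof.
move=> hP D64; have [nT h] := near_projD hP D64.
apply: (le_trans (nrm_dist _ (P + D) _)).
rewrite (_ : P + D - P = D); last by rewrite addrAC subrr add0r.
by have := gap_proj_near nT; lra.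
Qed.

End spectral_gap_projection.

(** * Spectral sections *)
Section continuity_helpers.
Variables (R : realType) (H : hilbertType R).

Lemma continuous_projectionsP (X : topologicalType) (P : X -> projections H) :
  continuous P <-> continuous (fun x => val (P x) : bop H).
Proof.
split=> [cP x|cP].
  by apply: (@continuous_comp _ _ _ P (fun p => val p : bop H)); [exact: cP|exact: initial_continuous].
exact: continuous_comp_initial.
Qed.

Lemma continuous_RKsaP (X : topologicalType) (A : X -> RKsa H) :
  continuous A <-> continuous (fun x => bounded_transform (val (A x))).
Proof.
split=> [cA x|cA].
  apply: (@continuous_comp _ (regop H : topologicalType) _ (fun x => val (A x)) (@bounded_transform R H)).
    by apply: (@continuous_comp _ _ _ A (fun p => val p : regop H)); [exact: cA|exact: initial_continuous].
  exact: initial_continuous.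
apply: continuous_comp_initial; apply: continuous_comp_initial; exact: cA.
Qed.

End continuity_helpers.

(** * Continuous choice of a positive parameter *)

Section slack.
Variables (R : realType) (X : topologicalType) (d : X -> X -> R) (p : X -> R -> Prop).
Hypotheses (d0 : forall x, d x x = 0) (dC : forall x y, d x y = d y x).
Hypothesis dD : forall x y z, d x z <= d x y + d y z.
Hypothesis dcont : forall x (e : R), 0 < e -> \forall y \near x, d x y < e.
Hypothesis p_anti : forall x (e e' : R), p x e -> 0 < e' -> e' <= e -> p x e'.
Hypothesis p_loc : forall x, exists2 e : R, 0 < e & forall y, d x y < e -> p y e.

(* the supremum of the radii that work on a whole ball is 1-Lipschitz *)
Lemma continuous_slack : exists c : X -> R,
  [/\ continuous c, forall x, 0 < c x, forall x, c x <= 1 & forall x, p x (c x)].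
Proof.
pose S x := [set e : R | [/\ 0 < e, e <= 1 & forall y, d x y < e -> p y e]].
have dge0 x y : 0 <= d x y.
  by have := dD x y x; rewrite d0 (dC y x); lra.
have S0 x : S x !=set0.
  have [e e0 eP] := p_loc x; exists (Num.min e 1); split.
  - by rewrite lt_min e0 ltr01.
  - by rewrite ge_min lexx orbT.
  - move=> y; rewrite lt_min => /andP[/eP pe _]; apply: p_anti pe _ _.
      by rewrite lt_min e0 ltr01.
    by rewrite ge_min lexx.
have supS x : has_sup (S x) by split=> //; exists 1 => e [].
pose s x := sup (S x).
have s0 x : 0 < s x.
  have [e Se] := S0 x; apply: (@lt_le_trans _ _ e); first by case: Se.
  by apply: sup_ubound => //; exact: (supS x).2.
have slip x y : s x <= s y + d x y.
  apply: ge_sup; first exact: S0.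
  move=> e [e0 e1 eP]; rewrite -lerBlDr; have [le0|gt0] := leP (e - d x y) 0.
    by apply: (le_trans le0); exact: ltW.
  apply: sup_ubound; first exact: (supS y).2.
  split=> //; first by have := dge0 x y; lra.
  move=> z yz; apply: (@p_anti _ e) => //; last by have := dge0 x y; lra.
  by apply: eP; have := dD x y z; lra.
(* The supremum itself may fail to be admissible; its half lies below an admissible radius. *)
exists (fun x => s x / 2); split=> [x|x|x|x].
- apply/cvgrPdist_lt => e e0; apply: filterS (dcont x e0) => y xy.
  have := slip x y; have := slip y x; rewrite (dC y x) => h1 h2.
  by rewrite ltr_norml; apply/andP; split; lra.
- by rewrite divr_gt0.
- have : s x <= 1 by apply: ge_sup; [exact: S0|move=> e []].
  by have := s0 x; lra.
- have s20 : 0 < s x / 2 by rewrite divr_gt0.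
  have [e [e0 e1 eP] se] := sup_adherent s20 (supS x).
  apply: (@p_anti _ e) => //; first by apply: eP; rewrite d0.
  by rewrite -/(s x) in se; lra.
Qed.

End slack.

(** * Cut-off functions and the gluing of projections *)

Section cutoff_functions.
Variable R : realType.
Implicit Types (eps k f : R).

(** The ramp from 0 at eps to 1 at 2 eps, written with absolute values so that it transfers to
    operators by [absop]. *)
Definition cutv eps k := (2 * eps)^-1 * (`|k - eps| - `|k - 2 * eps| + eps).

(** 2 f truncated to [-1, 1]: the sign of f as soon as |f| >= 1/2. *)
Definition clampv f := `|f + 2^-1| - `|f - 2^-1|.

Lemma cutv_eq0 eps k : 0 < eps -> k <= eps -> cutv eps k = 0.
Proof.
move=> e0 ke; rewrite /cutv ler0_norm ?subr_le0// ler0_norm; last by lra.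
by rewrite (_ : _ + eps = 0) ?mulr0//; ring.
Qed.

Lemma cutv_eq1 eps k : 0 < eps -> 2 * eps <= k -> cutv eps k = 1.
Proof.
move=> e0 ke; rewrite /cutv ger0_norm; last by lra.
rewrite ger0_norm ?subr_ge0//; field; exact: lt0r_neq0.
Qed.

Lemma cutv_itv eps k : 0 < eps -> 0 <= cutv eps k <= 1.
Proof.
move=> e0; have [ke|ke] := leP k eps; first by rewrite cutv_eq0// lexx ler01.
have [ke2|ke2] := leP (2 * eps) k; first by rewrite cutv_eq1// lexx ler01.
have e20 : 0 < 2 * eps by lra.
rewrite /cutv ger0_norm; last by lra.
rewrite ler0_norm; last by lra.
rewrite mulrC divr_ge0 ?ler_pdivrMr//=; lra.
Qed.

Lemma clampv_eq1 f : 2^-1 <= f -> clampv f = 1.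
Proof.
by move=> f2; rewrite /clampv ger0_norm; [rewrite ger0_norm; lra|lra].
Qed.

Lemma clampv_eqN1 f : f <= - 2^-1 -> clampv f = - 1.
Proof.
by move=> f2; rewrite /clampv ler0_norm; [rewrite ler0_norm; lra|lra].
Qed.

End cutoff_functions.

Section cutoff_operators.
Variables (R : realType) (H : hilbertType R).
Implicit Types (F P T : bop H) (eps : R).

Definition scalop (r : R) : bop H := r%:C *: (1 : bop H).

(* For F = f(A), [kap F] is (1 + A^2)^-1; [cutoff eps F] is 0 where the latter is
   at most eps, hence where |A| >= 1 / eps, and 1 where it is at least 2 eps;
   [pos_sign F] is the indicator of A >= 0 away from |F| < 1/2. All three are
   built from absolute values, hence norm continuous in F. *)
Definition kap F : bop H := 1 - F * F.

Definition cutoff eps F : bop H := (2 * eps)^-1%:C *: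
  (absop (kap F - scalop eps) - absop (kap F - scalop (2 * eps)) + scalop eps).

Definition pos_sign F : bop H := 2^-1%:C *:
  ((1 : bop H) + (absop (F + scalop 2^-1) - absop (F - scalop 2^-1))).

(* P near the kernel of A, the spectral projection of A far from it *)
Definition glue eps F P : bop H := (1 - cutoff eps F * cutoff eps F) * pos_sign F +
  cutoff eps F * P * cutoff eps F.

Section diagonal.
Variables (e : nat -> H) (phi : nat -> R) (F : bop H).
Hypotheses (oe : orthonormal_seq e) (te : total_seq e) (hF : is_diag e phi F).

Lemma is_diag_const (r : R) : is_diag e (fun=> r) (scalop r).
Proof. by move=> n; rewrite /scalop bopZE bop1E. Qed.

Lemma is_diag_kap : is_diag e (fun n => 1 - phi n ^+ 2) (kap F).
Proof.
apply: is_diag_ext (is_diagB (is_diag1 e) (is_diagM hF hF)) => n /=.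
by rewrite expr2.
Qed.

Lemma is_diag_cutoff eps : is_diag e (fun n => cutv eps (1 - phi n ^+ 2)) (cutoff eps F).
Proof.
have [_ h1] := absop_diag oe te (is_diagB is_diag_kap (is_diag_const eps)).
have [_ h2] := absop_diag oe te (is_diagB is_diag_kap (is_diag_const (2 * eps))).
exact: (is_diagZ _ (is_diagD (is_diagB h1 h2) (is_diag_const eps))).
Qed.

Lemma is_diag_pos_sign : is_diag e (fun n => 2^-1 * (1 + clampv (phi n))) (pos_sign F).
Proof.
have [_ h1] := absop_diag oe te (is_diagD hF (is_diag_const 2^-1)).
have [_ h2] := absop_diag oe te (is_diagB hF (is_diag_const 2^-1)).
exact: (is_diagZ _ (is_diagD (is_diag1 e) (is_diagB h1 h2))).
Qed.

Lemma kap_diagonalizable (r : R) : diagonalizable (kap F - scalop r).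
Proof. by exists e; eexists; split=> //; exact: is_diagB is_diag_kap (is_diag_const r). Qed.

Lemma shift_diagonalizable (r : R) : diagonalizable (F + scalop r).
Proof. by exists e; eexists; split=> //; exact: is_diagD hF (is_diag_const r). Qed.

Lemma nrm_cutoff eps : 0 < eps -> nrm (cutoff eps F) <= 1.
Proof.
move=> e0; apply: (is_diag_nrm oe te ler01 (is_diag_cutoff eps)) => n.
by have /andP[h0 h1] := cutv_itv (1 - phi n ^+ 2) e0; rewrite ger0_norm.
Qed.

Lemma cutoff_self_adj eps : self_adj (cutoff eps F).
Proof. exact: (is_diag_self_adj oe te (is_diag_cutoff eps)). Qed.

End diagonal.

Lemma cvg_scale1 (I : Type) (G : set_system I) {FG : Filter G} (r : I -> R) (r0 : R) :
  r @ G --> r0 -> (fun i => scalop (r i)) @ G --> scalop r0.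
Proof. by move=> rr; apply: cvgZr_real => //; exact: cvg_cst. Qed.

Lemma cutoff_cvg (I : Type) (G : set_system I) {FG : Filter G} (f : I -> bop H) F
    (r : I -> R) (r0 : R) : (forall i, diagonalizable (f i)) -> diagonalizable F ->
  r0 != 0 -> r @ G --> r0 -> f @ G --> F ->
  (fun i => cutoff (r i) (f i)) @ G --> cutoff r0 F.
Proof.
move=> fd [e [phi [oe te hF]]] r00 rr fF.
have kd (g : I -> R) i : diagonalizable (kap (f i) - scalop (g i)).
  by have [e' [phi' [oe' te' hi]]] := fd i; exact: (kap_diagonalizable oe' te' hi).
have r2 : (fun i => 2 * r i) @ G --> 2 * r0 by exact: cvgMr.
have kF : (fun i => kap (f i)) @ G --> kap F.
  by apply: cvgB; [exact: cvg_cst|apply: cvg_bopM].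
apply: cvgZr_real; first by apply: cvgV => //; rewrite mulf_neq0.
apply: cvgD; last exact: cvg_scale1.
apply: cvgB; apply: absop_cvg.
- exact: (kd r).
- exact: (kap_diagonalizable oe te hF).
- by apply: cvgB => //; exact: cvg_scale1.
- exact: (kd (fun i => 2 * r i)).
- exact: (kap_diagonalizable oe te hF).
- by apply: cvgB => //; exact: cvg_scale1.
Qed.

Lemma pos_sign_cvg (I : Type) (G : set_system I) {FG : Filter G} (f : I -> bop H) F :
  (forall i, diagonalizable (f i)) -> diagonalizable F -> f @ G --> F ->
  (fun i => pos_sign (f i)) @ G --> pos_sign F.
Proof.
move=> fd [e [phi [oe te hF]]] fF.
have sd (r : R) i : diagonalizable (f i + scalop r).
  by have [e' [phi' [oe' te' hi]]] := fd i; exact: (shift_diagonalizable oe' te' hi).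
have sub (r : R) B : B - scalop r = B + scalop (- r) by rewrite /scalop rmorphN scaleNr.
apply: cvgZr_real; first exact: cvg_cst.
apply: cvgD; first exact: cvg_cst.
apply: cvgB; first apply: absop_cvg.
- exact: sd.
- exact: (shift_diagonalizable oe te hF).
- by apply: cvgD => //; exact: cvg_cst.
rewrite sub; under eq_fun do rewrite sub; apply: absop_cvg.
- exact: sd.
- exact: (shift_diagonalizable oe te hF).
- by apply: cvgD => //; exact: cvg_cst.
Qed.

Lemma glue_cvg (I : Type) (G : set_system I) {FG : Filter G} (f g : I -> bop H) F P
    (r : I -> R) (r0 : R) : (forall i, diagonalizable (f i)) -> diagonalizable F ->
  r0 != 0 -> r @ G --> r0 -> f @ G --> F -> g @ G --> P ->
  (fun i => glue (r i) (f i) (g i)) @ G --> glue r0 F P.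
Proof.
move=> fd Fd r00 rr fF gP; have cc := cutoff_cvg fd Fd r00 rr fF.
apply: cvgD; apply: cvg_bopM.
- by apply: cvgB; [exact: cvg_cst|apply: cvg_bopM; exact: cc].
- exact: pos_sign_cvg.
- by apply: cvg_bopM; [exact: cc|exact: gP].
- exact: cc.
Qed.

End cutoff_operators.

(** * Estimates for a single operator *)

Section pointwise.
Variables (R : realType) (H : hilbertType R) (A : regop H).
Variables (e : nat -> H) (lam : nat -> R).
Hypothesis Adata : eigen_data A e lam.

Let F := bounded_transform A.
Let E := spectral_projection `[0, +oo[ A.
Let oe : orthonormal_seq e. Proof. by case: Adata. Qed.
Let te : total_seq e. Proof. by case: Adata. Qed.
Let hF : is_diag e (fun n => btr (lam n)) F. Proof. exact: bounded_transformP. Qed.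
Let hE : is_diag e (\1_`[0, +oo[%classic \o lam) E.
Proof. by apply: spectral_projectionP => //; exact: measurable_itv. Qed.

Lemma eigen_diagonalizable : diagonalizable F.
Proof. by exists e, (fun n => btr (lam n)). Qed.

Lemma spectral_projection_proj (S : set R) : measurable S ->
  orthogonal_projection (spectral_projection S A).
Proof.
by move=> mS; apply: (is_diag_proj oe te (spectral_projectionP Adata mS)) => n; exact: indic_sqr.
Qed.

Lemma kappaE n : 1 - btr (lam n) ^+ 2 = (1 + lam n ^+ 2)^-1.
Proof. by rewrite btr_sqr opprB addrC subrK. Qed.

Lemma kappa_small (eps : R) : 0 < eps ->
  exists N, forall n, (N <= n)%N -> (1 + lam n ^+ 2)^-1 <= eps.
Proof.
move=> e0; have [_ _ lamD _] := Adata; have [N NP] := lamD (Num.sqrt eps^-1).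
exists N => n /NP h; rewrite -[leRHS]invrK lef_pV2 ?posrE ?sqr1D_gt0 ?invr_gt0//.
apply: (@le_trans _ _ (lam n ^+ 2)); last by rewrite lerDr.
rewrite -(real_normK (num_real (lam n))) -(@sqr_sqrtr _ eps^-1) ?invr_ge0 ?(ltW e0)//.
by rewrite ler_pXn2r ?nnegrE ?sqrtr_ge0.
Qed.

Lemma indic_ge (r t : R) : \1_(`[r, +oo[%classic : set R) t = (r <= t)%R%:R :> R.
Proof. by rewrite indicE mem_setE in_itv /= andbT. Qed.

Lemma indic_gt (r t : R) : \1_(`]r, +oo[%classic : set R) t = (r < t)%R%:R :> R.
Proof. by rewrite indicE mem_setE in_itv /= andbT. Qed.

(** The hypothesis says that [btr t ^+ 2] is at least 1/2, so [clampv] is saturated. *)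
Lemma btr_large (t : R) : (1 + t ^+ 2)^-1 <= 2^-1 ->
  2^-1 * (1 + clampv (btr t)) = (0 <= t)%R%:R.
Proof.
move=> h; have : 2^-1 <= btr t ^+ 2 by rewrite btr_sqr; lra.
have [t0|t0] := leP 0 t; move=> h2.
  rewrite clampv_eq1; first by rewrite /= mulr1n; field.
  by have := btr_ge0 t; rewrite t0; nra.
have b0 : btr t < 0 by rewrite ltNge btr_ge0 -ltNge.
by rewrite clampv_eqN1; [rewrite /= mulr0n; ring|nra].
Qed.

(** Where 1 - c is nonzero, (1 + lam^2)^-1 < 2 eps <= 1/2, hence the bound 1/4 on eps. This trades
    the discontinuous E for an operator continuous in F. *)
Lemma cutoff_pos_sign (eps : R) : 0 < eps -> eps <= 4^-1 ->
  (1 - cutoff eps F) * pos_sign F = (1 - cutoff eps F) * E.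
Proof.
move=> e0 e4; have h1 := is_diagB (is_diag1 e) (is_diag_cutoff oe te hF eps).
apply: (is_diag_uniq oe te (is_diagM h1 (is_diag_pos_sign oe te hF))).
apply: is_diag_ext (is_diagM h1 hE) => n /=; rewrite kappaE indic_ge.
have [k2|k2] := leP (2 * eps) (1 + lam n ^+ 2)^-1.
  by rewrite cutv_eq1// subrr !mul0r.
by rewrite btr_large//; lra.
Qed.

(** The ramp of eps' ends at 2 eps' <= eps, where that of eps begins, so 1 - c' = (1 - c') (1 -
    c). *)
Lemma cutoff_mono (eps eps' : R) K : 0 < eps' -> eps' <= eps / 2 ->
  nrm ((1 - cutoff eps' F) * K) <= nrm ((1 - cutoff eps F) * K).
Proof.
move=> e'0 e'e; have e0 : 0 < eps by lra.
have h1 := is_diagB (is_diag1 e) (is_diag_cutoff oe te hF eps').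
have h2 := is_diagB (is_diag1 e) (is_diag_cutoff oe te hF eps).
have -> : 1 - cutoff eps' F = (1 - cutoff eps' F) * (1 - cutoff eps F).
  apply: (is_diag_uniq oe te h1); apply: is_diag_ext (is_diagM h1 h2) => n /=.
  have [k2|k2] := leP eps (1 - btr (lam n) ^+ 2).
    by rewrite (cutv_eq1 e'0) ?subrr ?mul0r//; lra.
  by rewrite (cutv_eq0 e0) ?subr0 ?mulr1// ltW.
rewrite -mulrA -[leRHS]mul1r; apply: nrm_bopM_le => //.
apply: (is_diag_nrm oe te ler01 h1) => n /=.
by have /andP[h h'] := cutv_itv (1 - btr (lam n) ^+ 2) e'0; rewrite ger0_norm; lra.
Qed.

(** With 2 eps below the first N values of (1 + lam n^2)^-1, the operator 1 - c vanishes on the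
    first N basis vectors and [is_diag_tail_compact] applies. *)
Lemma cutoff_compact_small K (eta : R) : compact_op K -> 0 < eta ->
  exists eps, [/\ 0 < eps, eps <= 4^-1 & nrm ((1 - cutoff eps F) * K) <= eta].
Proof.
move=> cK eta0; have [N NP] := is_diag_tail_compact oe te cK eta0.
have [eps [e0 e4 eN]] : exists eps, [/\ 0 < eps, eps <= 4^-1 &
    forall n, (n < N)%N -> 2 * eps <= (1 + lam n ^+ 2)^-1].
  elim: N {NP} => [|N [eps [e0 e4 eN]]]; first by exists 4^-1; split.
  have k0 : 0 < (1 + lam N ^+ 2)^-1 by rewrite invr_gt0 sqr1D_gt0.
  exists (Num.min eps ((1 + lam N ^+ 2)^-1 / 2)); split.
  - by rewrite lt_min e0 divr_gt0.
  - by rewrite ge_min e4.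
  - move=> n; rewrite ltnS leq_eqVlt => /predU1P[->|/eN h].
      by rewrite mulrC -ler_pdivlMr// ge_min lexx orbT.
    by apply: le_trans h; rewrite ler_pM2l// ge_min lexx.
exists eps; split=> //.
apply: (NP _ _ (is_diagB (is_diag1 e) (is_diag_cutoff oe te hF eps))) => n /=.
  by have /andP[h h'] := cutv_itv (1 - btr (lam n) ^+ 2) e0; rewrite ger0_norm; lra.
by move=> nN; rewrite kappaE cutv_eq1 ?subrr// eN.
Qed.

Section glue.
Variables (P : bop H) (eps : R).
Hypotheses (hP : orthogonal_projection P) (PE : compact_op (P - E)).
Hypotheses (e0 : 0 < eps) (e4 : eps <= 4^-1).

Let c := cutoff eps F.

(** 1 - c^2 has the factor 1 - c, so [pos_sign] may be replaced by E; then c commutes with E. *)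
Lemma glueE : glue eps F P - P = c * (P - E) * c - (P - E).
Proof.
have hc := is_diag_cutoff oe te hF eps.
have h : (1 - c * c) * pos_sign F = (1 - c * c) * E.
  have -> : 1 - c * c = (1 + c) * (1 - c).
    by rewrite mulrDl mul1r mulrBr mulr1 addrA subrK.
  by rewrite -!mulrA cutoff_pos_sign.
rewrite /glue -/c h mulrBl mul1r.
have cE : c * c * E = c * E * c by rewrite -!mulrA (is_diag_comm oe te hc hE).
rewrite cE; move: (c) (E) => c' E'; apply: bopP => x; apply: rdot_ext => y.
by rewrite !bopE !rdotlE; ring.
Qed.

Lemma glue_compact : compact_op (glue eps F P - P).
Proof.
rewrite glueE; apply: compact_opB => //.
by apply: compact_opMr; exact: compact_opMl.
Qed.

(** With K = P - E, the difference is minus the sum of c K (1 - c) and (1 - c) K. Reversing the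
    order of two self-adjoint factors preserves the norm, by [nrm_self_adjM]. *)
Lemma glue_dist : nrm (glue eps F P - P) <= 2 * nrm ((1 - c) * (P - E)).
Proof.
rewrite glueE; set K := P - E.
have Ksa : self_adj K.
  by apply: self_adjB; [exact: proj_self_adj|exact: is_diag_self_adj hE].
have csa : self_adj (1 - c).
  by apply: self_adjB; [exact: self_adj1|exact: (cutoff_self_adj oe te hF)].
have -> : c * K * c - K = - (c * (K * (1 - c)) + (1 - c) * K).
  move: (c) (K) => c' K'; apply: bopP => x; apply: rdot_ext => y.
  by rewrite !bopE !rdotlE; ring.
rewrite nrmN; apply: (le_trans (nrmD _ _)); rewrite mulr_natl mulr2n lerD2r.
apply: (@le_trans _ _ (1 * nrm (K * (1 - c)))).
  by apply: nrm_bopM_le => //; exact: (nrm_cutoff oe te hF).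
by rewrite mul1r; exact: nrm_self_adjM.
Qed.

Lemma glue_self_adj : self_adj (glue eps F P).
Proof.
rewrite -(subrK P (glue eps F P)); apply: self_adjD; last exact: proj_self_adj.
rewrite glueE; have Ksa : self_adj (P - E).
  by apply: self_adjB; [exact: proj_self_adj|exact: is_diag_self_adj hE].
by apply: self_adjB => //; apply: self_adj_sandwich => //; exact: (cutoff_self_adj oe te hF).
Qed.

Let kappa_le n : eps^-1 <= `|lam n| -> (1 + lam n ^+ 2)^-1 <= eps.
Proof.
move=> h; rewrite -[leRHS]invrK lef_pV2 ?posrE ?sqr1D_gt0 ?invr_gt0//.
have e1 : 1 <= eps^-1 by rewrite invf_ge1//; move: e4; lra.
have : eps^-1 ^+ 2 <= lam n ^+ 2.
  by rewrite -(real_normK (num_real (lam n))) ler_pXn2r ?nnegrE ?invr_ge0 ?(ltW e0).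
nra.
Qed.

(** On the range of Y, (1 + lam^2)^-1 <= eps, so c vanishes and only [pos_sign] remains, equal to 1
    there. As a statement on fixed vectors it passes to [gap_proj]; [glue_lower] does the same for
    kernel vectors. *)
Lemma glue_upper (Y := spectral_projection `[eps^-1, +oo[ A) : glue eps F P * Y = Y.
Proof.
have hY : is_diag e (\1_`[eps^-1, +oo[%classic \o lam) Y.
  by apply: spectral_projectionP => //; exact: measurable_itv.
have hc := is_diag_cutoff oe te hF eps.
have ei0 : 0 < eps^-1 by rewrite invr_gt0.
have cY : c * Y = 0.
  apply: (bop_basis_eq oe te) => n; rewrite (is_diagM hc hY) /= kappaE indic_ge ?bop0E.
  case: (leP eps^-1 (lam n)) => h; last by rewrite mulr0 scale0r.
  by rewrite cutv_eq0 ?mul0r ?scale0r// kappa_le// (le_trans h (ler_norm _)).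
rewrite /glue mulrDl -(mulrA _ c Y) cY mulr0 addr0 mulrBl mul1r mulrBl -(mulrA (c * c)).
rewrite (is_diag_comm oe te (is_diag_pos_sign oe te hF) hY) (mulrA (c * c)) -(mulrA c c) cY.
rewrite mulr0 mul0r subr0.
apply: (is_diag_uniq oe te (is_diagM hY (is_diag_pos_sign oe te hF))).
apply: is_diag_ext hY => n /=; rewrite indic_ge.
case: (leP eps^-1 (lam n)) => h; last by rewrite mul0r.
rewrite btr_large ?mul1r ?(ltW (lt_le_trans ei0 h))//.
by apply: le_trans (kappa_le (le_trans h (ler_norm _))) _; move: e4; lra.
Qed.

Lemma glue_lower (Y := 1 - spectral_projection `]- eps^-1, +oo[ A) : glue eps F P * Y = 0.
Proof.
have hY : is_diag e (fun n => 1 - \1_`]- eps^-1, +oo[%classic (lam n)) Y.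
  apply: is_diagB; first exact: is_diag1.
  by apply: spectral_projectionP => //; exact: measurable_itv.
have hc := is_diag_cutoff oe te hF eps.
have ei0 : 0 < eps^-1 by rewrite invr_gt0.
have lamN n : lam n <= - eps^-1 -> eps^-1 <= `|lam n|.
  by move=> h; rewrite ler0_norm; [rewrite lerNr|lra].
have cY : c * Y = 0.
  apply: (bop_basis_eq oe te) => n; rewrite (is_diagM hc hY) /= kappaE indic_gt ?bop0E.
  case: (ltP (- eps^-1) (lam n)) => h; first by rewrite subrr mulr0 scale0r.
  by rewrite cutv_eq0 ?mul0r ?scale0r// kappa_le// lamN.
rewrite /glue mulrDl -(mulrA _ c Y) cY mulr0 addr0 mulrBl mul1r mulrBl -(mulrA (c * c)).
rewrite (is_diag_comm oe te (is_diag_pos_sign oe te hF) hY) (mulrA (c * c)) -(mulrA c c) cY.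
rewrite mulr0 mul0r subr0; apply: (bop_basis_eq oe te) => n.
rewrite (is_diagM hY (is_diag_pos_sign oe te hF)) /= indic_gt ?bop0E.
case: (ltP (- eps^-1) (lam n)) => h; first by rewrite subrr mul0r scale0r.
rewrite btr_large; last by apply: le_trans (kappa_le (lamN _ h)) _; move: e4; lra.
have -> : (0 <= lam n) = false by apply/negbTE; rewrite -ltNge; lra.
by rewrite mulr0 scale0r.
Qed.

End glue.

Lemma proj_dotp (P : bop H) x : orthogonal_projection P -> dotp (P x) x = (nrm (P x) ^+ 2)%:C.
Proof. by move=> [PP Psa]; rewrite -{1}PP Psa dotp_nrm. Qed.

Lemma op_le_proj (P Q : bop H) : orthogonal_projection P -> orthogonal_projection Q ->
  op_le P Q <-> Q * P = P.
Proof.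
move=> hP hQ; split=> [PQ|QP x].
  apply: bopP => x; rewrite bopME; have [PP _] := hP.
  have := PQ (P x); rewrite !proj_dotp// PP lecR => h.
  apply/eqP; rewrite -subr_eq0 -nrm_eq0 -sqrf_eq0 eq_le sqr_ge0 andbT.
  by rewrite nrm_sqrB proj_rdot//; lra.
rewrite !proj_dotp// lecR ler_pXn2r ?nnegrE ?nrm_ge0//.
have -> : P x = P (Q x).
  apply: rdot_ext => y; rewrite !(self_adj_rdot (proj_self_adj hP)).
  by rewrite (self_adj_rdot (proj_self_adj hQ)) -bopME QP.
exact: proj_nrm_le.
Qed.

Lemma op_le_proj_compl (P Q : bop H) : orthogonal_projection P -> orthogonal_projection Q ->
  op_le P Q <-> P * (1 - Q) = 0.
Proof.
move=> hP hQ; rewrite op_le_proj//; rewrite mulrBr mulr1; split=> [QP|/eqP].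
  apply/eqP; rewrite subr_eq0; apply/eqP/bopP => x; apply: rdot_ext => y.
  rewrite bopME !(self_adj_rdot (proj_self_adj hP)) (self_adj_rdot (proj_self_adj hQ)).
  by rewrite -bopME QP.
rewrite subr_eq0 => /eqP PQ; apply: bopP => x; apply: rdot_ext => y.
rewrite bopME (self_adj_rdot (proj_self_adj hQ)) !(self_adj_rdot (proj_self_adj hP)).
by rewrite -bopME -PQ.
Qed.

(** P - E = (E1 - E) + P (E3 - E1), where both differences of spectral projections only involve
    eigenvalues in [-r, r], hence have finite rank. *)
Lemma spectral_section_at_compact (P : bop H) (r : R) : orthogonal_projection P -> 0 < r ->
  spectral_section_at r A P -> compact_op (P - E).
Proof.
move=> hP r0 [lo up].
set E1 := spectral_projection _ _ in lo; set E3 := spectral_projection _ _ in up.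
have mE1 : measurable (`[r, +oo[%classic : set R) by exact: measurable_itv.
have mE3 : measurable (`]- r, +oo[%classic : set R) by exact: measurable_itv.
have h1 : is_diag e _ E1 := spectral_projectionP Adata mE1.
have h3 : is_diag e _ E3 := spectral_projectionP Adata mE3.
have PE1 : P * E1 = E1 by apply/op_le_proj => //; exact: spectral_projection_proj.
have PE3 : P * (1 - E3) = 0 by apply/op_le_proj_compl => //; exact: spectral_projection_proj.
have -> : P - E = (E1 - E) + P * (E3 - E1).
  have : P = E1 + P * (E3 - E1).
    rewrite mulrBr PE1; move/eqP: PE3; rewrite mulrBr mulr1 subr_eq0 => /eqP {1}->.
    by rewrite addrC subrK.
  by move=> {1}->; rewrite addrAC.
have [_ _ lamD _] := Adata; have [N NP] := lamD r.
apply: compact_opD.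
  apply: (is_diag_finite_compact oe te (N := N) (is_diagB h1 hE)) => n /NP rn /=.
  rewrite !indic_ge; have [l0|l0] := leP 0 (lam n).
    by rewrite (ger0_norm l0) in rn; rewrite rn subrr.
  by rewrite (_ : (r <= lam n) = false) ?subrr//; apply/negbTE; rewrite -ltNge; lra.
apply: compact_opMl; apply: (is_diag_finite_compact oe te (N := N) (is_diagB h3 h1)) => n /NP rn /=.
rewrite indic_ge indic_gt; have [l0|l0] := leP 0 (lam n).
  by rewrite (ger0_norm l0) in rn; rewrite rn (_ : (- r < lam n)) ?subrr//; lra.
rewrite (ltr0_norm l0) in rn.
rewrite (_ : (r <= lam n) = false); last by apply/negbTE; rewrite -ltNge; lra.
by rewrite (_ : (- r < lam n) = false) ?subrr//; apply/negbTE; rewrite -leNgt; lra.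
Qed.

(** For |b| <= 1 the distance from b to its sign is 1 - |b| <= 1 - b^2, the eigenvalue of (1 +
    A^2)^-1, which tends to 0. *)
Lemma bounded_transform_sign_compact : compact_op (F - (E + E - 1)).
Proof.
apply: (is_diag_compact oe te (is_diagB hF (is_diagB (is_diagD hE hE) (is_diag1 e)))) => eps eps0.
have [N NP] := kappa_small eps0; exists N => n /NP kn /=.
rewrite !indic_ge; apply: le_trans kn; rewrite -kappaE.
have b1 := btr_norm_le1 (lam n); rewrite ler_norml in b1.
move/andP: b1 => [b1 b2]; have := btr_ge0 (lam n).
have [l0|l0] := leP 0 (lam n) => /= b0; rewrite ?mulr1n ?mulr0n.
  by rewrite ler0_norm; [nra|lra].
have {}b0 : btr (lam n) < 0 by rewrite ltNge b0.
by rewrite ger0_norm; [nra|lra].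
Qed.

Lemma bounded_transform_self_adj : self_adj F.
Proof. exact: is_diag_self_adj hF. Qed.

(** |x|^2 - |F x|^2 = |S x|^2 with S = (1 + A^2)^(-1/2), which is injective. *)
Lemma bounded_transform_lt x : x != 0 -> nrm (F x) < nrm x.
Proof.
move=> x0; have hK := is_diag_kap hF.
have F2 : nrm (F x) ^+ 2 = nrm x ^+ 2 - rdot (kap F x) x.
  by rewrite bopBE bopME bop1E rdotBl (self_adj_rdot bounded_transform_self_adj) !rdot_nrm; ring.
have kn0 n : 0 < 1 - btr (lam n) ^+ 2 by rewrite kappaE invr_gt0 sqr1D_gt0.
have [|S hS] := @is_diag_ex _ _ e oe te (fun n => Num.sqrt (1 - btr (lam n) ^+ 2)) 1.
  move=> n; rewrite ger0_norm ?sqrtr_ge0// -[leRHS]sqrtr1 ler_wsqrtr//.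
  by rewrite gerBl sqr_ge0.
have SS : kap F = S * S.
  apply: (is_diag_uniq oe te hK); apply: is_diag_ext (is_diagM hS hS) => n /=.
  by rewrite -expr2 sqr_sqrtr// ltW.
rewrite -(@ltr_pXn2r _ 2)// ?nnegrE ?nrm_ge0// F2 gtrBl SS bopME.
rewrite (self_adj_rdot (is_diag_self_adj oe te hS)) rdot_nrm exprn_gt0// nrm_gt0.
apply: contraNneq x0 => Sx; apply/eqP; apply: te => n.
have := is_diag_coef oe te x n hS; rewrite Sx dotp0l => /esym/eqP.
rewrite mulf_eq0 (inj_eq (@complexI R)) sqrtr_eq0 leNgt kn0 /=.
by move/eqP.
Qed.

(** [btr] vanishes only at 0, and with eigenvalues tending to infinity injectivity already gives a
    bounded inverse. *)
Lemma invertible_bounded_transform :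
  invertible A <-> forall x, F x = 0 -> x = 0.
Proof.
rewrite (invertible_eigen Adata); split=> [l0 x Fx|inj n].
  apply: te => n; have := is_diag_coef oe te x n hF; rewrite Fx dotp0l => /esym/eqP.
  by rewrite mulf_eq0 (inj_eq (@complexI R)) /= btr_eq0 (negbTE (l0 n)) => /eqP.
apply/eqP => ln; have : e n = 0.
  by apply: inj; rewrite hF /= ln /btr mul0r scale0r.
by move/(congr1 (@nrm _ _)); rewrite nrm_orthonormal// nrm0 => /eqP; rewrite oner_eq0.
Qed.

End pointwise.

(** * Families: approximation by spectral sections, homotopy to invertible operators *)

Section families.
Variables (R : realType) (H : hilbertType R).
Hypothesis Hinf : infinite_dimensional H.
Variable X : topologicalType.
Implicit Types (A : X -> RKsa H) (P Q : X -> projections H).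

Lemma RKsa_eigen_data (A : RKsa H) : exists e lam, eigen_data (val A) e lam.
Proof. by have [sa cr] := set_mem (valP A); exact: eigen_data_ex. Qed.

Lemma projections_val (P : projections H) : orthogonal_projection (val P).
Proof. exact: set_mem (valP P). Qed.

Definition to_projections (T : bop H) (hT : orthogonal_projection T) : projections H :=
  exist _ T (mem_set hT).

Lemma RKsa_diagonalizable (A : RKsa H) : diagonalizable (bounded_transform (val A)).
Proof. by have [e [lam Ad]] := RKsa_eigen_data A; exact: eigen_diagonalizable Ad. Qed.

Lemma compact_opBD (S T U : bop H) : compact_op (S - T) -> compact_op (T - U) ->
  compact_op (S - U).
Proof. by move=> h1 h2; rewrite -(subrK T S) -addrA; exact: compact_opD. Qed.

Lemma proj_compact_defect (P D : bop H) : P * P = P -> compact_op D ->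
  compact_op (P + D - (P + D) * (P + D)).
Proof.
move=> PP cD; rewrite proj_perturb//.
apply: compact_opB => //; apply: compact_opD; last exact: compact_opMl.
by apply: compact_opD; [exact: compact_opMl|exact: compact_opMr].
Qed.

Lemma sqr1_perturb (G D : bop H) : G * G = 1 ->
  1 - (G + D) * (G + D) = - (G * D + D * G + D * D).
Proof.
move=> GG; rewrite mulrDl !mulrDr GG; apply: bopP => u; apply: rdot_ext => v.
by rewrite !bopE !rdotlE; ring.
Qed.

Lemma spectral_section_generalized A P : spectral_section A P -> generalized_spectral_section A P.
Proof.
move=> [Pc [r [_ r0 Pr]]]; split=> // x.
have [e [lam Ad]] := RKsa_eigen_data (A x).
exact: (spectral_section_at_compact Ad (projections_val (P x)) (r0 x) (Pr x)).
Qed.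

Section approximation.
Variables (A : X -> RKsa H) (P : X -> projections H) (eta : R).
Hypotheses (Ac : continuous A) (gP : generalized_spectral_section A P) (eta0 : 0 < eta).

Let F x := bounded_transform (val (A x)).
Let E x := spectral_projection `[0, +oo[ (val (A x)).
Let p x : bop H := val (P x).

Let defect eps x := nrm ((1 - cutoff eps (F x)) * (p x - E x)).

(** Compactness of P - E gives a suitable eps at each point; [continuous_slack] makes the choice
    continuous. [good] quantifies over all smaller values because it must be inherited by them. *)
Lemma defect_small : exists eps : X -> R, [/\ continuous eps, forall x, 0 < eps x,
  forall x, eps x <= 4^-1 & forall x, defect (eps x) x <= eta].
Proof.
have Fc : continuous F by exact/continuous_RKsaP.
have pc : continuous p by have [/continuous_projectionsP] := gP.
pose d x y := nrm (F x - F y) + nrm (p x - p y).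
pose good x eps := forall e' : R, 0 < e' -> e' <= eps -> e' <= 4^-1 -> defect e' x <= eta.
have [|x y|x y z|x e e0|x e e' h e'0 e'e e'' e''0 e''e|x|c [cc c0 c1 cP]] := @continuous_slack R X d good.
- by move=> x; rewrite /d !subrr !nrm0 addr0.
- by rewrite /d nrmBC (nrmBC (p x)).
- by have := nrm_dist (F x) (F y) (F z); have := nrm_dist (p x) (p y) (p z); rewrite /d; lra.
- have e20 : 0 < e / 2 by rewrite divr_gt0.
  have /cvg_nrmP/(_ _ e20) hF : F @ x --> F x by exact: Fc.
  have /cvg_nrmP/(_ _ e20) hp : p @ x --> p x by exact: pc.
  by apply: filterS2 hF hp => y h1 h2; rewrite /d [ltRHS]splitr; exact: ltrD.
- by apply: h => //; exact: le_trans e'e.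
- have [e [lam Ad]] := RKsa_eigen_data (A x).
  have eta20 : 0 < eta / 2 by rewrite divr_gt0.
  have [eps [eps0 eps4 hx]] := cutoff_compact_small Ad (proj2 gP x) eta20.
  (* With [pos_sign] in place of E, the defect at a fixed eps is continuous in y. *)
  have E_eq y : (1 - cutoff eps (F y)) * (p y - E y) = (1 - cutoff eps (F y)) * (p y - pos_sign (F y)).
    have [e' [lam' Ad']] := RKsa_eigen_data (A y).
    by rewrite !mulrBr (cutoff_pos_sign Ad').
  (* The ball is taken for d, not for the topology of X. A sequence of counterexamples tending to x
     for d makes F and p converge, which is all that the defect depends on. *)
  have [del del0 delP] : exists2 del : R, 0 < del & forall y, d x y < del -> defect eps y <= eta.
    apply: contrapT => /forall2NP nd.
    have /choice[y yP] n : exists y, d x y < n.+1%:R^-1 /\ eta < defect eps y.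
      have [/negP|/existsNP[y /not_implyP[h1 /negP]]] := nd n.+1%:R^-1.
        by rewrite invr_gt0 ltr0n.
      by rewrite -ltNge => h2; exists y.
    have dn : (fun n : nat => d x (y n)) @ \oo --> (0 : R).
      apply: (@squeeze_cvgr _ _ _ _ (fun=> 0) (fun n => n.+1%:R^-1)).
      - by apply: nearW => n; have [/ltW -> _] := yP n; rewrite /d addr_ge0 ?nrm_ge0.
      - exact: cvg_cst.
      - exact: cvg_harmonic.
    have Fy : (fun n => F (y n)) @ \oo --> F x.
      apply: (@cvg_nrm_le _ _ _ _ _ _ _ (fun n : nat => d x (y n))) => // n.
      by rewrite nrmBC /d lerDl nrm_ge0.
    have py : (fun n => p (y n)) @ \oo --> p x.
      apply: (@cvg_nrm_le _ _ _ _ _ _ _ (fun n : nat => d x (y n))) => // n.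
      by rewrite nrmBC /d lerDr nrm_ge0.
    have dy : (fun n => defect eps (y n)) @ \oo --> defect eps x.
      rewrite /defect E_eq; under eq_fun do rewrite E_eq.
      apply: nrm_cvg; apply: cvg_bopM; apply: cvgB.
      - exact: cvg_cst.
      - apply: cutoff_cvg => //; [|exact: RKsa_diagonalizable|exact: lt0r_neq0|exact: cvg_cst].
        by move=> n; exact: RKsa_diagonalizable.
      - exact: py.
      - apply: pos_sign_cvg => //; last exact: RKsa_diagonalizable.
        by move=> n; exact: RKsa_diagonalizable.
    have : eta <= defect eps x.
      by apply: (cvgr_to_ge dy); apply: nearW => n; have [_ /ltW] := yP n.
    by rewrite leNgt => /negP; apply; apply: le_lt_trans hx _; lra.
  exists (Num.min del (eps / 2)); first by rewrite lt_min del0 divr_gt0.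
  move=> y; rewrite lt_min => /andP[dy _] e' e'0; rewrite le_min => /andP[_ e'2] _.
  have [e1 [lam' Ad']] := RKsa_eigen_data (A y).
  by apply: le_trans (delP y dy); exact: (cutoff_mono Ad').
(* c <= 1, so the division enforces the bound 1/4. *)
- exists (fun x => c x / 4); split=> [x|x|x|x].
  + by apply: cvgMl; exact: cc.
  + by rewrite divr_gt0.
  + by have := c1 x; lra.
  + apply: cP => //; first by rewrite divr_gt0.
      by have := c0 x; lra.
    by have := c1 x; lra.
Qed.

End approximation.

Theorem spectral_section_approximation A P (eps : R) : continuous A ->
  generalized_spectral_section A P -> 0 < eps ->
  exists Q, [/\ spectral_section A Q, (sup_dist Q P < eps%:E)%E &
    homotopic_as_generalized A Q P].
Proof.
(* |D| <= 2 eta: 1/128 keeps it within the 1/64 of [near_projD], and 1/200 gives 41 * 2 eta < eps /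
   2. *)
move=> Ac gP eps0; pose eta := Num.min 128^-1 (eps / 200).
have eta0 : 0 < eta by rewrite lt_min invr_gt0 ltr0n divr_gt0.
have eta1 : eta <= 128^-1 by rewrite ge_min lexx.
have eta2 : eta <= eps / 200 by rewrite ge_min lexx orbT.
have [r [rc r0 r4 rP]] := defect_small Ac gP eta0.
have Fc : continuous (fun x => bounded_transform (val (A x))) by exact/continuous_RKsaP.
have pc : continuous (fun x => val (P x) : bop H) by have [/continuous_projectionsP] := gP.
pose F x := bounded_transform (val (A x)); pose p x : bop H := val (P x).
have hp x : orthogonal_projection (p x) by exact: projections_val.
pose D x := glue (r x) (F x) (p x) - p x.
have Dc x : compact_op (D x).
  have [e [lam Ad]] := RKsa_eigen_data (A x).
  exact: (glue_compact Ad (proj2 gP x) (r0 x) (r4 x)).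
have Dsa x : self_adj (D x).
  have [e [lam Ad]] := RKsa_eigen_data (A x); apply: self_adjB; last exact: proj_self_adj.
  exact: (glue_self_adj Ad (hp x) (r0 x) (r4 x)).
have Deta x : nrm (D x) <= 2 * eta.
  have [e [lam Ad]] := RKsa_eigen_data (A x).
  apply: (le_trans (glue_dist Ad (hp x) (r0 x) (r4 x))).
  by rewrite ler_pM2l//; exact: rP.
(* Shrinking the perturbation linearly joins the glued operator at t = 0 to P at t = 1, with the
   same norm bound throughout. *)
pose DD (z : X * unit_interval R) := (1 - val z.2)%:C *: D z.1.
have t01 (t : unit_interval R) : 0 <= val t <= 1.
  by have := set_mem (valP t); rewrite /unit_interval /= in_itv.
have DDeta z : nrm (DD z) <= 2 * eta.
  apply: le_trans (Deta z.1); rewrite nrmZr ler_piMl ?nrm_ge0//.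
  by have /andP[h0 h1] := t01 z.2; rewrite ger0_norm; lra.
have DD64 z : nrm (DD z) <= 64^-1 by apply: (le_trans (DDeta z)); lra.
pose hb z := gap_proj (p z.1 + DD z).
have nhb z : near_proj (p z.1 + DD z) by have [] := near_projD (hp z.1) (DD64 z).
have hbP z : orthogonal_projection (hb z).
  by apply: gap_proj_proj => //; apply: self_adjD; [exact: proj_self_adj|exact: self_adjZ].
pose h z := to_projections (hbP z).
have pfst : continuous (fun z : X * unit_interval R => p z.1).
  by move=> z; apply: (@continuous_comp _ _ _ fst p); [exact: cvg_fst|exact: pc].
have hbc : continuous hb.
  move=> z; apply: gap_proj_cvg => //; apply: cvgD; first exact: pfst.
  apply: cvgZr_real.
    apply: cvgB; first exact: cvg_cst.
    by apply: (@continuous_comp _ _ _ snd (fun t : unit_interval R => val t)); [exact: cvg_snd|exact: initial_continuous].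
  apply: cvgB; last exact: pfst.
  apply: glue_cvg.
  - by move=> i; exact: RKsa_diagonalizable.
  - exact: RKsa_diagonalizable.
  - exact: lt0r_neq0.
  - by apply: (@continuous_comp _ _ _ fst r); [exact: cvg_fst|exact: rc].
  - by apply: (@continuous_comp _ _ _ fst F); [exact: cvg_fst|exact: Fc].
  - exact: pfst.
have hc : continuous h by apply/continuous_projectionsP.
have pairc (t : unit_interval R) : continuous (fun x : X => (x, t)).
  move=> x; apply: (@cvg_pair _ _ _ (nbhs x) (nbhs x) (nbhs t) _ _ _ id (fun=> t)); [exact: cvg_id|exact: cvg_cst].
have gh t : generalized_spectral_section A (fun x => h (x, t)).
  split=> [x|x]; first by apply: (@continuous_comp _ _ _ (fun x => (x, t)) h); [exact: pairc|exact: hc].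
  apply: (compact_opBD _ (proj2 gP x)).
  apply: (@compact_opBD _ (p x + DD (x, t))).
    apply: gap_proj_compact; first exact: (nhb (x, t)).
    by apply: proj_compact_defect; [exact: proj_mul|exact: compact_opZ].
  by rewrite addrAC subrr add0r; exact: compact_opZ.
have i0 : unit_interval R 0 by rewrite /unit_interval /= in_itv /= lexx ler01.
pose t0 : unit_interval R := exist _ 0 (mem_set i0).
pose Q x := h (x, t0).
have hbQ x : hb (x, t0) = gap_proj (glue (r x) (F x) (p x)).
  by rewrite /hb /DD /= subr0 scale1r /D addrC subrK.
exists Q; split.
- split; first by have [] := gh t0.
  (* The operator cut-off at r x vanishes where |A| >= 1 / r x, whence this cut-off function. *)
  exists (fun x => (r x)^-1); split=> [x|x|x].
  + by apply: cvgV; [exact: lt0r_neq0|exact: rc].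
  + by rewrite invr_gt0.
  have [e [lam Ad]] := RKsa_eigen_data (A x).
  have ng : near_proj (glue (r x) (F x) (p x)).
    by have := nhb (x, t0); rewrite /DD /= subr0 scale1r /D addrC subrK.
  have mi1 : measurable (`[(r x)^-1, +oo[%classic : set R) by exact: measurable_itv.
  have mi2 : measurable (`]- (r x)^-1, +oo[%classic : set R) by exact: measurable_itv.
  split.
    apply/op_le_proj; [exact: (spectral_projection_proj Ad)|exact: hbP|].
    rewrite /= hbQ; apply: bopP => y; rewrite bopME; apply: gap_proj_fix => //.
    by rewrite -bopME (glue_upper Ad _ (r0 x) (r4 x)).
  apply/op_le_proj_compl; [exact: hbP|exact: (spectral_projection_proj Ad)|].
  rewrite /= hbQ; apply: bopP => y; rewrite bopME bop0E; apply: gap_proj_ker => //.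
  by rewrite -bopME (glue_lower Ad _ (r0 x) (r4 x)).
- apply: (@le_lt_trans _ _ (eps / 2)%:E); last by rewrite lte_fin ltr_pdivrMr// ltr_pMr// ltr1n.
  apply: ge_ereal_sup => _ [x _ <-]; rewrite lee_fin.
  apply: (@le_trans _ _ (nrm (hb (x, t0) - p x))); first exact: lexx.
  apply: (le_trans (gap_proj_dist_proj (hp x) (DD64 (x, t0)))).
  by have := DDeta (x, t0); lra.
- exists h; split=> //.
  + move=> x t tv; apply: val_inj; rewrite /= /hb /DD /= tv.
    by [].
  + move=> x t tv; apply: val_inj; rewrite /= /hb /DD /= tv subrr scale0r addr0.
    by rewrite gap_proj_id.
Qed.

Theorem generalized_homotopic_to_invertible A P : continuous A ->
  generalized_spectral_section A P -> homotopic_to_invertible A.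
Proof.
move=> Ac gP; pose F x := bounded_transform (val (A x)); pose p x : bop H := val (P x).
pose G x := p x + p x - 1.
have Fc : continuous F by exact/continuous_RKsaP.
have pc : continuous p by have [/continuous_projectionsP] := gP.
have hp x : orthogonal_projection (p x) by exact: projections_val.
have GG x : G x * G x = 1.
  rewrite /G mulrBl mulrDl !mulrBr !mulrDr !mul1r !mulr1 (proj_mul (hp x)).
  by apply: bopP => u; apply: rdot_ext => v; rewrite !bopE !rdotlE; ring.
have Gsa x : self_adj (G x).
  apply: self_adjB; last exact: self_adj1.
  by apply: self_adjD; exact: proj_self_adj.
have Gnrm x u : nrm (G x u) = nrm u.
  apply/eqP; rewrite -(@eqrXn2 _ 2)// ?nrm_ge0// -!rdot_nrm (self_adj_rdot (Gsa x)).
  by rewrite -bopME GG.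
(* The weight t / 2 keeps a positive share of F, the strict contraction. With weight t the end would
   be the isometry G, which is not a bounded transform. *)
pose K (z : X * unit_interval R) : bop H := (1 - val z.2 / 2)%:C *: F z.1 + (val z.2 / 2)%:C *: G z.1.
have t01 (t : unit_interval R) : 0 <= val t <= 1.
  by have := set_mem (valP t); rewrite /unit_interval /= in_itv.
have FGc x : compact_op (F x - G x).
  have [e [lam Ad]] := RKsa_eigen_data (A x); have cE := proj2 gP x.
  set E := spectral_projection `[0, +oo[ (val (A x)) in cE.
  have -> : F x - G x = (F x - (E + E - 1)) - ((p x - E) + (p x - E)).
    by apply: bopP => u; apply: rdot_ext => v; rewrite !bopE !rdotlE; ring.
  apply: compact_opB; first exact: bounded_transform_sign_compact Ad.
  exact: compact_opD.
have Fsa x : self_adj (F x).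
  by have [e [lam Ad]] := RKsa_eigen_data (A x); exact: bounded_transform_self_adj Ad.
have Flt x u : u != 0 -> nrm (F x u) < nrm u.
  by have [e [lam Ad]] := RKsa_eigen_data (A x); move=> u0; exact: (bounded_transform_lt Ad u0).
have KA z : exists B : RKsa H, bounded_transform (val B) = K z.
  have /andP[t0 t1] := t01 z.2; set t := val z.2 in t0 t1.
  apply: RKsa_of_bounded => //.
  - by apply: self_adjD; exact: self_adjZ.
  - move=> u u0; rewrite /K -/t !(bopDE, bopZE); apply: (le_lt_trans (nrmD _ _)).
    rewrite !nrmZr Gnrm.
    rewrite !ger0_norm; [|lra|lra].
    have := Flt z.1 u u0; set a := nrm (F z.1 u); set b := nrm u => ab.
    have : 0 < (1 - t / 2) * (b - a) by rewrite mulr_gt0 ?subr_gt0//; lra.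
    lra.
  - have KE : K z = G z.1 + (1 - t / 2)%:C *: (F z.1 - G z.1).
      rewrite /K -/t; apply: bopP => u; apply: rdot_ext => v.
      by rewrite !bopE !rdotlE; ring.
    set D := _ *: (_ - _) in KE; have cD : compact_op D by exact: compact_opZ.
    rewrite KE sqr1_perturb//.
    apply: compact_opN; apply: compact_opD; last exact: compact_opMl.
    by apply: compact_opD; [exact: compact_opMl|exact: compact_opMr].
(* K z prescribes B only through its bounded transform, so at t = 0 the value A is imposed;
   injectivity of the transform is not invoked. *)
have /choice[h hP] z : exists B : RKsa H, bounded_transform (val B) = K z /\ (val z.2 = 0 -> B = A z.1).
  have [z0|z0] := eqVneq (val z.2) 0.
    by exists (A z.1); split=> //; rewrite /K z0 mul0r subr0 scale0r addr0 scale1r.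
  by have [B hB] := KA z; exists B; split=> // z1; rewrite z1 eqxx in z0.
exists h; split.
- apply/continuous_RKsaP => z.
  rewrite (_ : (fun z => _) = K); last by apply/funext => z'; have [] := hP z'.
  have tc : (fun z : X * unit_interval R => val z.2 / 2) @ z --> val z.2 / 2.
    apply: cvgMl; apply: (@continuous_comp _ _ _ snd (fun t : unit_interval R => val t)).
      exact: cvg_snd.
    exact: initial_continuous.
  have pz : (fun z : X * unit_interval R => p z.1) @ z --> p z.1.
    by apply: (@continuous_comp _ _ _ fst p); [exact: cvg_fst|exact: pc].
  apply: cvgD; apply: cvgZr_real => //.
  + by apply: cvgB => //; exact: cvg_cst.
  + by apply: (@continuous_comp _ _ _ fst F); [exact: cvg_fst|exact: Fc].
  + by apply: cvgB; [exact: cvgD|exact: cvg_cst].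
- by move=> x t tv; have [_ ->] := hP (x, t).
- move=> x t tv; have [e [lam Ad]] := RKsa_eigen_data (h (x, t)).
  apply/(invertible_bounded_transform Ad) => u; have [-> _] := hP (x, t).
  rewrite /K -[(x, t).1]/x -[(x, t).2]/t tv bopDE !bopZE => Ku; apply/eqP/negPn/negP => u0; have := Flt x u u0.
  have FG : F x u = - G x u.
    apply/eqP; rewrite -addr_eq0; have := congr1 (fun v => 2%:C *: v) Ku.
    rewrite scalerDr !scalerA -!rmorphM scaler0 (_ : 2 * (1 - 1 / 2) = 1 :> R); last by field.
    by rewrite (_ : 2 * (1 / 2) = 1 :> R) ?scale1r => [->|]; [exact: eqxx|field].
  by rewrite FG nrmN Gnrm ltxx.
Qed.

End families.

(** * Transport of projections along a homotopy *)

Section transport.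
Variables (R : realType) (H : hilbertType R).
Hypothesis Hinf : infinite_dimensional H.
Variables (X : topologicalType) (h : X * unit_interval R -> RKsa H).
Hypothesis hc : continuous h.

Lemma clamp01_subproof (t : R) : unit_interval R (Num.max 0 (Num.min 1 t)).
Proof.
by rewrite /unit_interval /= in_itv /= le_max lexx /= ge_max ler01 ge_min lexx.
Qed.

(** Retraction of R onto the interval: the homotopy extends to all real times, so times can be
    computed without membership proofs. *)
Definition clamp01 (t : R) : unit_interval R :=
  exist (fun x : R => x \in unit_interval R) _ (mem_set (clamp01_subproof t)).

Lemma clamp01_val (t : R) : val (clamp01 t) = Num.max 0 (Num.min 1 t).
Proof. by []. Qed.

Lemma clamp01_continuous : continuous clamp01.
Proof.
apply: continuous_comp_initial => t /=.
apply: continuous_max; first exact: cvg_cst.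
by apply: continuous_min; [exact: cvg_cst|exact: cvg_id].
Qed.

Let G (x : X) (t : R) := bounded_transform (val (h (x, clamp01 t))).

Let Gc : continuous (fun z : X * R => G z.1 z.2).
Proof.
move=> z; apply: (@continuous_comp _ _ _ (fun z : X * R => (z.1, clamp01 z.2))
  (fun w => bounded_transform (val (h w)))); last by move/continuous_RKsaP : hc; exact.
apply: (@cvg_pair _ _ _ (nbhs z) (nbhs z.1) (nbhs (clamp01 z.2)) _ _ _ fst (clamp01 \o snd)).
  exact: cvg_fst.
by apply: continuous_comp; [exact: cvg_snd|exact: clamp01_continuous].
Qed.

(** The tube lemma. The radius joins the point y as a second parameter tending to 0 from the right,
    and compactness of [0, 1] makes both uniform in t. *)
Lemma transform_equicontinuous (x : X) (eta : R) : 0 < eta ->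
  exists2 del : R, 0 < del & \forall y \near x, forall t t', 0 <= t <= 1 -> `|t - t'| < del ->
    nrm (G y t' - G x t) < eta.
Proof.
move=> eta0; have eta20 : 0 < eta / 2 by rewrite divr_gt0.
have cov := (compact_near_coveringP `[(0 : R), 1]%classic).1 (@segment_compact R 0 1).
have := cov (X * R)%type (filter_prod (nbhs x) (0^'+ : set_system R))
  (fun w s => forall t', `|s - t'| < w.2 -> nrm (G w.1 t' - G x s) < eta) _.
case.
  move=> s _; have hG : (fun z : X * R => G z.1 z.2) @ (x, (s : R)) --> G x s.
    exact: (@Gc (x, s)).
  move/cvg_nrmP : hG => /(_ _ eta20).
  case=> -[U V] /= [xU sV] UV; have /nbhs_ballP[rho /= rho0 rhoV] := sV.
  have rho20 : 0 < rho / 2 by rewrite divr_gt0.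
  exists (ball s (rho / 2), U `*` [set d : R | d < rho / 2]).
    split; first exact: nbhsx_ballx.
    by exists (U, [set d : R | d < rho / 2]) => //=; split=> //; exact: nbhs_right_lt.
  move=> [s' [y d]] /= [ss' [Uy dr]] t' st'.
  have near_s z t'' : U z -> `|s - t''| < rho -> nrm (G x s - G z t'') < eta / 2.
    by move=> Uz st; apply: (UV (z, t'')); split=> //=; exact: rhoV.
  apply: (le_lt_trans (nrm_dist _ (G x s) _)); rewrite [ltRHS]splitr; apply: ltrD.
    rewrite nrmBC; apply: near_s => //; move: ss'; rewrite /ball /= => ss'.
    by have := ler_distD s' s t'; lra.
  apply: near_s; first exact: nbhs_singleton.
  by move: ss'; rewrite /ball /=; lra.
move=> [U V] /= [xU V0] UV.
have [del [Vdel del0]] := filter_ex (filterI V0 (nbhs_right_gt (0 : R))).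
exists del => //; apply: filterS xU => y Uy t t' t01 tt'.
by apply: (UV (y, del)) => //=; rewrite in_itv.
Qed.

(** The uniform distance over all times, used as pseudometric in [continuous_slack]. *)
Let d (x y : X) := sup [set nrm (G x t - G y t) | t in `[0, 1]%classic].

Let dset_sup x y : has_sup [set nrm (G x t - G y t) | t in `[(0 : R), 1]%classic].
Proof.
split; first by exists (nrm (G x 0 - G y 0)), 0 => //=; rewrite in_itv /= lexx ler01.
have G1 z t : nrm (G z t) <= 1.
  have [e [lam Ad]] := RKsa_eigen_data Hinf (h (z, clamp01 t)); have [oe te _ _] := Ad.
  by apply: (is_diag_nrm oe te ler01 (bounded_transformP Ad)) => n; exact: btr_norm_le1.
exists 2 => _ [t _ <-]; apply: (le_trans (nrmB _ _)).
by have := G1 x t; have := G1 y t; lra.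
Qed.

Let d_ge x y t : 0 <= t <= 1 -> nrm (G x t - G y t) <= d x y.
Proof.
by move=> t01; apply: sup_ubound; [exact: (dset_sup x y).2|exists t => //=; rewrite in_itv].
Qed.

Let d_le x y (M : R) : (forall t, 0 <= t <= 1 -> nrm (G x t - G y t) <= M) -> d x y <= M.
Proof.
move=> hM; apply: ge_sup; first exact: (dset_sup x y).1.
by move=> _ [t /= t01 <-]; apply: hM; rewrite in_itv in t01.
Qed.

(** A step moves the projection by half the variation of G, and 1/80 < 1/64 is admissible. At a
    nearby point the variation is at most 1/200 + 1/100 + 1/200 < 1/40. *)
Lemma mesh_ex : exists del : X -> R, [/\ continuous del, forall x, 0 < del x &
  forall x t t', 0 <= t <= 1 -> 0 <= t' <= 1 -> `|t - t'| <= del x ->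
    nrm (G x t - G x t') <= 40^-1].
Proof.
pose good x (e : R) := forall t t', 0 <= t <= 1 -> 0 <= t' <= 1 -> `|t - t'| <= e ->
    nrm (G x t - G x t') <= 40^-1.
have d0 x : d x x = 0.
  apply/eqP; rewrite eq_le; apply/andP; split; first by apply: d_le => t _; rewrite subrr nrm0.
  by apply: le_trans (@d_ge x x 0 _); rewrite ?nrm_ge0// lexx ler01.
have [|x y|x y z|x e e0|x e e' he e'0 e'e t t' t0 t1 tt'|x|c [cc c0 c1 cP]] := @continuous_slack R X d good.
- exact: d0.
- by apply/eqP; rewrite eq_le; apply/andP; split; apply: d_le => t t01; rewrite nrmBC; exact: d_ge.
- apply: d_le => t t01; apply: (le_trans (nrm_dist _ (G y t) _)).
  by apply: lerD; exact: d_ge.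
- have e20 : 0 < e / 2 by rewrite divr_gt0.
  have [del del0] := transform_equicontinuous x e20; apply: filterS => y hy.
  apply: (@le_lt_trans _ _ (e / 2)); last by rewrite ltr_pdivrMr// ltr_pMr// ltr1n.
  by apply: d_le => t t01; rewrite nrmBC ltW// hy// subrr normr0.
- by apply: he => //; exact: le_trans e'e.
- have e1 : 0 < 100^-1 :> R by rewrite invr_gt0 ltr0n.
  have [del del0 /nbhs_singleton hx] := transform_equicontinuous x e1.
  exists (Num.min (200^-1) (del / 2)); first by rewrite lt_min invr_gt0 ltr0n divr_gt0.
  move=> y; rewrite lt_min => /andP[dy _] t t' t01 t'01; rewrite le_min => /andP[_ tt'].
  have := hx t t' t01; rewrite (le_lt_trans tt') ?ltr_pdivrMr ?ltr_pMr ?ltr1n// => /(_ isT) hxt.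
  apply: (le_trans (nrm_dist _ (G x t) _)).
  have h1 : nrm (G y t - G x t) <= 200^-1 by rewrite nrmBC (le_trans (d_ge _ _ t01))// ltW.
  have h2 : nrm (G x t - G y t') <= nrm (G x t - G x t') + nrm (G x t' - G y t') by exact: nrm_dist.
  have h3 : nrm (G x t' - G y t') <= 200^-1 by rewrite (le_trans (d_ge _ _ t'01))// ltW.
  by rewrite nrmBC in hxt; lra.
- by exists c; split=> // x t t' ? ? ?; exact: cP.
Qed.

(** Invertibility at x keeps the eigenvalues of F x at distance 2 c from 0. When F y is c-close to F
    x, those of F y have modulus at least c, and [pos_sign] of c^-1 F y is the projection. *)
Lemma spectral_projection_invertible_continuous (B : X -> RKsa H) :
  continuous B -> (forall x, invertible (val (B x))) ->
  continuous (fun x => spectral_projection `[0, +oo[ (val (B x))).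
Proof.
move=> /continuous_RKsaP Fc Binv x; set F := fun x => bounded_transform (val (B x)) in Fc.
have [e [lam Ad]] := RKsa_eigen_data Hinf (B x); have [oe te lamD _] := Ad.
have l0 n : lam n != 0 by exact: (invertible_eigen Ad).1 (Binv x) n.
have [c c0 cP] : exists2 c : R, 0 < c & forall n, 2 * c <= `|btr (lam n)|.
  have [N NP] := kappa_small Ad (divr_gt0 ltr01 (ltr0n R 2)).
  have big n : (N <= n)%N -> 2^-1 <= `|btr (lam n)|.
    move=> /NP; rewrite -kappaE => hk; have := btr_norm_le1 (lam n).
    have : 2^-1 <= `|btr (lam n)| ^+ 2 by rewrite real_normK ?num_real//; lra.
    by have := normr_ge0 (btr (lam n)); set b := `|_|; nra.
  have [c c0 cP] : exists2 c : R, 0 < c & forall n, (n < N)%N -> 2 * c <= `|btr (lam n)|.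
    elim: {NP big} N => [|N [c c0 cP]]; first by exists 1.
    have b0 : 0 < `|btr (lam N)| by rewrite normr_gt0 btr_eq0.
    exists (Num.min c (`|btr (lam N)| / 2)); first by rewrite lt_min c0 divr_gt0.
    move=> n; rewrite ltnS leq_eqVlt => /predU1P[->|/cP h1].
      by rewrite mulrC -ler_pdivlMr// ge_min lexx orbT.
    by apply: le_trans h1; rewrite ler_pM2l// ge_min lexx.
  exists (Num.min c 4^-1) => [|n]; first by rewrite lt_min c0 invr_gt0 ltr0n.
  have [/cP h1|/big h1] := ltnP n N.
    by apply: le_trans h1; rewrite ler_pM2l// ge_min lexx.
  apply: le_trans h1; apply: (@le_trans _ _ (2 * 4^-1)); last by lra.
  by rewrite ler_pM2l// ge_min lexx orbT.
have EE y : nrm (F x - F y) < c ->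
    spectral_projection `[0, +oo[ (val (B y)) = pos_sign (c^-1%:C *: F y).
  move=> xy; have [e' [lam' Ad']] := RKsa_eigen_data Hinf (B y); have [oe' te' _ _] := Ad'.
  have hF' := bounded_transformP Ad'.
  have mi : measurable (`[0, +oo[%classic : set R) by exact: measurable_itv.
  apply: (is_diag_uniq oe' te' (spectral_projectionP Ad' mi)).
  apply: is_diag_ext (is_diag_pos_sign oe' te' (is_diagZ c^-1 hF')) => n /=.
  rewrite indic_ge.
  have big : c <= `|btr (lam' n)|.
    (* e' n is an eigenvector of F y, not of F x; the lower bound comes from the inverse D of F x,
       of norm at most 1 / (2 c). *)
    have hx : 2 * c <= nrm (F x (e' n)).
      have hF := bounded_transformP Ad.
      have [|D hD] := @is_diag_ex _ _ e oe te (fun n => (btr (lam n))^-1) (2 * c)^-1.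
        by move=> m; rewrite normfV lef_pV2 ?posrE ?normr_gt0 ?btr_eq0// mulr_gt0.
      have D1 : D * F x = 1.
        apply: (is_diag_uniq oe te (is_diagM hD hF)); apply: is_diag_ext (is_diag1 e) => m /=.
        by rewrite mulVf// btr_eq0.
      have c20 : 0 < 2 * c by rewrite mulr_gt0.
      have Dn : nrm D <= (2 * c)^-1.
        apply: (is_diag_nrm oe te _ hD); first by rewrite invr_ge0 ltW.
        by move=> m; rewrite normfV lef_pV2 ?posrE ?normr_gt0 ?btr_eq0.
      have : nrm (D (F x (e' n))) <= (2 * c)^-1 * nrm (F x (e' n)).
        by apply: (le_trans (nrm_bop _ _)); rewrite ler_wpM2r ?nrm_ge0.
      rewrite -bopME D1 bop1E nrm_orthonormal// mulrC ler_pdivlMr// mul1r.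
      by [].
    have : nrm (F y (e' n)) = `|btr (lam' n)| by rewrite hF' nrmZr nrm_orthonormal// mulr1.
    have : nrm ((F x - F y) (e' n)) <= c.
      apply: (le_trans (nrm_bop _ _)); rewrite nrm_orthonormal// mulr1; exact: ltW.
    rewrite bopBE; have := nrm_distB (F x (e' n)) (F y (e' n)); lra.
  have := btr_ge0 (lam' n); have [l0'|l0'] := leP 0 (lam' n) => b0; rewrite ?mulr1n ?mulr0n /=.
    rewrite ger0_norm// in big.
    by rewrite clampv_eq1; [field|rewrite ler_pdivlMl//; lra].
  have {}b0 : btr (lam' n) < 0 by rewrite ltNge b0.
  rewrite ltr0_norm// in big.
  by rewrite clampv_eqN1; [ring|rewrite ler_pdivrMl//; lra].
have hx := EE x; rewrite subrr nrm0 in hx.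
have dgl (y : X) : diagonalizable (c^-1%:C *: F y).
  have [e' [lam' Ad']] := RKsa_eigen_data Hinf (B y); have [oe' te' _ _] := Ad'.
  exists e', (fun n => c^-1 * btr (lam' n)); split=> //.
  exact: (is_diagZ c^-1 (bounded_transformP Ad')).
have psc : (fun y => pos_sign (c^-1%:C *: F y)) @ x --> pos_sign (c^-1%:C *: F x).
  by apply: pos_sign_cvg => //; apply: cvgZr_real; [exact: cvg_cst|exact: Fc].
rewrite /continuous_at hx//; apply/cvg_nrmP => eps eps0.
have /cvg_nrmP/(_ _ c0) Fx : F @ x --> F x by exact: Fc.
move/cvg_nrmP : psc => /(_ _ eps0); apply: filterS2 Fx => y xy.
by rewrite EE.
Qed.

Section steps.
Variables (P1 : X -> bop H) (del : X -> R).
Hypotheses (P1proj : forall x, orthogonal_projection (P1 x)) (P1c : continuous P1).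
Hypothesis P1G : forall x, compact_op (P1 x - 2^-1%:C *: (1 + G x 1)).
Hypotheses (delc : continuous del) (del0 : forall x, 0 < del x).
Hypothesis delP : forall x t t', 0 <= t <= 1 -> 0 <= t' <= 1 -> `|t - t'| <= del x ->
    nrm (G x t - G x t') <= 40^-1.

(* The times tau k x decrease from 1 to 0 with mesh del x; W transports P1 along
   them, each step being gap_proj of a small self-adjoint perturbation that is
   congruent to (1 + G x (tau k x)) / 2 modulo compact operators. *)
Let tau k x : R := Num.max 0 (1 - k%:R * del x).
Let D k x := 2^-1%:C *: (G x (tau k.+1 x) - G x (tau k x)).
Let W := fix W k x : bop H := if k is k'.+1 then gap_proj (W k' x + D k' x) else P1 x.

Let tau01 k x : 0 <= tau k x <= 1.
Proof.
rewrite /tau le_max lexx /= ge_max ler01 /= gerBl mulr_ge0// ltW//.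
Qed.

Let D64 k x : nrm (D k x) <= 64^-1.
Proof.
rewrite nrmZr ger0_norm; last by rewrite invr_ge0.
have : nrm (G x (tau k.+1 x) - G x (tau k x)) <= 40^-1.
  apply: delP => //; rewrite /tau.
  have -> : k.+1%:R * del x = k%:R * del x + del x by rewrite -natr1; ring.
  have := del0 x; set a := k%:R * del x => d0.
  have [h1|h1] := leP 0 (1 - (a + del x)); have [h2|h2] := leP 0 (1 - a);
    rewrite ler_norml; apply/andP; split; lra.
lra.
Qed.

Let Gsa x t : self_adj (G x t).
Proof.
have [e [lam Ad]] := RKsa_eigen_data Hinf (h (x, clamp01 t)).
exact: bounded_transform_self_adj Ad.
Qed.

Let Dsa k x : self_adj (D k x).
Proof. by apply: self_adjZ; apply: self_adjB. Qed.

Let Wproj k x : orthogonal_projection (W k x).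
Proof.
elim: k => [|k IH] /=; first exact: P1proj.
apply: gap_proj_proj; first by have [] := near_projD IH (D64 k x).
by apply: self_adjD => //; exact: proj_self_adj.
Qed.

Let Wnear k x : near_proj (W k x + D k x).
Proof. by have [] := near_projD (Wproj k x) (D64 k x). Qed.

Let kapG x t : compact_op (1 - G x t * G x t).
Proof.
have [e [lam Ad]] := RKsa_eigen_data Hinf (h (x, clamp01 t)); have [oe te _ _] := Ad.
apply: (is_diag_compact oe te (is_diag_kap (bounded_transformP Ad))) => eps eps0.
have [N NP] := kappa_small Ad eps0; exists N => n /NP.
by rewrite kappaE ger0_norm// invr_ge0 sqr1D_ge0.
Qed.

(** For q = (1 + g) / 2, q - q^2 = (1 - g^2) / 4; what C adds is compact. *)
Lemma half_sym_defect (g C : bop H) : compact_op (1 - g * g) -> compact_op C ->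
  compact_op (2^-1%:C *: (1 + g) + C - (2^-1%:C *: (1 + g) + C) * (2^-1%:C *: (1 + g) + C)).
Proof.
move=> cg cC; set q := 2^-1%:C *: (1 + g).
have -> : q + C - (q + C) * (q + C) = 4^-1%:C *: (1 - g * g) + (C - (q * C + C * q + C * C)).
  have -> : 4^-1%:C *: (1 - g * g) = q - q * q.
    by rewrite /q; apply: bopP => u; apply: rdot_ext => v; rewrite !bopE !rdotlE; field.
  by move: (q) => q'; rewrite mulrDl !mulrDr; apply: bopP => u; apply: rdot_ext => v;
    rewrite !bopE !rdotlE; ring.
apply: compact_opD; first exact: compact_opZ.
apply: compact_opB => //; apply: compact_opD; last exact: compact_opMl.
by apply: compact_opD; [exact: compact_opMl|exact: compact_opMr].
Qed.

Let WG k x : compact_op (W k x - 2^-1%:C *: (1 + G x (tau k x))).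
Proof.
elim: k => [|k IH].
  by rewrite /= /tau mul0r subr0 max_r ?ler01.
pose q := 2^-1%:C *: (1 + G x (tau k.+1 x)).
have TE : W k x + D k x = q + (W k x - 2^-1%:C *: (1 + G x (tau k x))).
  rewrite /q /D; move: (W k x) (G x _) (G x _) => w g1 g2.
  by apply: bopP => u; apply: rdot_ext => v; rewrite !bopE !rdotlE; ring.
apply: (@compact_opBD _ _ _ (W k x + D k x)).
  by apply: gap_proj_compact => //; rewrite TE; exact: half_sym_defect.
by rewrite TE addrAC subrr add0r.
Qed.

Let tauc k : continuous (tau k).
Proof.
move=> x; apply: (@continuous_comp _ _ _ (fun x => 1 - k%:R * del x) (fun r : R => Num.max 0 r)).
  by apply: cvgB; [exact: cvg_cst|apply: cvgMr; exact: delc].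
by apply: continuous_max; [exact: cvg_cst|exact: cvg_id].
Qed.

Let Gtauc k : continuous (fun x => G x (tau k x)).
Proof.
move=> x; apply: (@continuous_comp _ _ _ (fun x => (x, tau k x)) (fun z : X * R => G z.1 z.2)); last exact: Gc.
apply: (@cvg_pair _ _ _ (nbhs x) (nbhs x) (nbhs (tau k x)) _ _ _ id (tau k)).
  exact: cvg_id.
exact: tauc.
Qed.

Let Wc k : continuous (W k).
Proof.
elim: k => [|k IH]; first exact: P1c.
move=> x; apply: gap_proj_cvg => //; apply: cvgD; first exact: IH.
apply: cvgZr_real; first exact: cvg_cst.
by apply: cvgB; exact: Gtauc.
Qed.

(** Once the clamped times have reached 0 the increments vanish, and [gap_proj] fixes
    projections. *)
Let W_stable k m x : 1 <= k%:R * del x -> W (m + k) x = W k x.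
Proof.
move=> kd; have t0 j : (k <= j)%N -> tau j x = 0.
  move=> kj; rewrite /tau max_l// subr_le0; apply: (le_trans kd).
  by rewrite ler_wpM2r ?ler_nat// ltW.
elim: m => [//|m IH]; rewrite addSn /= IH /D !t0 ?leq_addl//; last by rewrite -addSn leq_addl.
by rewrite subrr scaler0 addr0 gap_proj_id.
Qed.

Lemma transported_projection : exists Q : X -> bop H, [/\ continuous Q,
  forall x, orthogonal_projection (Q x) &
  forall x, compact_op (Q x - 2^-1%:C *: (1 + G x 0))].
Proof.
pose K x := (Num.truncn (del x)^-1).+1.
have KP x (r : R) : (del x)^-1 <= r -> 1 <= (Num.truncn r).+1%:R * del x.
  move=> dr; rewrite -ler_pdivrMr// mul1r; apply: (le_trans dr).
  have r0 : 0 <= r by apply: le_trans dr; rewrite invr_ge0 ltW.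
  by have /andP[_ /ltW] := truncn_itv r0.
have KK x : 1 <= (K x)%:R * del x by exact: KP.
exists (fun x => W (K x) x); split=> [x|x|x] //.
(* The number of steps K y may jump. M steps suffice wherever del y > del x / 2, so by [W_stable] a
   fixed M serves near x. *)
- pose M := (Num.truncn (2 / del x)).+1.
  have nearM : \forall y \near x, W (K y) y = W M y.
    have d20 : 0 < del x / 2 by rewrite divr_gt0.
    have hdel : del @ x --> del x by exact: delc.
    move/cvgrPdist_lt : hdel => /(_ _ d20); apply: filterS => y.
    rewrite ltr_norml => /andP[_ dxy].
    have My : 1 <= M%:R * del y.
      apply: KP; rewrite -[2 / del x]invrK lef_pV2 ?posrE ?invr_gt0 ?divr_gt0//.
      by rewrite invf_div; lra.
    by rewrite -(W_stable M (KK y)) -(W_stable (K y) My) addnC.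
  have hW : W M @ x --> W M x by exact: Wc.
  apply/cvg_nrmP => eps eps0; move/cvg_nrmP : hW => /(_ _ eps0).
  have WKx := nbhs_singleton nearM.
  by apply: filterS2 nearM => y ->; rewrite WKx.
- have t0 : tau (K x) x = 0 by rewrite /tau max_l// subr_le0; exact: KK.
  by have := @WG (K x) x; rewrite t0.
Qed.

End steps.

End transport.

Theorem homotopic_to_invertible_generalized (R : realType) (H : hilbertType R)
    (Hinf : infinite_dimensional H) (X : topologicalType) (A : X -> RKsa H) :
  homotopic_to_invertible A -> exists P : X -> projections H, generalized_spectral_section A P.
Proof.
move=> [h [hc h0 h1]].
have c0 : val (clamp01 0 : unit_interval R) = 0 by rewrite clamp01_val min_r ?ler01// maxxx.
have c1 : val (clamp01 1 : unit_interval R) = 1 by rewrite clamp01_val minxx max_r ?ler01.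
pose B x := h (x, clamp01 1).
have Bc : continuous B.
  move=> x; apply: (@continuous_comp _ _ _ (fun x => (x, clamp01 1)) h); last exact: hc.
  by apply: (@cvg_pair _ _ _ (nbhs x) (nbhs x) (nbhs (clamp01 1)) _ _ _ id (fun=> clamp01 1));
    [exact: cvg_id|exact: cvg_cst].
have Binv x : invertible (val (B x)) by exact: h1.
(* Replaces the reference projection by (1 + F) / 2, which stays norm continuous along the
   homotopy. *)
have half (C : RKsa H) : compact_op (spectral_projection `[0, +oo[ (val C) -
    2^-1%:C *: (1 + bounded_transform (val C))).
  have [e [lam Ad]] := RKsa_eigen_data Hinf C.
  have -> : spectral_projection `[0, +oo[ (val C) - 2^-1%:C *: (1 + bounded_transform (val C)) =
     (- 2^-1)%:C *: (bounded_transform (val C) - (spectral_projection `[0, +oo[ (val C) +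
       spectral_projection `[0, +oo[ (val C) - 1)).
    move: (spectral_projection _ _) (bounded_transform _) => E F.
    by apply: bopP => u; apply: rdot_ext => v; rewrite !bopE !rdotlE; field.
  by apply: compact_opZ; exact: bounded_transform_sign_compact Ad.
have [del [delc del0 delP]] := mesh_ex Hinf hc.
have [|x|Q [Qc Qp QG]] := transported_projection Hinf hc _
  (spectral_projection_invertible_continuous Hinf Bc Binv) _ delc del0 delP.
- move=> x; have [e [lam Ad]] := RKsa_eigen_data Hinf (B x).
  by apply: (spectral_projection_proj Ad); exact: measurable_itv.
- exact: half.
exists (fun x => to_projections (Qp x)); split; first exact/continuous_projectionsP.
move=> x /=; apply: (compact_opBD (QG x)).
have -> : A x = h (x, clamp01 0) by rewrite h0.
by rewrite -opprB; apply: compact_opN; exact: half.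
Qed.

Theorem theorem4p4 (R : realType) (H : hilbertType R)
    (Hsep : separable_space H) (Hinf : infinite_dimensional H)
    (X : topologicalType) (A : X -> RKsa H) (A_Riesz : continuous A) :
  [/\ (exists P : X -> projections H, spectral_section A P) <->
      (exists P : X -> projections H, generalized_spectral_section A P),
      (exists P : X -> projections H, generalized_spectral_section A P) <->
      homotopic_to_invertible A &
      forall (P : X -> projections H) (eps : R),
        generalized_spectral_section A P -> 0 < eps ->
        exists Q : X -> projections H,
          [/\ spectral_section A Q,
              (sup_dist Q P < eps%:E)%E &
              homotopic_as_generalized A Q P]].
Proof.
have up P : generalized_spectral_section A P -> exists Q, spectral_section A Q.
  by move=> gP; have [Q [sQ _ _]] := spectral_section_approximation Hinf A_Riesz gP ltr01; exists Q.
split.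
- split=> [[P sP]|[P /up]]; last by [].
  by exists P; exact: spectral_section_generalized sP.
- split=> [[P gP]|]; first exact: generalized_homotopic_to_invertible gP.
  exact: homotopic_to_invertible_generalized.
- by move=> P eps gP eps0; exact: spectral_section_approximation.
Qed.
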